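(* Let $p$ be an odd prime, $S$ a finite $p$-group of sectional rank $3$ and $\mathcal{F}$ a saturated fusion system on $S$. Let $E$ be an $\mathcal{F}$-essential subgroup of $S$ that is not $\mathcal{F}$-characteristic in $S$, set $Z_S=\Omega_1(Z(S))$ and $Z_E=\langle Z_S\alpha:\alpha\in\mathrm{Aut}_{\mathcal{F}}(E)\rangle$. If $Z_S<Z_E$, then $E$ is abelian.
   Context: Rank: minimal size of a generating set; a $p$-group has sectional rank $k$ if all its subgroups have rank at most $k$ and $k$ is minimal. For $P\le S$, $\mathrm{Aut}_{\mathcal{F}}(P)=\mathrm{Hom}_{\mathcal{F}}(P,P)$, $\mathrm{Out}_{\mathcal{F}}(P)=\mathrm{Aut}_{\mathcal{F}}(P)/\mathrm{Inn}(P)$, $P^{\mathcal{F}}=\{P\alpha:\alpha\in\mathrm{Hom}_{\mathcal{F}}(P,S)\}$. $E\le S$ is $\mathcal{F}$-essential if $C_S(P)\le P$ and $|N_S(E)|\ge|N_S(P)|$ for all $P\in E^{\mathcal{F}}$, and $\mathrm{Out}_{\mathcal{F}}(E)$ has a strongly $p$-embedded subgroup. $E$ is $\mathcal{F}$-characteristic in $S$ if normalized by $\mathrm{Aut}_{\mathcal{F}}(S)$. $\Omega_1(A)$ is the subgroup generated by elements of order $p$. *)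

(* Defs.v *)
From mathcomp Require Import all_boot all_fingroup all_solvable.
Set Implicit Arguments. Unset Strict Implicit. Unset Printing Implicit Defensive.
Local Open Scope group_scope.

(* Fusion systems over a finite group S (an ambient finGroupType gT).
   A fusion system F is encoded by the boolean predicate  F P f  meaning
   "f, restricted to P, is a morphism in Hom_F(P,S)".  Morphisms are
   represented by finite functions gT -> gT, only their values on P matter. *)
Definition fsys (gT : finGroupType) := {set gT} -> {ffun gT -> gT} -> bool.

Section Fusion.
Variable gT : finGroupType.
Implicit Types (S P Q : {set gT}) (F : fsys gT) (f g : {ffun gT -> gT}).

Definition inj_hom_into S P (f : gT -> gT) :=
  [/\ {in P &, {morph f : x y / x * y}}, {in P &, injective f} & f @: P \subset S].

Definition is_fusion_system S F :=
  [/\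
      forall P f, F P f -> [/\ group_set P, P \subset S & inj_hom_into S P f],
      forall P f g, F P f -> {in P, f =1 g} -> F P g,
      forall P s, group_set P -> P \subset S -> s \in S -> F P [ffun x => x ^ s],
      forall P Q f g, F P f -> F Q g -> f @: P \subset Q -> F P [ffun x => g (f x)]
    &
      forall P f, F P f -> exists2 g, F (f @: P) g & {in P, cancel f g}].

Definition Fconj F P Q := exists2 f, F P f & f @: P = Q.

Definition fully_normalized S F P :=
  forall Q, Fconj F P Q -> #|'N_S(Q)| <= #|'N_S(P)|.
Definition fully_centralized S F P :=
  forall Q, Fconj F P Q -> #|'C_S(Q)| <= #|'C_S(P)|.

Definition AutF F P : {set {perm gT}} :=
  [set a in Aut P | F P [ffun x => a x]].
Definition AutS S P : {set {perm gT}} :=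
  [set a in Aut P | [exists s in 'N_S(P), [forall y in P, a y == y ^ s]]].
Definition Inn P : {set {perm gT}} := AutS P P.
Definition OutF F P := (AutF F P / Inn P)%g.

Definition Nphi S P f : {set gT} :=
  [set x in 'N_S(P) | [exists s in 'N_S(f @: P),
                        [forall y in P, f (y ^ x) == f y ^ s]]].

(* Saturation (Roberts--Shpectorov / Aschbacher--Kessar--Oliver axioms). *)
Definition saturated (p : nat) S F :=
  is_fusion_system S F /\
  (forall P, group_set P -> P \subset S -> fully_normalized S F P ->
     fully_centralized S F P /\ p.-Sylow(AutF F P) (AutS S P)) /\
  (forall P f, F P f -> fully_centralized S F (f @: P) ->
     exists2 g, F (Nphi S P f) g & {in P, f =1 g}).

End Fusion.

Definition strongly_p_embedded_in (p : nat) (T : finGroupType) (G : {set T}) :=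
  exists H : {group T},
    [/\ H \proper G, p %| #|H| &
        forall g, g \in G :\: H -> ~~ (p %| #|H :&: (H :^ g)|)].

Section Essential.
Variable gT : finGroupType.
Implicit Types (S E P : {set gT}) (F : fsys gT).

Definition F_essential (p : nat) S F E :=
  [/\ group_set E, E \subset S,
      forall P, Fconj F E P -> 'C_S(P) \subset P /\ #|'N_S(P)| <= #|'N_S(E)|
    & strongly_p_embedded_in p (OutF F E)].

Definition F_characteristic S F E :=
  forall a, a \in AutF F S -> a @: E = E.

Definition sectional_rank (S : {group gT}) k :=
  (forall H : {group gT}, H \subset S -> 'm(H) <= k) /\
  exists2 H : {group gT}, H \subset S & 'm(H) = k.

Definition Z_E F (S E : {group gT}) : {set gT} :=
  <<\bigcup_(a in AutF F E) (a @: 'Ohm_1('Z(S)))>>.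
End Essential.

(* Main.v *)
(* Put X = Omega_1(Z(E)), T = N_S(E), A = Aut_F(E), and suppose that E is not
   abelian. As Out_F(E) has a strongly p-embedded subgroup, every normal
   p-subgroup of A lies in Inn(E). As E is not F-characteristic in S, some
   automorphism al of T stabilises Z_S and moves E: an element of Aut_F(S) if
   T = S, conjugation by an element of N_S(T) otherwise.

   If C_T(X) <= E, rank 3 forces X and al(X) to meet in Z_S, |X| = p^2 and
   al(X) <= E; the commutators of E with al(X) then fill Z_S, and this makes
   Z_S invariant under A, against Z_S < Z_E.

   If C_T(X) is not contained in E, let D be the subgroup of elements of order
   dividing p in a Thompson critical subgroup of E. As C_A(X) has no normal
   p-subgroup outside Inn(E), rank 3 gives |X| = p^2, |D| = p^4, E = D Z(E) and
   |E'| = p, and T centralises X because X = E' Z_S. Replace X by a fully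
   normalised F-conjugate and put M = C_S(X). Every automorphism of X in F
   extends to M. Conjugation in S yields a transvection of X with centre Z_S,
   and A contains an element moving Z_S; so no characteristic subgroup of M
   lies strictly between 1 and X, and some automorphism g of M acts on X as a
   transvection with centre E'. Let Q / X = Omega_1(Z(M / X)), J = C_M(Q) and
   J0 = {u in J : u^p in Q, [u, M] <= Q}. Then Q is elementary abelian of order
   p^3, and u -> u^p maps J0 onto X with kernel Q. If [J0, J] <= X, applying g
   to a commutator [c, d] = 1 with c in J0 and Z(E) is contradictory; otherwise
   M has an elementary abelian quotient of order p^4. *)
Require Import Defs.
From mathcomp Require Import all_boot all_fingroup all_solvable.
Set Implicit Arguments. Unset Strict Implicit. Unset Printing Implicit Defensive.
Local Open Scope group_scope.

(** * Ranks and commutators in p-groups *)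

(** The obstacle is that automorphisms of E need not extend to ['N_S(E)], while automorphisms of X
    in F extend to ['C_S(X)] once X is fully normalised. Hence all that A has to offer is first
    condensed into [core_pair], conditions on E and its normaliser that mention no automorphism and
    survive an isomorphism; afterwards only characteristic subgroups of M and the two lifted
    automorphisms are available. Rank 3 enters in two dual ways: an elementary abelian quotient of a
    subgroup has order at most p^3, and an element of order p centralising an elementary abelian
    subgroup of order p^3 lies in it. The centre of g is taken to be E' because the commutators of E
    with Q lie in E': g fixes them, which confines g d to a group in which J has index p. Also g
    changes the p-th powers of elements of J0 only by elements of E', and these are p-th powers of
    elements t of J0 outside E. Such a t acts nontrivially on E / Z(E), while c in Z(E) commutes
    with d; so g must not mix c with t, but it does. *)

Lemma sectional_rank_index (gT : finGroupType) (p r : nat) (S H K : {group gT}) :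
    prime p -> (forall L : {group gT}, L \subset S -> 'm(L) <= r) ->
    H \subset S -> K <| H -> H^`(1) \subset K ->
    {in H, forall x, x ^+ p \in K} -> #|H : K| <= p ^ r.
Proof.
move=> p_pr rkS sHS nsKH sH'K Kp; have [sKH nKH] := andP nsKH.
have abHK: p.-abelem (H / K).
  apply/abelemP => //; split; first by rewrite sub_der1_abelian.
  move=> _ /morphimP[x Nx Hx ->]; rewrite -morphX //.
  by apply: coset_id; apply: Kp.
rewrite -card_quotient // (card_pgroup (abelem_pgroup abHK)).
rewrite leq_exp2l ?prime_gt1 // -(rank_abelem abHK) -grank_abelian ?(abelem_abelian abHK) //.
exact: leq_trans (quotient_grank nKH) (rkS _ sHS).
Qed.

Lemma sectional_rank_card (gT : finGroupType) (p r : nat) (S B : {group gT}) :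
    prime p -> (forall L : {group gT}, L \subset S -> 'm(L) <= r) ->
    B \subset S -> abelian B -> {in B, forall x, x ^+ p = 1} -> #|B| <= p ^ r.
Proof.
move=> p_pr rkS sBS abB eB; rewrite -indexg1.
apply: (sectional_rank_index p_pr rkS); rewrite ?normal1 //.
  by rewrite (derG1P abB).
by move=> x Bx; rewrite eB // set11.
Qed.

(** Otherwise [B] and [y] would generate an elementary abelian subgroup of order greater than
    [p ^ r]. *)
Lemma sectional_rank_adjoin (gT : finGroupType) (p r : nat) (S B : {group gT}) y :
    prime p -> (forall L : {group gT}, L \subset S -> 'm(L) <= r) ->
    B \subset S -> abelian B -> {in B, forall x, x ^+ p = 1} ->
    y \in S -> y \in 'C(B) -> y ^+ p = 1 -> p ^ r <= #|B| -> y \in B.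
Proof.
move=> p_pr rkS sBS abB eB Sy cBy yp oB.
have cBy': <[y]> \subset 'C(B) by rewrite cycle_subG.
have abY: abelian (B <*> <[y]>).
  by rewrite abelianY abB cycle_abelian.
have := @sectional_rank_card gT p r S [group of B <*> <[y]>] p_pr rkS.
rewrite join_subG sBS cycle_subG Sy => /(_ isT abY) le.
have /le {}le : {in [group of B <*> <[y]>], forall x, x ^+ p = 1}.
  move=> x; rewrite /= cent_joinEr // => /mulsgP[b c Bb Cc ->].
  have /cycleP[i ->] := Cc.
  rewrite expgMn; last by apply/commuteX/commute_sym; apply: (centP cBy).
  by rewrite eB // -expgM mulnC expgM yp expg1n mulg1.
have : B == B <*> <[y]> :> {set _}.
  by rewrite eqEcard joing_subl /= (leq_trans le).
by move/eqP->; rewrite mem_gen // inE cycle_id orbT.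
Qed.

Lemma morph_card_leq (aT rT : finGroupType) (G K : {group aT}) (X : {group rT})
    (f : aT -> rT) : {in G &, {morph f : x y / x * y}} ->
    {in G, forall x, f x \in X} ->
    (forall x, x \in G -> f x = 1 -> x \in K) -> #|G| <= #|X| * #|K|.
Proof.
move=> fM fX fK; pose phi := Morphism fM.
have ->: #|G| = (#|phi @* G| * #|'ker phi|)%N.
  by rewrite card_morphim setIid mulnC Lagrange // subsetIl.
apply: leq_mul; apply: subset_leq_card; apply/subsetP=> x.
  by case/morphimP=> y _ Gy ->; apply: fX.
by move=> kx; apply: fK; [case/morphpreP: kx | apply: (mker kx)].
Qed.

(** Since commutators of [X] with [D] lie in [Y], sending [u] to the coset of [[~ u, x]] is a
    homomorphism from [D] to [X / Y], and [K] contains its kernel. *)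
Lemma comm_card_leq (gT : finGroupType) (D X Y K : {group gT}) x :
    Y <| X -> {in X & D, forall z u, [~ z, u] \in Y} ->
    {in D, forall u, [~ u, x] \in X} ->
    (forall u, u \in D -> [~ u, x] \in Y -> u \in K) ->
  #|D| <= #|X : Y| * #|K|.
Proof.
move=> /andP[sYX nYX] XDY DX DK; rewrite -card_quotient //.
have XN z : z \in X -> z \in 'N(Y) by apply: (subsetP nYX).
apply: (@morph_card_leq _ _ D K (X / Y)%G (fun u => coset Y [~ u, x])).
- move=> u v Du Dv /=; rewrite commMgJ conjg_mulR.
  have Yz: [~ [~ u, x], v] \in Y by rewrite XDY ?DX.
  have Xu := XN _ (DX u Du); have Xv := XN _ (DX v Dv).
  have Xuv := XN _ (subsetP sYX _ Yz); have := coset_id Yz.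
  move: [~ u, x, v] Xuv => w Nw cw.
  move: [~ u, x] [~ v, x] Xu Xv => s t Ns Nt.
  by rewrite !morphM ?groupM //= cw mulg1.
- by move=> u Du; rewrite mem_quotient ?DX.
move=> u Du /= e1; apply: DK => //; apply: coset_idr e1.
by rewrite XN ?DX.
Qed.

(** The correction term is a power of the commutator with exponent p(p - 1)/2, a multiple of [p]
    because [p] is odd. *)
Lemma expMg_class2 (gT : finGroupType) p (u v : gT) :
    odd p -> commute u [~ v, u] -> commute v [~ v, u] -> [~ v, u] ^+ p = 1 ->
  (u * v) ^+ p = u ^+ p * v ^+ p.
Proof.
move=> odd_p cu cv cp; rewrite expMg_Rmul // bin2odd //.
by rewrite expgM cp expg1n mulg1.
Qed.

Lemma char_by_aut (gT : finGroupType) (M Q : {group gT}) :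
    Q \subset M -> (forall a x, a \in Aut M -> x \in Q -> a x \in Q) ->
  Q \char M.
Proof.
move=> sQM Qa; apply/charP; split=> // f injf fM; apply/eqP.
rewrite eqEcard card_injm // leqnn andbT; apply/subsetP=> y.
case/morphimP=> x Mx Qx ->; have := Qa _ _ (Aut_aut injf fM) Qx.
by rewrite autE.
Qed.

(** * Values of automorphisms on elements *)

Section AutElement.
Variables (gT : finGroupType) (G : {group gT}) (a : {perm gT}).
Hypothesis Aa : a \in Aut G.

Lemma Aut1E : a 1 = 1. Proof. by rewrite -(autmE Aa) morph1. Qed.

Lemma AutM x y : x \in G -> y \in G -> a (x * y) = a x * a y.
Proof. by move=> *; rewrite -(autmE Aa) morphM. Qed.

Lemma AutV x : x \in G -> a x^-1 = (a x)^-1.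
Proof. by move=> *; rewrite -(autmE Aa) morphV. Qed.

Lemma AutX n x : x \in G -> a (x ^+ n) = a x ^+ n.
Proof. by move=> *; rewrite -(autmE Aa) morphX. Qed.

Lemma AutR x y : x \in G -> y \in G -> a [~ x, y] = [~ a x, a y].
Proof. by move=> *; rewrite -(autmE Aa) morphR. Qed.

Lemma AutJ x y : x \in G -> y \in G -> a (x ^ y) = a x ^ a y.
Proof. by move=> *; rewrite -(autmE Aa) morphJ. Qed.

Lemma Aut_preimage x : x \in G -> exists2 y, y \in G & x = a y.
Proof.
move=> Gx; exists (a^-1 x); last by rewrite permKV.
exact: (Aut_closed (groupVr Aa)).
Qed.

Lemma char_Aut (Q : {group gT}) x : Q \char G -> x \in Q -> a x \in Q.
Proof.
move=> chQ Qx; have /charP[sQG /(_ _ (injm_autm Aa) (im_autm Aa)) <-] := chQ.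
by rewrite -{1}(autmE Aa) mem_morphim // (subsetP sQG).
Qed.

Lemma char_AutE (Q : {group gT}) x :
  Q \char G -> x \in G -> (a x \in Q) = (x \in Q).
Proof.
move=> chQ Gx; apply/idP/idP; last exact: char_Aut.
have /charP[sQG /(_ _ (injm_autm Aa) (im_autm Aa)) {1}<-] := chQ.
case/morphimP=> y Gy Qy /=; rewrite autmE => /perm_inj-> //.
Qed.

End AutElement.

(** [Z / Y] is a normal subgroup of order at most [p] in the p-group [P / Y], hence central. *)
Lemma pgroup_index_p_comm (gT : finGroupType) p (P Y Z : {group gT}) :
    prime p -> p.-group P -> Y \subset Z -> Z \subset P -> Y <| P -> Z <| P ->
    #|Z : Y| <= p -> {in Z & P, forall z x, [~ z, x] \in Y}.
Proof.
move=> p_pr pP sYZ sZP nsYP nsZP oZY z x Zz Px.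
have nYP := normal_norm nsYP.
have: Z / Y \subset 'Z(P / Y).
  have pZY : p.-group (Z / Y) by rewrite quotient_pgroup // (pgroupS sZP).
  have [-> | ntZY] := eqVneq (Z / Y)%g 1; first exact: sub1G.
  have /meet_center_nil : nilpotent (P / Y).
    by apply: (@pgroup_nil _ p); rewrite quotient_pgroup.
  move/(_ (Z / Y)%G (quotient_normal _ nsZP) ntZY) => ntI.
  have pr: prime #|Z / Y|.
    have [_ _ [n oZ]] := pgroup_pdiv pZY ntZY.
    have := oZY; rewrite -card_quotient ?(subset_trans sZP) // oZ -{2}(expn1 p).
    by rewrite leq_exp2l ?prime_gt1 // ltnS leqn0 => /eqP->; rewrite expn1.
  have := prime_meetG pr; move=> /(_ 'Z(P / Y)%G); apply; exact: ntI.
move/subsetP/(_ (coset Y z)); rewrite mem_quotient // => /(_ isT)/centerP[_ /(_ (coset Y x))].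
rewrite mem_quotient // => /(_ isT)/commgP.
have Nz: z \in 'N(Y) by rewrite (subsetP nYP) ?(subsetP sZP).
have Nx: x \in 'N(Y) by rewrite (subsetP nYP).
by rewrite -morphR // => /eqP/coset_idr; apply; rewrite groupR.
Qed.

(* For X normal in M, this is the preimage in N of Omega_1(Z(M / X)). *)
Definition upper (gT : finGroupType) p (M X N : {set gT}) : {set gT} :=
  [set m in N | (m ^+ p \in X) && [forall y in M, [~ m, y] \in X]].

Section Upper.
Variables (gT : finGroupType) (p : nat) (M X N : {group gT}).
Hypotheses (odd_p : odd p) (p_pr : prime p) (pM : p.-group M).
Hypotheses (nsXM : X <| M) (nsNM : N <| M) (sXN : X \subset N).
Hypotheses (cNX : N \subset 'C(X)) (eX : {in X, forall x, x ^+ p = 1}).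

Lemma upperP m : reflect [/\ m \in N, m ^+ p \in X &
  {in M, forall y, [~ m, y] \in X}] (m \in upper p M X N).
Proof.
rewrite inE; apply: (iffP and3P) => [[Nm mp /forall_inP mX] | [Nm mp mX]] //.
by split=> //; apply/forall_inP.
Qed.

Lemma upper_expM u v : u \in upper p M X N -> v \in upper p M X N ->
  (u * v) ^+ p = u ^+ p * v ^+ p.
Proof.
case/upperP=> Nu _ _ /upperP[Nv _ vX].
have Xvu : [~ v, u] \in X by apply: vX; apply: (subsetP (normal_sub nsNM)).
have cX w : w \in N -> commute w [~ v, u].
  by move=> Nw; apply: (centP (subsetP cNX _ Nw)).
by apply: expMg_class2; rewrite ?eX //; apply: cX.
Qed.

Lemma upper_group_set : group_set (upper p M X N).
Proof.
apply/group_setP; split=> [|u v Uu Uv].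
  by apply/upperP; split=> [||y _]; rewrite ?expg1n ?comm1g group1.
have e := upper_expM Uu Uv.
case/upperP: Uu Uv => Nu up uX /upperP[Nv vp vX].
apply/upperP; split=> [||y My]; first exact: groupM.
  by rewrite e groupM.
rewrite commMgJ groupM ?vX // memJ_norm ?uX //.
by rewrite (subsetP (normal_norm nsXM)) // (subsetP (normal_sub nsNM)).
Qed.
Canonical upper_group := Group upper_group_set.

Lemma sub_upper : X \subset upper p M X N.
Proof.
apply/subsetP=> x Xx; apply/upperP; split=> [||y My].
- exact: (subsetP sXN).
- by rewrite eX.
by rewrite commgEl groupM ?groupV // memJ_norm // (subsetP (normal_norm nsXM)).
Qed.

Lemma upper_sub : upper p M X N \subset N.
Proof. by apply/subsetP=> x /upperP[]. Qed.

(** [u ^ y] is [u * [~ u, y]] with the commutator in [X], of exponent [p]; so these p-th powers are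
    central in [M]. *)
Lemma upper_expJ u y : u \in upper p M X N -> y \in M ->
  (u ^+ p) ^ y = u ^+ p.
Proof.
move=> Uu My; have [Nu up uX] := upperP _ Uu.
rewrite conjXg conjg_mulR upper_expM //; last by rewrite (subsetP sub_upper) ?uX.
by rewrite (eX (uX y My)) mulg1.
Qed.

Lemma upper_char : X \char M -> N \char M -> upper_group \char M.
Proof.
move=> chX chN; have sNM := normal_sub nsNM.
apply: char_by_aut => [|a u Aa /= Uu]; first exact: subset_trans upper_sub sNM.
have [Nu up uX] := upperP _ Uu; have Mu := subsetP sNM _ Nu.
apply/upperP; split=> [||y My].
- exact: (char_Aut Aa chN).
- by rewrite -(AutX Aa) // (char_Aut Aa chX).
have [z Mz ->] := Aut_preimage Aa My.
by rewrite -(AutR Aa) // (char_Aut Aa chX) ?uX.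
Qed.

(** A nontrivial normal subgroup of the p-group [M / X] meets the centre, and Cauchy's theorem gives
    an element of order [p] there. *)
Lemma upper_nontrivial : ~~ (N \subset X) -> exists2 u, u \in upper p M X N & u \notin X.
Proof.
move=> nNX; have [nXM sNM] := (normal_norm nsXM, normal_sub nsNM).
have nXN := subset_trans sNM nXM.
have ntNX: N / X != 1 by rewrite -subG1 quotient_sub1.
have pMX: p.-group (M / X) by rewrite quotient_pgroup.
have ntI := meet_center_nil (pgroup_nil pMX) (quotient_normal X nsNM) ntNX.
have pI : p.-group (N / X :&: 'Z(M / X)).
  by rewrite (pgroupS _ pMX) // subIset // quotientS.
have [_ pdv _] := pgroup_pdiv pI ntI.
have [v /setIP[NXv Zv] ov] := Cauchy p_pr pdv.
have [u nu Nu dv] := morphimP NXv; exists u; last first.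
  apply/negP=> Xu; move: ov; rewrite dv /= coset_id // order1 => p1.
  by have := prime_gt1 p_pr; rewrite -p1.
apply/upperP; split=> // [|y My].
  by apply: coset_idr; rewrite ?groupX // morphX // -dv -ov expg_order.
have ny := subsetP nXM _ My.
apply: coset_idr; rewrite ?groupR // morphR // -dv; apply/eqP/commgP.
by case/centerP: Zv => _; apply; rewrite mem_quotient.
Qed.

Definition upper_powers : {set gT} := [set u ^+ p | u in upper p M X N].

Lemma upper_powers_group_set : group_set upper_powers.
Proof.
apply/group_setP; split=> [|_ _ /imsetP[u Uu ->] /imsetP[v Uv ->]].
  by apply/imsetP; exists 1; rewrite ?group1 ?expg1n.
by rewrite -upper_expM //; apply: imset_f; apply: groupM.
Qed.
Canonical upper_powers_group := Group upper_powers_group_set.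

Lemma upper_powers_sub : upper_powers \subset X :&: 'Z(M).
Proof.
apply/subsetP=> _ /imsetP[u Uu ->]; have [Nu up uX] := upperP _ Uu.
rewrite inE up; apply/centerP; split=> [|y My].
  by rewrite (subsetP (normal_sub nsXM)).
by apply/commgP; rewrite commgEl upper_expJ // mulVg.
Qed.

Lemma upper_powers_char : X \char M -> N \char M -> upper_powers_group \char M.
Proof.
move=> chX chN; have chU := upper_char chX chN; have sUM := char_sub chU.
apply: char_by_aut => [|a _ Aa /= /imsetP[u Uu ->]].
  apply: subset_trans upper_powers_sub _.
  by rewrite subIset ?(normal_sub nsXM).
rewrite (AutX Aa) ?(subsetP sUM) //; apply: imset_f.
exact: (char_Aut Aa chU).
Qed.

End Upper.

Lemma pgroup_card_ltn (gT : finGroupType) p n (Q : {group gT}) :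
  prime p -> p.-group Q -> p ^ n < #|Q| -> p ^ n.+1 <= #|Q|.
Proof.
move=> p_pr pQ; rewrite (card_pgroup pQ) ltn_exp2l ?prime_gt1 //.
by rewrite leq_exp2l ?prime_gt1.
Qed.

Lemma proper_pgroup_card (gT : finGroupType) p (G H : {group gT}) :
  prime p -> p.-group G -> H \proper G -> p * #|H| <= #|G|.
Proof.
move=> p_pr pG /andP[sHG nGH]; rewrite -(Lagrange sHG) mulnC leq_mul2l.
apply/orP; right; have := dvdn_indexg G H.
rewrite (card_pgroup pG) => /(dvdn_pfactor _ _ p_pr)[[|k] _ oGH].
  by move: nGH; rewrite -indexg_eq1 oGH expn0.
by rewrite oGH expnS leq_pmulr // expn_gt0 prime_gt0.
Qed.

(** Elimination over the field of [p] elements: [a] generates [Q / X]. For trivial [X] this says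
    that [a] generates [Q]. *)
Lemma quotient_p_combine (gT : finGroupType) p (Q X : {group gT}) a b :
    prime p -> p.-group Q -> X <| Q -> #|Q| <= p * #|X| ->
    a \in Q -> a \notin X -> b \in Q -> exists k, b * a ^+ k \in X.
Proof.
move=> p_pr pQ /andP[sXQ nXQ] oQ Qa nXa Qb.
have Na := subsetP nXQ _ Qa; have Nb := subsetP nXQ _ Qb.
have pQX : p.-group (Q / X) by rewrite quotient_pgroup.
have sub: <[coset X a]> \subset Q / X by rewrite cycle_subG mem_quotient.
have eqQ: <[coset X a]> = Q / X.
  apply/eqP; rewrite eqEcard sub /= card_quotient //.
  have: 1%G \proper <[coset X a]>.
    rewrite proper1G cycle_eq1; apply: contra nXa => /eqP e1.
    by apply: coset_idr.
  move/(proper_pgroup_card p_pr (pgroupS sub pQX)); rewrite cards1 muln1.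
  apply: leq_trans; rewrite -(leq_pmul2l (cardG_gt0 X)) Lagrange //.
  by rewrite mulnC.
have: coset X b^-1 \in <[coset X a]> by rewrite eqQ mem_quotient ?groupV.
case/cycleP=> k ek; exists k; apply: coset_idr; first by rewrite groupM ?groupX.
by rewrite morphM ?groupX // morphX // -ek -morphM ?groupV // mulgV morph1.
Qed.

Lemma norm_by_comm (gT : finGroupType) (E : {group gT}) q :
  {in E, forall e, [~ e, q] \in E} -> q \in 'N(E).
Proof.
move=> Eq; rewrite inE; apply/subsetP=> _ /imsetP[e Ee ->].
by rewrite conjg_mulR groupM ?Eq.
Qed.

Lemma commg_swap_in (gT : finGroupType) (H : {group gT}) x y :
  ([~ x, y] \in H) = ([~ y, x] \in H).
Proof. by rewrite -invg_comm groupV. Qed.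

Lemma expg_coprime_mem (gT : finGroupType) p (K : {group gT}) x k :
  prime p -> x ^+ k \in K -> x ^+ p \in K -> ~~ (p %| k) -> x \in K.
Proof.
move=> p_pr; case: (posnP k) => [-> | k_gt0]; first by rewrite dvdn0.
move=> Kk Kp; rewrite -prime_coprime // coprime_sym => /eqP co.
case: (egcdnP p k_gt0) => a b def_ab _; rewrite co in def_ab.
have := groupX a Kk; rewrite -expgM mulnC def_ab addn1 expgSr mulnC expgM.
by rewrite groupMl // groupX.
Qed.

(** * Centralisers of an element modulo a subgroup *)

Definition commker (gT : finGroupType) (M Y : {set gT}) u : {set gT} :=
  [set m in M | [~ m, u] \in Y].

Lemma commkerP (gT : finGroupType) (M Y : {set gT}) u m :
  reflect (m \in M /\ [~ m, u] \in Y) (m \in commker M Y u).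
Proof. by rewrite inE; apply: andP. Qed.

Lemma commker_sub (gT : finGroupType) (M Y : {set gT}) (u : gT) :
  commker M Y u \subset M.
Proof. by apply/subsetP=> m /commkerP[]. Qed.

Section CommKer.
Variables (gT : finGroupType) (M Y : {group gT}) (u : gT).
Hypothesis nYM : M \subset 'N(Y).

Lemma commker_group_set : group_set (commker M Y u).
Proof.
apply/group_setP; split=> [|m n /commkerP[Mm Ym] /commkerP[Mn Yn]].
  by apply/commkerP; rewrite group1 comm1g group1.
apply/commkerP; split; first exact: groupM.
by rewrite commMgJ groupM // memJ_norm // (subsetP nYM).
Qed.
Canonical commker_group := Group commker_group_set.

Variables (p : nat) (Z : {group gT}).
Hypotheses (nsYZ : Y <| Z) (sZM : Z \subset M).
Hypotheses (MZ : {in M, forall m, [~ m, u] \in Z}).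
Hypotheses (ZMY : {in Z & M, forall z m, [~ z, m] \in Y}).
Hypothesis (Zp : {in Z, forall z, z ^+ p \in Y}).

Lemma commker_card : #|M| <= #|Z : Y| * #|commker M Y u|.
Proof.
apply: (@comm_card_leq _ M Z Y commker_group u) => // m Mm Ym.
by apply/commkerP.
Qed.

Let f m := coset Y [~ m, u].

Let fM : {in M &, {morph f : m n / m * n}}.
Proof.
move=> m n Mm Mn; rewrite /f commMgJ conjg_mulR.
have [Zm Zn] := (MZ Mm, MZ Mn).
have Yc : [~ [~ m, u], n] \in Y by apply: ZMY.
have nZ : Z \subset 'N(Y) := normal_norm nsYZ.
have := coset_id Yc; have := subsetP (normG Y) _ Yc.
move: [~ m, u, n] => w Nw cw.
move: [~ m, u] [~ n, u] (subsetP nZ _ Zm) (subsetP nZ _ Zn) => s t Ns Nt.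
by rewrite !morphM ?groupM //= cw mulg1.
Qed.
Let phi := Morphism fM.

Let ker_phi : 'ker phi = commker M Y u.
Proof.
have nZ : Z \subset 'N(Y) := normal_norm nsYZ.
apply/setP=> m; apply/morphpreP/commkerP=> [[Mm /set1P fm] | [Mm Ym]].
  by split=> //; apply: coset_idr fm; apply: (subsetP nZ); apply: MZ.
by split=> //; apply/set1P; apply: coset_id.
Qed.

Let Zphi : {in M, forall m, phi m \in Z / Y}.
Proof. by move=> m Mm; rewrite mem_quotient ?MZ. Qed.

(** [m -> [~ m, u]] induces a homomorphism into [Z / Y], which is abelian because commutators of [Z]
    with [M] fall into [Y]. *)
Lemma der1_sub_commker : M^`(1) \subset commker M Y u.
Proof.
rewrite -ker_phi; suffices ab1: phi @* M^`(1) = 1.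
  apply/subsetP=> m M'm; have Mm := subsetP (der_sub 1 M) _ M'm.
  by apply/kerP=> //; apply/set1P; rewrite -[[set 1]]ab1 mem_morphim.
rewrite morphim_der //; apply/derG1P.
apply/centsP=> _ /morphimP[m _ Mm ->] _ /morphimP[n _ Mn ->].
have ab: abelian (Z / Y).
  apply: sub_der1_abelian; rewrite gen_subG.
  apply/subsetP=> _ /imset2P[z z' Zz Zz' ->]; apply: ZMY => //.
  exact: (subsetP sZM).
by apply: (centsP ab); apply: Zphi.
Qed.

Lemma expg_commker : {in M, forall m, m ^+ p \in commker M Y u}.
Proof.
move=> m Mm; rewrite -ker_phi; apply/kerP; first by rewrite groupX.
rewrite morphX //= /f -morphX ?(subsetP (normal_norm nsYZ)) ?MZ //.
by apply: coset_id; apply: Zp; apply: MZ.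
Qed.

End CommKer.

(** * The contradiction inside the centraliser of X *)

(** What the action of Aut_F(E) leaves behind once automorphisms are forgotten. [core_faithful] says
    that [T] modulo [E] acts faithfully on [E / 'Z(E)]; [core_comm] is the trace of an automorphism
    inverting [D / X]; [core_powers] is a consequence of rank 3. *)
Record core_pair (gT : finGroupType) p (T E X : {group gT}) : Prop := CorePair {
  core_sub : X \subset 'Z(E);
  core_card : #|X| = (p ^ 2)%N;
  core_exp : {in X, forall x, x ^+ p = 1};
  core_max : {in 'Z(E), forall x, x ^+ p = 1 -> x \in X};
  core_index : #|E : 'Z(E)| = (p ^ 2)%N;
  core_der : #|E^`(1)| = p;
  core_faithful :
    {in T, forall t, {in E, forall e, [~ e, t] \in 'Z(E)} -> t \in E};
  core_comm : {in E, forall q, q ^+ p = 1 ->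
    {in T, forall t, [~ q, t] \in X} -> {in T, forall t, [~ q, t] \in E^`(1)}};
  core_powers : {in E, forall e, e ^+ p \in E^`(1) -> e ^+ p = 1}
}.

Lemma core_der_sub (gT : finGroupType) p (T E X : {group gT}) :
  prime p -> p.-group E -> core_pair p T E X -> E^`(1) \subset X.
Proof.
move=> p_pr pE [_ _ _ maxX iEZ oE' _ _ _].
have nZ := normal_norm (center_normal E).
have sE'Z : E^`(1) \subset 'Z(E).
  apply: der1_min => //; apply: (@p2group_abelian _ p); first by rewrite quotient_pgroup.
  by rewrite card_quotient // iEZ pfactorK.
apply/subsetP=> z E'z; apply: maxX; first exact: (subsetP sE'Z).
by rewrite -oE' expg_cardG.
Qed.

Section CoreContradiction.
Variables (gT : finGroupType) (p : nat) (M E X : {group gT}) (g : {perm gT}).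
Hypotheses (p_pr : prime p) (odd_p : odd p) (pM : p.-group M).
Hypothesis rkM : forall L : {group gT}, L \subset M -> 'm(L) <= 3.
Hypotheses (sEM : E \subset M) (sXZM : X \subset 'Z(M)) (cME : 'C_M(E) \subset E).
Hypothesis coreE : core_pair p 'N_M(E)%G E X.
Hypothesis irrX : forall Y : {group gT},
  Y \char M -> Y \subset X -> Y :=: 1 \/ X \subset Y.
Hypotheses (Ag : g \in Aut M) (gE' : {in E^`(1), forall z, g z = z}).
Hypotheses (gX : {in X, forall x, x^-1 * g x \in E^`(1)}).
Hypothesis (g_nontriv : exists2 x, x \in X & g x != x).

Let T := 'N_M(E).
Let sXZE := core_sub coreE.
Let oX := core_card coreE.
Let eX := core_exp coreE.
Let maxX := core_max coreE.
Let iEZ := core_index coreE.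
Let oE' := core_der coreE.
Let faith := core_faithful coreE.
Let powE := core_powers coreE.
Let pE : p.-group E := pgroupS sEM pM.
Let p1 : 1 < p := prime_gt1 p_pr.
Let p0 : 0 < p := prime_gt0 p_pr.

Let sXE : X \subset E. Proof. exact: subset_trans sXZE (center_sub E). Qed.
Let sXM : X \subset M. Proof. exact: subset_trans sXE sEM. Qed.

Let sE'X : E^`(1) \subset X. Proof. exact: core_der_sub p_pr pE coreE. Qed.

Let E'_lt_X : X \subset E^`(1) -> False.
Proof.
by move/subset_leq_card; rewrite oX oE' leqNgt -{1}(expn1 p) ltn_exp2l.
Qed.

(** A central element of [M] centralises [E], hence lies in [E]. So [X] consists of the elements of
    order dividing [p] in ['Z(M)], which makes it characteristic. *)
Let Z_in_X z : z \in 'Z(M) -> z ^+ p = 1 -> z \in X.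
Proof.
case/centerP=> Mz cMz zp; apply: maxX => //; apply/centerP.
have cEz: {in E, forall y, commute z y}.
  by move=> y Ey; apply: cMz; apply: (subsetP sEM).
split=> //; apply: (subsetP cME); rewrite inE Mz; apply/centP => y Ey.
exact: cEz.
Qed.

Let chX : X \char M.
Proof.
apply: char_by_aut => // a x Aa Xx; apply: Z_in_X.
  by rewrite (char_Aut Aa (center_char M)) ?(subsetP sXZM).
by rewrite -(AutX Aa) ?(subsetP sXM) // eX // (Aut1E Aa).
Qed.

Let nsXM : X <| M := char_normal chX.
Let cMX : M \subset 'C(X).
Proof. by rewrite centsC; apply: subset_trans sXZM (subsetIr _ _). Qed.

Let QG := upper_group odd_p nsXM (normal_refl M) cMX eX.
Notation Q := (gval QG).

Let chQ : Q \char M. Proof. exact: upper_char (char_refl M). Qed.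
Let nsQM : Q <| M := char_normal chQ.
Let sQM : Q \subset M := normal_sub nsQM.

Let sXQ : X \subset Q. Proof. exact: sub_upper. Qed.

Let QX : {in Q & M, forall q y, [~ q, y] \in X}.
Proof. by move=> q y /upperP[_ _ qX] /qX. Qed.

Let sQT : Q \subset T.
Proof.
apply/subsetP=> q Qq; rewrite inE (subsetP sQM) //=.
apply: norm_by_comm => e Ee; rewrite commg_swap_in (subsetP sXE) // QX //.
exact: (subsetP sEM).
Qed.

(** [Q] acts trivially on [E / 'Z(E)], since its commutators with [E] lie in [X]. *)
Let sQE : Q \subset E.
Proof.
apply/subsetP=> q Qq; apply: faith => [|e Ee]; first exact: (subsetP sQT).
rewrite (subsetP sXZE) // commg_swap_in QX //; exact: (subsetP sEM).
Qed.

(** The derived group of [Q] is characteristic in [M] and contained in E', which is too small to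
    contain [X]; so irreducibility makes it trivial. *)
Let abQ : abelian Q.
Proof.
have sQ'E' : Q^`(1) \subset E^`(1) := dergS 1 sQE.
have chQ' : Q^`(1) \char M := char_trans (der_char 1 QG) chQ.
have [/derG1P // | s] := irrX chQ' (subset_trans sQ'E' sE'X).
by case: E'_lt_X; apply: subset_trans sQ'E'.
Qed.

Let E'_nontriv : exists2 z, z \in E^`(1) & z != 1.
Proof. by apply/trivgPn; rewrite trivg_card1 oE' neq_ltn p1 orbT. Qed.

(** The p-th powers form a characteristic subgroup of [X]. Were it all of [X], a nontrivial element
    of E' would be a p-th power in [E], against [core_powers]. *)
Let eQ : {in Q, forall q, q ^+ p = 1}.
Proof.
have chP := upper_powers_char odd_p nsXM (normal_refl M) sXM cMX eX chX (char_refl M).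
have sPX : upper_powers p M X M \subset X.
  by apply: subset_trans (upper_powers_sub _ _ _ _ _ _) _ => //; apply: subsetIl.
have [P1 q Qq | sXP] := irrX chP sPX.
  by apply/set1P; rewrite -[[set 1]]P1; apply: imset_f.
have [z E'z nz] := E'_nontriv.
have /imsetP[q Qq dz] := subsetP sXP z (subsetP sE'X _ E'z).
by move: nz; rewrite dz powE ?eqxx -?dz // (subsetP sQE).
Qed.

Let nMX : ~~ (M \subset X).
Proof.
apply/negP=> sMX; case: E'_nontriv => z; suffices /derG1P-> : abelian E.
  by move/set1P->; rewrite eqxx.
by apply: abelianS (subset_trans sEM sMX) (abelianS sXZE (center_abelian E)).
Qed.

Let q0_ex : exists2 q, q \in Q & q \notin X.
Proof. exact: upper_nontrivial. Qed.

Let pQ : p.-group Q := pgroupS sQM pM.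

Let oQ : #|Q| = (p ^ 3)%N.
Proof.
have [q Qq nXq] := q0_ex; apply/eqP; rewrite eqn_leq.
rewrite (sectional_rank_card p_pr rkM sQM abQ eQ) /=.
apply: pgroup_card_ltn pQ _ => //; rewrite -oX proper_card //.
by apply/properP; split=> //; exists q.
Qed.

Let nsXQ : X <| Q. Proof. exact: normalS nsXM. Qed.

Let le_QX : #|Q| <= p * #|X|. Proof. by rewrite oQ oX -expnS. Qed.

Let notZE q : q \in Q -> q \notin X -> q \notin 'Z(E).
Proof. by move=> Qq; apply: contra => Zq; apply: maxX => //; apply: eQ. Qed.

(** [X] is central in [M] and has index [p] in [Q], so [X] and [q] generate [Q]. *)
Let cent_q q m : q \in Q -> q \notin X -> m \in M -> [~ m, q] = 1 -> m \in 'C(Q).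
Proof.
move=> Qq nXq Mm /eqP/commgP cmq; apply/centP=> b Qb.
have [k Xk] := quotient_p_combine p_pr pQ nsXQ le_QX Qq nXq Qb.
have cmX : commute m (b * q ^+ k) by apply: (centP (subsetP cMX _ Mm)).
rewrite -(mulgK (q ^+ k) b); apply: commuteM => //.
exact/commuteV/commuteX.
Qed.

(** * The centraliser J of Q and its subgroup J0 *)

Let J := 'C_M(Q).
Let chJ : J \char M. Proof. exact: subcent_char (char_refl M) chQ. Qed.
Let nsJM : J <| M := char_normal chJ.
Let sJM : J \subset M := normal_sub nsJM.

Let q0 := s2val (sig2W q0_ex).
Let Qq0 : q0 \in Q. Proof. exact: s2valP (sig2W q0_ex). Qed.
Let nXq0 : q0 \notin X. Proof. exact: s2valP' (sig2W q0_ex). Qed.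

Let XM y : [~ q0, y] \in X -> [~ y, q0] \in X.
Proof. by rewrite commg_swap_in. Qed.

Let sXMQ : X \subset [~: M, Q].
Proof.
have ch : [~: M, Q] \char M := charR (char_refl M) chQ.
have sRX : [~: M, Q] \subset X.
  rewrite gen_subG; apply/subsetP=> _ /imset2P[m q Mm Qq ->].
  by rewrite commg_swap_in QX.
have [/commG1P cMQ | //] := irrX ch sRX.
case/negP: nXq0; apply: Z_in_X (eQ Qq0); rewrite inE (subsetP sQM) //=.
by rewrite (subsetP _ _ Qq0) // centsC.
Qed.

Let QE' q t : q \in Q -> t \in T -> [~ q, t] \in E^`(1).
Proof.
move=> Qq Tt; apply: (core_comm coreE) Tt => [||y /setIP[My _]].
- exact: (subsetP sQE).
- exact: eQ.
exact: QX.
Qed.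

Let nE'M : M \subset 'N(E^`(1)).
Proof. by apply: cents_norm; rewrite (subset_trans cMX) ?centS. Qed.

Let L := commker_group q0 nE'M.

Let sTL : T \subset L.
Proof.
apply/subsetP=> t Tt; apply/commkerP; split; first by case/setIP: Tt.
by rewrite commg_swap_in QE'.
Qed.

(** Otherwise [[~: M, Q]] would lie in E', whereas it contains [X]. *)
Let properLM : L \proper M.
Proof.
rewrite properE commker_sub; apply/negP=> sML.
case: E'_lt_X; apply: subset_trans sXMQ _; rewrite gen_subG.
apply/subsetP=> _ /imset2P[m q Mm Qq ->].
have [k Xk] := quotient_p_combine p_pr pQ nsXQ le_QX Qq0 nXq0 Qq.
have cX y : y \in X -> commute m y.
  by move=> Xy; apply: (centP (subsetP cMX _ Mm)).
have /commkerP[_ Lm] := subsetP sML _ Mm.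
have mq0k : [~ m, q0 ^+ k] \in E^`(1).
  rewrite commgX ?groupX //.
  apply: (centP (subsetP (subset_trans sQM cMX) _ Qq0)).
  exact: (subsetP sE'X).
have: [~ m, q * q0 ^+ k] \in E^`(1) by rewrite (eqP (introT commgP (cX _ Xk))).
rewrite commgMJ groupMl // memJ_norm //.
by rewrite (subsetP nE'M) // (subsetP sQM) // groupX.
Qed.

Let nTM : ~~ (M \subset T).
Proof. by apply: contraL properLM => sMT; rewrite properE (subset_trans sMT) ?andbF. Qed.

Let sJL : J \subset L.
Proof.
apply/subsetP=> j /setIP[Mj cQj]; apply/commkerP; split=> //.
by rewrite (eqP (introT commgP (centP cQj _ Qq0))) group1.
Qed.

Let d_ex : exists2 d, d \in E & [~ q0, d] != 1.
Proof.
apply/exists_inP; apply: contraR (notZE Qq0 nXq0) => /exists_inPn cq.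
apply/centerP; split=> [|d Ed]; first exact: (subsetP sQE).
by apply/commgP; apply: contraR (cq d Ed).
Qed.

Let properJL : J \proper L.
Proof.
have [d Ed nd] := d_ex; apply/properP; split=> //; exists d.
  by rewrite (subsetP sTL) // inE (subsetP sEM) // (subsetP (normG E)).
apply: contra nd => /setIP[_ cQd]; apply/commgP; apply: commute_sym.
exact: (centP cQd).
Qed.

Let iMJ : #|M| <= p ^ 2 * #|J|.
Proof.
rewrite -oX -(indexg1 X); apply: (@comm_card_leq _ M X 1%G [group of J] q0).
- exact: normal1.
- move=> x m Xx Mm; apply/set1P/eqP/commgP; apply: commute_sym.
  by apply: (centP (subsetP cMX _ Mm)).
- by move=> m Mm; rewrite XM ?QX.
by move=> m Mm /set1P cm; rewrite inE Mm (cent_q Qq0 nXq0).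
Qed.

(** The chain [J < L < M] is strict. Together with [iMJ] this shows that [J] has index exactly
    [p ^ 2] in [M]. *)
Let jMJ : p ^ 2 * #|J| <= #|M|.
Proof.
apply: leq_trans (proper_pgroup_card p_pr pM properLM).
rewrite -mulnA leq_pmul2l //.
exact: proper_pgroup_card p_pr (pgroupS (proper_sub properLM) pM) properJL.
Qed.

(** With [J] inside [Q], the order of [M] would be at most [p ^ 5]; but the strict chain [E < T < M]
    above a group [E] of order at least [p ^ 4] forces at least [p ^ 6]. *)
Let nJQ : ~~ (J \subset Q).
Proof.
apply/negP=> sJQ; have le_M : #|M| <= p ^ 5.
  apply: leq_trans iMJ _; rewrite (expnD p 2 3) leq_mul2l -oQ.
  by rewrite subset_leq_card ?orbT.
have ge_E : p ^ 4 <= #|E|.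
  rewrite -(Lagrange (center_sub E)) iEZ (expnD p 2 2) leq_mul2r -oX.
  by rewrite subset_leq_card ?orbT.
have pT : T \proper M by rewrite properE subsetIl.
have pET : E \proper T.
  apply: nilpotent_proper_norm (pgroup_nil pM) _.
  by rewrite properE sEM; apply: contra nTM => sME; rewrite subsetI subxx
     (subset_trans sME) ?normG.
have pTg : p.-group T := pgroupS (proper_sub pT) pM.
have := leq_trans (proper_pgroup_card p_pr pM pT) le_M.
have := proper_pgroup_card p_pr pTg pET; rewrite -(leq_pmul2l p0) => h1 h2.
have := leq_trans h1 h2; rewrite mulnA => h3.
have: p ^ 6 <= p ^ 5.
  apply: leq_trans h3; rewrite (expnD p 2 4) -[(p * p)%N]/(p ^ 2)%N.
  by rewrite leq_mul2l ge_E orbT.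
by rewrite leq_exp2l.
Qed.

Let sQJ : Q \subset J. Proof. by rewrite subsetI sQM. Qed.
Let cJQ : J \subset 'C(Q). Proof. exact: subsetIr. Qed.

Let J0G := upper_group odd_p nsQM nsJM cJQ eQ.
Notation J0 := (gval J0G).

Let chJ0 : J0 \char M. Proof. exact: upper_char. Qed.
Let sJ0M : J0 \subset M := char_sub chJ0.
Let sQJ0 : Q \subset J0. Proof. exact: sub_upper. Qed.
Let sJ0J : J0 \subset J. Proof. exact: upper_sub. Qed.

Let J0Q u y : u \in J0 -> y \in M -> [~ u, y] \in Q.
Proof. by move=> /upperP[_ _ uQ] /uQ. Qed.

Let J0expM u v : u \in J0 -> v \in J0 -> (u * v) ^+ p = u ^+ p * v ^+ p.
Proof. exact: upper_expM. Qed.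

Let J0comm q u : q \in Q -> u \in J0 -> commute q u.
Proof.
move=> Qq Ju; apply: commute_sym; apply: (centP (subsetP cJQ _ _)) => //.
exact: (subsetP sJ0J).
Qed.

Let J0commM u v m : u \in J0 -> v \in J0 -> m \in M ->
  [~ u * v, m] = [~ u, m] * [~ v, m].
Proof.
move=> Ju Jv Mm; rewrite commMgJ conjgE (J0comm (J0Q Ju Mm) Jv).
by rewrite mulKg.
Qed.

Let J0commX u k m : u \in J0 -> m \in M -> [~ u ^+ k, m] = [~ u, m] ^+ k.
Proof. by move=> Ju Mm; apply: commXg; apply/commute_sym/J0comm/Ju/J0Q. Qed.

Let J0pow u : u \in J0 -> u ^+ p \in X.
Proof.
move=> Ju; have: u ^+ p \in Q :&: 'Z(M).
  have sP := upper_powers_sub odd_p nsQM nsJM sQJ cJQ eQ.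
  by apply: (subsetP sP); apply: imset_f.
by case/setIP=> Qu Zu; apply: Z_in_X => //; apply: eQ.
Qed.

(** Rank 3: [u] centralises the elementary abelian group [Q] of order [p ^ 3]. *)
Let J0ker u : u \in J0 -> u ^+ p = 1 -> u \in Q.
Proof.
move=> Ju up; apply: sectional_rank_adjoin p_pr rkM sQM abQ eQ _ _ up _.
- exact: (subsetP sJ0M).
- exact: (subsetP (subset_trans sJ0J cJQ)).
by rewrite oQ.
Qed.

(** The p-th powers of [J0] form a characteristic subgroup of [X], nontrivial by [J0ker] because
    [J0] has elements outside [Q]. *)
Let J0surj x : x \in X -> exists2 u, u \in J0 & u ^+ p = x.
Proof.
have ch := upper_powers_char odd_p nsQM nsJM sQJ cJQ eQ chQ chJ.
have sPX : upper_powers p M Q J \subset X.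
  by apply/subsetP=> _ /imsetP[u Ju ->]; apply: J0pow.
have [u Ju nQu] := upper_nontrivial p_pr pM nsQM nsJM nJQ.
case: (irrX ch sPX) => [P1 | sXP Xx].
  case/negP: nQu; apply: J0ker => //; apply/set1P.
  by rewrite -[[set 1]]P1; apply: imset_f.
by have /imsetP[v Jv ->] := subsetP sXP _ Xx; exists v.
Qed.

Let sJ0T : J0 \subset T.
Proof.
apply/subsetP=> u Ju; rewrite inE (subsetP sJ0M) //=.
apply: norm_by_comm => e Ee; rewrite commg_swap_in (subsetP sQE) // J0Q //.
exact: (subsetP sEM).
Qed.

(** The p-th powers of [N0], the part of [J0] centralising [J] modulo [X], form a characteristic
    subgroup of [X]. If it is trivial, [N0] lies in [Q]; if it is [X], every element of [J0] differs
    from one of [N0] by an element with trivial p-th power, that is, an element of [Q]. *)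
Let J0_dichotomy :
  {in J0 & J, forall u j, [~ u, j] \in X} \/
  (forall u, u \in J0 -> u \notin Q -> exists2 j, j \in J & [~ u, j] \notin X).
Proof.
pose N0 := [set u in J0 | [forall j in J, [~ u, j] \in X]].
have N0P u : reflect (u \in J0 /\ {in J, forall j, [~ u, j] \in X}) (u \in N0).
  by rewrite [u \in N0]inE; apply: (iffP andP) => -[-> /forall_inP].
have JM j : j \in J -> j \in M by apply: (subsetP sJM).
have gN0 : group_set N0.
  apply/group_setP; split=> [|u v /N0P[Ju uX] /N0P[Jv vX]].
    by apply/N0P; split=> // j _; rewrite comm1g.
  apply/N0P; split=> [|j Jj]; first exact: groupM.
  by rewrite J0commM ?JM // groupM ?uX ?vX.
pose P := [set u ^+ p | u in N0].
have gP : group_set P.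
  apply/group_setP; split=> [|_ _ /imsetP[u Nu ->] /imsetP[v Nv ->]].
    by apply/imsetP; exists 1; rewrite ?expg1n // (group1 (Group gN0)).
  have [[Ju _] [Jv _]] := (N0P _ Nu, N0P _ Nv).
  by rewrite -J0expM //; apply: imset_f; apply: (@groupM _ (Group gN0)).
have sPX : P \subset X.
  by apply/subsetP=> _ /imsetP[u /N0P[Ju _] ->]; apply: J0pow.
have chP : Group gP \char M.
  apply: char_by_aut => [|a _ Aa /imsetP[u /N0P[Ju uX] ->]].
    exact: subset_trans sPX sXM.
  have Mu := subsetP sJ0M _ Ju; rewrite (AutX Aa) //; apply: imset_f.
  apply/N0P; split=> [|j Jj]; first exact: (char_Aut Aa chJ0).
  have [j' Mj' dj] := Aut_preimage Aa (JM _ Jj); move: Jj; rewrite {j}dj.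
  by rewrite (char_AutE Aa chJ) // -(AutR Aa) // => /uX; apply: (char_Aut Aa chX).
have [P1 | sXP] := irrX chP sPX; [right | left].
  move=> u Ju nQu; apply/exists_inP; apply: contraR nQu => /exists_inPn uX.
  apply: J0ker => //; apply/set1P; rewrite -[[set 1]]P1; apply: imset_f.
  by apply/N0P; split=> // j /uX; rewrite negbK.
move=> u j Ju Jj; have /imsetP[v /N0P[Jv vX] e] := subsetP sXP _ (J0pow Ju).
have Qq : u * v^-1 \in Q.
  apply: J0ker; first by rewrite groupM ?groupV.
  by rewrite J0expM ?groupV // e -expgMn ?mulgV ?expg1n //; apply: commuteV.
rewrite -(mulgKV v u) J0commM ?JM //; last exact: (subsetP sQJ0).
by rewrite groupM ?vX // QX // JM.
Qed.

Let nXM : M \subset 'N(X) := normal_norm nsXM.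
Let X1 : 1%G <| X. Proof. exact: normal1. Qed.
Let XM1 : {in X & M, forall x m, [~ x, m] \in 1%G}.
Proof.
move=> x m Xx Mm; apply/set1P/eqP/commgP; apply: commute_sym.
by apply: (centP (subsetP cMX _ Mm)).
Qed.
Let Mq0X : {in M, forall m, [~ m, q0] \in X}.
Proof. by move=> m Mm; rewrite XM ?QX. Qed.
Let X1p : {in X, forall x, x ^+ p \in 1%G}. Proof. by move=> x /eX->; rewrite group1. Qed.

Let JE m : m \in M -> (m \in J) = (m \in commker M 1 q0).
Proof.
move=> Mm; apply/idP/idP => [/setIP[_ cQm] | /commkerP[_ /set1P cm]].
  apply/commkerP; split=> //; apply/set1P/eqP/commgP.
  exact: (centP cQm).
by rewrite inE Mm (cent_q Qq0 nXq0).
Qed.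

(** [J] is the kernel of [m -> [~ m, q0]], a homomorphism from [M] to the elementary abelian group
    [X]. *)
Let M'J : M^`(1) \subset J.
Proof.
apply/subsetP=> m M'm; rewrite JE ?(subsetP (der_sub 1 M)) //.
have := der1_sub_commker X1 sXM Mq0X XM1.
by move/subsetP; apply.
Qed.

Let MpJ m : m \in M -> m ^+ p \in J.
Proof.
move=> Mm; rewrite JE; last exact: groupX.
exact: (expg_commker X1 Mq0X XM1 X1p Mm).
Qed.

Let MuQ u : u \in J0 -> {in M, forall m, [~ m, u] \in Q}.
Proof. by move=> Ju m Mm; rewrite commg_swap_in J0Q. Qed.
Let Qp : {in Q, forall q, q ^+ p \in X}.
Proof. by move=> q /eQ->; rewrite group1. Qed.

Let M'K u : u \in J0 -> M^`(1) \subset commker M X u.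
Proof.
by move=> Ju; apply: (der1_sub_commker nsXQ sQM (MuQ Ju)) QX.
Qed.

Let MpK u m : u \in J0 -> m \in M -> m ^+ p \in commker M X u.
Proof.
by move=> Ju Mm; apply: (expg_commker nsXQ (MuQ Ju) QX Qp).
Qed.

(* The quotient of M by the intersection of J with the centralisers of t and
   v modulo X is elementary abelian of order at least p^4. *)
Let noncentral_case t c : t \in J0 -> c \in J0 -> c \notin Q ->
    (forall k, c * t ^+ k \notin Q) -> t \notin Q ->
    (forall u, u \in J0 -> u \notin Q -> exists2 j, j \in J & [~ u, j] \notin X) ->
  False.
Proof.
move=> Jt Jc nQc nQct nQt caseII.
have JM j : j \in J -> j \in M by apply: (subsetP sJM).
have [j1 Jj1 nj1] := caseII t Jt nQt.
have [k Xk] := quotient_p_combine p_pr pQ nsXQ le_QX (J0Q Jt (JM _ Jj1)) nj1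
  (J0Q Jc (JM _ Jj1)).
(* [v] is [c] corrected by a power of [t] so as to commute with [j1] modulo [X]; below, [j3] is [j2]
   corrected by a power of [j1] so as to commute with [t], but not with [v], modulo [X]. This
   separates the two centralisers and makes both inclusions from [D] to [J] strict. *)
pose v := c * t ^+ k; have Jv : v \in J0 by rewrite groupM ?groupX.
have vj1 : [~ v, j1] \in X by rewrite J0commM ?groupX ?JM // J0commX ?JM.
have [j2 Jj2 nj2] := caseII v Jv (nQct k).
have nj1' : [~ j1, t] \notin X by rewrite commg_swap_in.
have [i Xi] := quotient_p_combine p_pr pQ nsXQ le_QX (MuQ Jt (JM _ Jj1)) nj1'
  (MuQ Jt (JM _ Jj2)).
pose Kt := commker_group t nXM; pose Kv := commker_group v nXM.
have Xcomm u x y : u \in J0 -> x \in J -> y \in J ->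
    [~ x * y, u] = [~ x, u] * [~ y, u].
  move=> Ju Jx Jy; rewrite commMgJ conjgE.
  have -> : [~ x, u] * y = y * [~ x, u].
    by apply/commute_sym/(centP (subsetP cJQ _ Jy))/MuQ/JM.
  by rewrite mulKg.
have XcommX u x n : u \in J0 -> x \in J -> [~ x ^+ n, u] = [~ x, u] ^+ n.
  move=> Ju Jx; apply: commXg; apply: (centP (subsetP cJQ _ Jx)).
  by rewrite MuQ ?JM.
pose j3 := j2 * j1 ^+ i; have Jj3 : j3 \in J by rewrite groupM ?groupX.
have tj3 : [~ j3, t] \in X by rewrite Xcomm ?groupX // XcommX.
have vj3 : [~ j3, v] \notin X.
  rewrite Xcomm ?groupX // XcommX // groupMr; first by rewrite commg_swap_in.
  by rewrite groupX // commg_swap_in.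
pose D := (J :&: Kt :&: Kv)%G.
have p1D : D \proper (J :&: Kt)%G.
  apply/properP; split; first exact: subsetIl.
  exists j3; first by rewrite inE Jj3; apply/commkerP; split=> //; apply: JM.
  by apply/negP=> /setIP[_ /commkerP[_ h]]; rewrite h in vj3.
have p2D : (J :&: Kt)%G \proper J.
  apply/properP; split; first exact: subsetIl.
  exists j1 => //.
  by apply/negP=> /setIP[_ /commkerP[_ h]]; rewrite h in nj1'.
have pJ : p.-group J := pgroupS sJM pM.
have := leq_trans (leq_mul (leqnn p) (proper_pgroup_card p_pr (pgroupS (proper_sub p2D) pJ) p1D))
   (proper_pgroup_card p_pr pJ p2D).
rewrite -(leq_pmul2l (ltn0Sn 0)) !mul1n => leD.
have sDM : D \subset M by apply: subset_trans sJM; apply: subset_trans (subsetIl _ _) (subsetIl _ _).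
have sM'D : M^`(1) \subset D 
  by apply/subsetIP; split; [apply/subsetIP; split=> //|]; apply: M'K.
have nsDM : D <| M by apply: sub_der1_normal.
(* The index of [D] in [M] is at least [p ^ 4]: a factor [p ^ 2] from [M] to [J] and another from
   [J] to [D]. *)
have := sectional_rank_index p_pr rkM (subxx M) nsDM sM'D.
have MpD : {in M, forall x, x ^+ p \in D}.
  by move=> m Mm; apply/setIP; split; [apply/setIP; split; [exact: MpJ|]|]; apply: MpK.
move/(_ MpD); apply/negP; rewrite -ltnNge.
have := leq_trans (leq_mul (leqnn (p ^ 2)) leD) jMJ.
rewrite -(Lagrange sDM) !mulnA (mulnC #|D|) leq_pmul2r ?cardG_gt0 //.
by apply: leq_trans; rewrite -mulnA -[(p * p)%N]/(p ^ 2)%N -expnD ltn_exp2l.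
Qed.

(* Modulo Q the automorphism g multiplies c by a power t^-k with k prime to p,
   and modulo J it sends d to a power of d, so applying g to [c, d] = 1 gives
   [t, d] in X. *)
Let central_case t d c : t \in J0 -> c \in J0 -> d \in E -> [~ t, d] \notin X ->
    [~ c, d] = 1 -> t ^+ p \in E^`(1) -> t ^+ p != 1 -> c ^+ p \notin E^`(1) ->
    [~ q0, d] != 1 ->
    {in J0 & J, forall u j, [~ u, j] \in X} ->
  False.
Proof.
move=> Jt Jc Ed ntd cd E't nt nc nd caseI.
have Md := subsetP sEM _ Ed; have Mt := subsetP sJ0M _ Jt.
have Mc := subsetP sJ0M _ Jc.
have nsE'X : E^`(1) <| X.
  by rewrite /normal sE'X (subset_trans sXM).
have le_XE' : #|X| <= p * #|E^`(1)%G| by rewrite /= oX oE'.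
have pX : p.-group X := pgroupS sXM pM.
have Xc := J0pow Jc.
(* [X] is generated by E' and [c ^+ p], so [g] would be trivial on [X] if it fixed [c ^+ p]. *)
have gc : g (c ^+ p) != c ^+ p.
  apply/negP=> /eqP fc; case: g_nontriv => x Xx; case/eqP.
  have [k E'k] := quotient_p_combine p_pr pX nsE'X le_XE' Xc nc Xx.
  apply: (mulIg (c ^+ p ^+ k)); rewrite -[RHS](gE' E'k).
  have [Mx Mcp] := (subsetP sXM _ Xx, groupX p Mc).
  by rewrite (AutM Ag) ?groupX // (AutX Ag k Mcp) fc.
have pE' : p.-group E^`(1) := pgroupS (der_sub 1 E) pE.
have nt' : t ^+ p \notin 1%G by apply: contra nt => /set1P->.
have le_E' : #|E^`(1)%G| <= p * #|[1 gT]%G| by rewrite /= oE' cards1 muln1.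
have [k /set1P ek] := quotient_p_combine p_pr pE' (normal1 _) le_E' E't nt' (gX Xc).
have Jgc : g c \in J0 by apply: (char_Aut Ag chJ0).
have npk : ~~ (p %| k).
  apply/negP=> /dvdnP[i dk]; case/eqP: gc; apply/esym/eqP; rewrite eq_mulVg1.
  move: ek; rewrite dk mulnC expgM (eX (subsetP sE'X _ E't)) expg1n mulg1.
  by move/eqP.
(* By the choice of [k] the p-th power of [r] is trivial, so [J0ker] places [r] in [Q]. *)
pose r := g c * t ^+ k * c^-1.
have Jr : r \in J0 by rewrite !groupM ?groupV ?groupX.
have Qr : r \in Q.
  apply: J0ker => //; rewrite !J0expM ?groupM ?groupV ?groupX //.
  rewrite -(AutX Ag) // expgVn -expgM mulnC expgM.
  have -> : g (c ^+ p) * t ^+ p ^+ k = c ^+ p.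
    by apply: (mulgI (c ^+ p)^-1); rewrite mulgA ek mulVg.
  by rewrite mulgV.
pose m := g d; have Mm : m \in M by apply: (Aut_closed Ag).
have cm : [~ g c, m] = 1 by rewrite -(AutR Ag) // cd (Aut1E Ag).
(* Write [q0] as the image of [q] under [g]: the commutator [[~ d, q]] lies in E' and is therefore
   fixed by [g], so [m] centralises [q0] modulo E'. *)
have Lm : m \in L.
  apply/commkerP; split=> //.
  have [q Mq dq] := Aut_preimage Ag (subsetP sQM _ Qq0).
  have Qq : q \in Q by rewrite -(char_AutE Ag chQ) // -dq.
  have E'dq : [~ d, q] \in E^`(1).
    by rewrite commg_swap_in QE' // inE Md (subsetP (normG E)).
  by rewrite dq -(AutR Ag) // gE'.
have Ld : d \in L by rewrite (subsetP sTL) // inE Md (subsetP (normG E)).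
have nJd : d \notin J.
  apply: contra nd => /setIP[_ cQd]; apply/commgP; apply: commute_sym.
  exact: (centP cQd).
have sLM := proper_sub properLM; have pL : p.-group L := pgroupS sLM pM.
have nsJL : [group of J] <| L := normalS sJL sLM nsJM.
have le_L : #|L| <= p * #|J|.
  rewrite -(leq_pmul2l p0) mulnA; apply: leq_trans iMJ.
  exact: proper_pgroup_card properLM.
have [n Jn] := quotient_p_combine p_pr pL nsJL le_L Ld nJd Lm.
(* By [caseI] the centraliser [Ku] of [g c] modulo [X] contains [J]. It also contains [m], hence
   [d ^+ n], and finally [d], because [n] is prime to [p]. *)
pose Ku := commker_group (g c) nXM.
have Kum : m \in Ku.
  by apply/commkerP; split=> //; rewrite commg_swap_in cm group1.
have Kuj : m * d ^+ n \in Ku.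
  apply/commkerP; split; first exact: (subsetP sJM).
  by rewrite commg_swap_in caseI.
have Kudn : d ^+ n \in Ku by rewrite groupMl in Kuj.
have npn : ~~ (p %| n).
  apply: contra nJd => /dvdnP[i dn].
  have Jdn : d ^+ n \in J by rewrite dn mulnC expgM groupX ?MpJ.
  by rewrite -(char_AutE Ag chJ) //; rewrite groupMr in Jn.
have /commkerP[_ Xd] : d \in Ku by apply: expg_coprime_mem p_pr _ _ npn; rewrite ?MpK.
have Jtk : t ^+ k \in J0 by rewrite groupX.
have Jcv : c^-1 \in J0 by rewrite groupV.
(* Expanding [[~ r, d]], which lies in [X], leaves only [[~ t, d] ^+ k] modulo [X]. *)
have := QX Qr Md; rewrite (J0commM (groupM Jgc Jtk) Jcv Md) (J0commM Jgc Jtk Md).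
rewrite (J0commX k Jt Md).
have -> : [~ c^-1, d] = 1.
  by apply/eqP/commgP/commute_sym/commuteV/commute_sym/commgP; rewrite cd.
rewrite mulg1 groupMl; last by rewrite commg_swap_in.
move=> Xk; case/negP: ntd; apply: expg_coprime_mem p_pr _ _ npk => //.
by rewrite eQ ?J0Q // group1.
Qed.

Lemma core_contradiction : False.
Proof.
have [z E'z nz] := E'_nontriv.
(* The p-th power of [t] is a nontrivial element of E', so [core_powers] keeps [t] out of [E]. *)
have [t Jt dz] := J0surj (subsetP sE'X _ E'z).
have Tt := subsetP sJ0T _ Jt.
have nEt : t \notin E.
  by apply: contra nz => Et; rewrite -dz powE ?dz.
have nQt : t \notin Q by apply: contra nEt; apply: (subsetP sQE).
have [d Ed nZd] : exists2 d, d \in E & [~ d, t] \notin 'Z(E).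
  apply/exists_inP; apply: contraR nEt => /exists_inPn Zt.
  by apply: faith => // e Ee; apply: contraR (Zt e Ee).
have Md := subsetP sEM _ Ed.
have ntd : [~ t, d] \notin X.
  by rewrite commg_swap_in; apply: contra nZd; apply: (subsetP sXZE).
(* [W] has index at most [p] in [E], and [J0] centralises it modulo ['Z(E)]. So for elements of [J0]
   the commutator with the single element [d] decides whether they act trivially on [E / 'Z(E)]. *)
pose W := (Q <*> 'Z(E))%G.
have sZE := center_sub E.
have nZT u e : u \in T -> e \in 'Z(E) -> [~ e, u] \in 'Z(E).
  case/setIP=> _ nEu Ze; rewrite commgEl; apply: groupM; first by rewrite groupV.
  have nZu : u \in 'N('Z(E)) by apply: (subsetP (char_norms (center_char E))).
  by rewrite memJ_norm.
have sWK u : u \in J0 -> W \subset commker E 'Z(E) u.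
  move=> Ju; have Tu := subsetP sJ0T _ Ju.
  have nZE := normal_norm (center_normal E).
  rewrite -[commker _ _ _]/(gval (commker_group u nZE)) join_subG.
  apply/andP; split; apply/subsetP=> e He; apply/commkerP.
    by rewrite (subsetP sQE) // (eqP (introT commgP (J0comm He Ju))) group1.
  by rewrite (subsetP sZE) // nZT.
have pWZ : 'Z(E) \proper W.
  apply/properP; split; first exact: joing_subr.
  by exists q0; [rewrite mem_gen // inE Qq0 | apply: notZE].
have nWd : d \notin W.
  by apply: contra nZd => /(subsetP (sWK t Jt))/commkerP[].
have sWE : W \subset E by rewrite join_subG sQE.
have pW : p.-group W := pgroupS sWE pE.
have leW := proper_pgroup_card p_pr pW pWZ.
have oE : #|E| = (p * (p * #|'Z(E)|))%N.
  by rewrite -(Lagrange sZE) iEZ mulnC !mulnA.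
have fullK u : u \in J0 -> [~ u, d] \in X -> u \in E.
  move=> Ju Xud; apply: faith => [|e Ee]; first exact: (subsetP sJ0T).
  have nZE := normal_norm (center_normal E).
  pose K := commker_group u nZE.
  have pWK : W \proper K.
    apply/properP; split; first exact: sWK.
    exists d => //; apply/commkerP; split=> //.
    by rewrite commg_swap_in (subsetP sXZE).
  have sKE : K \subset E by apply: commker_sub.
  have leK := proper_pgroup_card p_pr (pgroupS sKE pE) pWK.
  have eqK : K :=: E.
    apply/eqP; rewrite eqEcard sKE oE; apply: leq_trans leK.
    by rewrite leq_pmul2l.
  by have /commkerP[] : e \in K by rewrite eqK.
have pCE : 'C_E(Q) \proper E.
  rewrite properE subsetIl; apply: contra (notZE Qq0 nXq0) => sEC.
  have sQC : Q \subset 'C(E) by rewrite centsC (subset_trans sEC) ?subsetIr.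
  by rewrite inE (subsetP sQE _ Qq0) (subsetP sQC).
have defW : 'C_E(Q) = W.
  apply/esym/eqP; rewrite eqEcard subsetI sWE join_subG -[Q \subset _]/(abelian Q) abQ /=.
  rewrite (subset_trans (subsetIr _ _)) ?centS //=.
  have := proper_pgroup_card p_pr pE pCE.
  by rewrite oE leq_pmul2l // => leC; apply: leq_trans leC leW.
have nd : [~ q0, d] != 1.
  apply: contra nWd => /commgP cd; rewrite -defW inE Ed.
  by apply: cent_q Qq0 nXq0 Md _; apply/eqP/commgP/commute_sym.
have [x Xx nE'x] : exists2 x, x \in X & x \notin E^`(1).
  by apply/subsetPn/negP=> s; apply: E'_lt_X.
have [s Js ds] := J0surj Xx.
(* Correcting [s] by a power of [t] kills its commutator with [d] modulo [X], which puts it in [E],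
   hence in ['C_E(Q) = W]. Splitting off a factor in [Q] leaves [c] in ['Z(E)], with p-th power
   still outside E'. *)
have [k Xk] := quotient_p_combine p_pr pQ nsXQ le_QX (J0Q Jt Md) ntd (J0Q Js Md).
have Jc' : s * t ^+ k \in J0 by rewrite groupM ?groupX.
have Ec' : s * t ^+ k \in E.
  by apply: fullK => //; rewrite J0commM ?groupX // J0commX.
have : s * t ^+ k \in 'C_E(Q).
  by rewrite inE Ec' (subsetP (subset_trans sJ0J cJQ)).
rewrite defW /= cent_joinEr; last first.
  by rewrite (subset_trans (subsetIr _ _)) ?centS.
case/mulsgP=> q c Qq Zc dc.
have Jc : c \in J0 by rewrite -(groupMl _ (subsetP sQJ0 _ Qq)) -dc.
have ec : c ^+ p = x * t ^+ p ^+ k.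
  rewrite -ds -expgM [(p * k)%N]mulnC expgM -J0expM ?groupX // dc.
  by rewrite J0expM ?(eQ Qq) ?mul1g // (subsetP sQJ0).
have E't : t ^+ p \in E^`(1) by rewrite dz.
have nc : c ^+ p \notin E^`(1).
  by rewrite ec groupMr // dz groupX.
have cd : [~ c, d] = 1.
  by apply/eqP/commgP; case/centerP: Zc => _; apply.
have nt1 : t ^+ p != 1 by rewrite dz.
have [caseI | caseII] := J0_dichotomy.
  exact: (central_case Jt Jc Ed ntd cd E't nt1 nc nd caseI).
have nQ u : u \in J0 -> u ^+ p \notin E^`(1) -> u \notin Q.
  by move=> _; apply: contra => /eQ->; apply: group1.
apply: (noncentral_case Jt Jc) caseII => //; first exact: nQ.
move=> i; apply: nQ; first by rewrite groupM ?groupX.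
have Jti : t ^+ i \in J0 by rewrite groupX.
by rewrite (J0expM Jc Jti) -expgM mulnC expgM groupMr // groupX.
Qed.
End CoreContradiction.

(** * Structure of E when C_T(X) is not contained in E *)

(** With [v = u^-1 * a u] fixed by [a], the power [a ^+ n] sends [u] to [u * v ^+ n]. So the order
    of [v], a power of [p], divides the order of [a]. *)
Lemma aut_coprime_chain (gT : finGroupType) (p : nat) (E V : {group gT}) a u :
    prime p -> p.-group V -> a \in Aut E -> coprime #[a] p -> V \subset E -> u \in E ->
    {in V, forall v, a v = v} -> u^-1 * a u \in V -> a u = u.
Proof.
move=> p_pr pV Aa co sVE Eu aV Vu; pose v := u^-1 * a u.
have eu : u * v = a u by rewrite mulKVg.
have powa n : (a ^+ n) u = u * v ^+ n.
  elim: n => [|n IHn]; first by rewrite perm1 mulg1.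
  rewrite expgSr permM IHn (AutM Aa) ?groupX //; last exact: (subsetP sVE).
  by rewrite (aV (v ^+ n)) ?groupX // expgS mulgA eu.
apply/eqP; rewrite eq_sym eq_mulVg1 -/v -order_eq1 -dvdn1.
have co_va : coprime #[v] #[a].
  apply: (@pnat_coprime p); first exact: mem_p_elt Vu.
  by rewrite p'natE // -prime_coprime // coprime_sym.
have dv : #[v] %| #[a].
  rewrite order_dvdn.
  by have := powa (order a); rewrite expg_order perm1 => e; apply/eqP/(mulgI u); rewrite mulg1.
by move: co_va; rewrite /coprime => /eqP <-; rewrite dvdn_gcd dvdnn.
Qed.

Lemma pgroup_by_coprime (gT : finGroupType) (p : nat) (B : {group gT}) :
  prime p -> (forall a, a \in B -> coprime #[a] p -> a = 1) -> p.-group B.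
Proof.
move=> p_pr Bp; apply/pgroupP=> q q_pr /Cauchy[] // a Ba oa; rewrite inE /=.
apply: contraT => ne_qp; suffices a1 : a = 1.
  by move: q_pr; rewrite -oa a1 order1.
by apply: Bp; rewrite // oa prime_coprime // dvdn_prime2.
Qed.

(** In a Thompson critical subgroup [K], commutators of elements of [K] are central with trivial
    p-th power, so for odd [p] raising to the power [p] is a homomorphism on [K]; [D] is its
    kernel. *)
Lemma critical_exponent_p (gT : finGroupType) (p : nat) (E : {group gT}) :
    prime p -> odd p -> p.-group E ->
  exists D : {group gT},
    [/\ D \char E, {in D, forall x, x ^+ p = 1},
        {in 'Z(E), forall x, x ^+ p = 1 -> x \in D},
        {in D & E, forall d e, [~ d, e] \in 'Z(D)}
      & forall a, a \in Aut E -> coprime #[a] p -> {in D, forall x, a x = x} ->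
        a = 1].
Proof.
move=> p_pr odd_p pE; have [K critK] := Thompson_critical pE.
have pAK := critical_p_stab_Aut critK pE.
have [chK sPhi sKE defZ] := critK; have sKsE := char_sub chK.
have pK := pgroupS sKsE pE.
have KpZ x : x \in K -> x ^+ p \in 'Z(K).
  move=> Kx; apply: (subsetP sPhi); rewrite (Phi_joing pK) mem_gen // inE.
  apply/orP; right; rewrite -[p in _ ^+ p]expn1.
  exact: Mho_p_elt Kx (mem_p_elt pK Kx).
have KcZ x y : x \in K -> y \in E -> [~ x, y] \in 'Z(K).
  by move=> Kx Ey; apply: (subsetP sKE); rewrite commGC mem_commg.
have cK x y z : x \in K -> y \in E -> z \in K -> commute z [~ x, y].
  move=> Kx Ey Kz; have /centerP[_ c] := KcZ x y Kx Ey.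
  exact/commute_sym/c.
have KpM x y : x \in K -> y \in K -> (x * y) ^+ p = x ^+ p * y ^+ p.
  move=> Kx Ky; have Ex := subsetP sKsE _ Kx.
  apply: expMg_class2; [by []| exact: cK | exact: cK |].
  rewrite -commXg; last exact: cK.
  have /centerP[_ c] := KpZ _ Ky; exact/eqP/commgP/c.
pose D := [set x in K | x ^+ p == 1].
have DP x : reflect (x \in K /\ x ^+ p = 1) (x \in D).
  by rewrite inE; apply: (iffP andP) => -[-> /eqP].
have gD : group_set D.
  apply/group_setP; split=> [|x y /DP[Kx xp] /DP[Ky yp]].
    by apply/DP; rewrite group1 expg1n.
  by apply/DP; rewrite groupM // KpM // xp yp mulg1.
have sDK : Group gD \subset K by apply/subsetP=> x /DP[].
exists (Group gD); split=> [|x /DP[] // |x Zx xp|d e /DP[Kd dp] Ee|a Aa co aD].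
- apply: char_by_aut => [|a x Aa /DP[Kx xp]]; first exact: subset_trans sDK sKsE.
  apply/DP; split; first exact: (char_Aut Aa chK).
  by rewrite -(AutX Aa) ?xp ?(Aut1E Aa) // (subsetP sKsE).
- apply/DP; split=> //; apply: (subsetP (center_sub K)); rewrite -defZ.
  by rewrite (subsetP _ _ Zx) // setIS // centS.
- apply/centerP; split=> [|y /DP[Ky _]]; last exact/commute_sym/cK.
  apply/DP; have /centerP[Kde _] := KcZ d e Kd Ee; split=> //.
  rewrite commgEl KpM ?groupV //; last first.
    by rewrite memJ_norm // (subsetP (char_norm chK)).
  by rewrite expgVn -conjXg dp invg1 conj1g mulg1.
(* Induction on the exponent: if [a] fixes [x ^+ p], then [x^-1 * a x] has trivial p-th power and so
   lies in [D], where [a] is trivial. *)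
have aK n x : x \in K -> x ^+ (p ^ n) = 1 -> a x = x.
  elim: n x => [|n IHn] x Kx; first by rewrite expn0 expg1 => ->; rewrite (Aut1E Aa).
  rewrite expnS expgM => /(IHn _ (groupX p Kx)) axp.
  have Ex := subsetP sKsE _ Kx.
  apply: (@aut_coprime_chain _ p E (Group gD)) => //.
  - exact: pgroupS sDK pK.
  - exact: subset_trans sDK sKsE.
  have Kax : a x \in K by apply: (char_Aut Aa chK).
  apply/DP; rewrite groupM ?groupV // KpM ?groupV //.
  by rewrite -(AutX Aa) // axp expgVn mulVg.
have [n oK] : exists n, #|K| = (p ^ n)%N by exists (logn p #|K|); apply: card_pgroup.
(* The automorphisms of [E] that are trivial on a critical subgroup form a p-group. *)
have aC : a \in 'C(K | [Aut E]).
  rewrite astab_ract inE Aa; apply/astabP=> x Kx; apply: (aK n) => //.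
  by rewrite -oK expg_cardG.
apply/eqP; rewrite -order_eq1 -dvdn1.
have co_aa : coprime #[a] #[a].
  apply: (@pnat_coprime p); first exact: mem_p_elt pAK aC.
  by rewrite p'natE // -prime_coprime // coprime_sym.
by move: co_aa; rewrite /coprime => /eqP <-; rewrite dvdn_gcd dvdnn.
Qed.

(** The kernel of the action on the factor [U / V]. Along a suitable chain such kernels intersect in
    a normal p-subgroup, which must then consist of inner automorphisms. *)
Definition factor_stab (gT : finGroupType) (N : {set {perm gT}}) (U V : {set gT}) :=
  [set a in N | [forall u in U, u^-1 * a u \in V]].

Section FactorStab.
Variables (gT : finGroupType) (E U V : {group gT}) (N : {group {perm gT}}).
Hypotheses (sNA : N \subset Aut E) (sUE : U \subset E) (sVU : V \subset U).
Hypothesis NU : {in N & U, forall (a : {perm gT}) u, a u \in U}.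
Hypothesis NV : {in N & V, forall (a : {perm gT}) v, a v \in V}.

Lemma factor_stabP a :
  reflect (a \in N /\ {in U, forall u, u^-1 * a u \in V}) (a \in factor_stab N U V).
Proof. by rewrite inE; apply: (iffP andP) => -[-> /forall_inP]. Qed.

Let NM a x y : a \in N -> x \in U -> y \in U -> a (x * y) = a x * a y.
Proof.
by move=> Na Ux Uy; rewrite (AutM (subsetP sNA _ Na)) // (subsetP sUE).
Qed.

Lemma factor_stab_group_set : group_set (factor_stab N U V).
Proof.
apply/group_setP; split=> [|a b /factor_stabP[Na aV] /factor_stabP[Nb bV]].
  by apply/factor_stabP; split=> // u _; rewrite perm1 mulVg.
apply/factor_stabP; split=> [|u Uu]; first exact: groupM.
have Vw := aV u Uu; rewrite permM -[a u](mulKVg u) (NM Nb Uu (subsetP sVU _ Vw)).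
by rewrite mulgA groupM ?bV ?NV.
Qed.
Canonical factor_stab_group := Group factor_stab_group_set.

Lemma factor_stab_normal : factor_stab_group <| N.
Proof.
apply/andP; split; first by apply/subsetP=> a /factor_stabP[].
apply/subsetP=> c Nc; rewrite inE; apply/subsetP=> _ /imsetP[a /factor_stabP[Na aV] ->].
apply/factor_stabP; split=> [|u Uu]; first by rewrite groupJ.
have Uw : c^-1 u \in U by rewrite NU ?groupV.
have Vw := aV _ Uw; rewrite conjgE !permM -[a _](mulKVg (c^-1 u)).
by rewrite (NM Nc Uw (subsetP sVU _ Vw)) permKV mulKg NV.
Qed.

End FactorStab.

Lemma Ohm1_centerP (gT : finGroupType) (p : nat) (E : {group gT}) x :
  prime p -> p.-group E ->
  reflect (x \in 'Z(E) /\ x ^+ p = 1) (x \in 'Ohm_1('Z(E))).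
Proof.
move=> p_pr pE; have pZ : p.-group 'Z(E) := pgroupS (center_sub E) pE.
rewrite (OhmEabelian pZ) ?expn1; first exact: LdivP.
exact: abelianS (Ohm_sub 1 _) (center_abelian E).
Qed.

(** * The subgroup D of exponent p when T centralises X *)

Section CoreStructure.
Variables (gT : finGroupType) (p : nat) (S T E : {group gT}) (N : {group {perm gT}}).
Hypotheses (p_pr : prime p) (odd_p : odd p) (pS : p.-group S).
Hypothesis rkS : forall L : {group gT}, L \subset S -> 'm(L) <= 3.
Hypotheses (sTS : T \subset S) (nsET : E <| T) (cTE : 'C_T(E) \subset E).
Let X : {group gT} := 'Ohm_1('Z(E))%G.
Hypotheses (cTX : T \subset 'C(X)) (ge_X : p ^ 2 <= #|X|).
Hypothesis nTE : ~~ (T \subset E).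
Hypotheses (sNA : N \subset Aut E).
Hypothesis NX : {in N & X, forall (a : {perm gT}) x, a x = x}.
Hypothesis TN : {in T, forall t, conj_aut E t \in N}.
Hypothesis ON : forall B : {group {perm gT}}, B <| N -> p.-group B ->
  forall a, a \in B -> exists2 e, e \in E & {in E, forall x, a x = x ^ e}.

Let sET : E \subset T := normal_sub nsET.
Let nET : T \subset 'N(E) := normal_norm nsET.
Let sES : E \subset S := subset_trans sET sTS.
Let pE : p.-group E := pgroupS sES pS.
Let pT : p.-group T := pgroupS sTS pS.
Let p1 : 1 < p := prime_gt1 p_pr.
Let p0 : 0 < p := prime_gt0 p_pr.
Let XP x : reflect (x \in 'Z(E) /\ x ^+ p = 1) (x \in X).
Proof. exact: Ohm1_centerP. Qed.
Let eX : {in X, forall x, x ^+ p = 1}. Proof. by move=> x /XP[]. Qed.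
Let sXZ : X \subset 'Z(E). Proof. exact: Ohm_sub. Qed.
Let sXE : X \subset E := subset_trans sXZ (center_sub E).
Let conjE t x : t \in T -> x \in E -> conj_aut E t x = x ^ t.
Proof. by move=> Tt Ex; rewrite norm_conj_autE // (subsetP nET). Qed.
Let NE : {in N & E, forall (a : {perm gT}) x, a x \in E}.
Proof. by move=> a x Na; apply: Aut_closed; apply: (subsetP sNA). Qed.
Let NXX : {in N & X, forall (a : {perm gT}) x, a x \in X}.
Proof. by move=> a x Na Xx; rewrite NX. Qed.

(** If [t] acts on [E] as [e] in [E] does, then [t * e^-1] centralises [E] and so lies in [E]. *)
Let pstab_inner (B : {group {perm gT}}) t :
  B <| N -> p.-group B -> t \in T -> conj_aut E t \in B -> t \in E.
Proof.
move=> nsB pB Tt Bt; have [e Ee et] := ON nsB pB Bt.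
rewrite -(mulgKV e t) groupMr //; apply: (subsetP cTE).
apply/setIP; split; first by rewrite groupM // groupV (subsetP sET).
apply/centP=> x Ex; apply/commute_sym/commgP/conjg_fixP.
by rewrite conjgM -(conjE Tt Ex) et // -conjgM mulgV conjg1.
Qed.

Let no_pstab (B : {group {perm gT}}) : B <| N -> p.-group B ->
  {in T, forall t, conj_aut E t \in B} -> False.
Proof.
move=> nsB pB TB; case/subsetPn: nTE => t Tt; case/negP.
exact: pstab_inner nsB pB Tt (TB t Tt).
Qed.

Let NJ (U : {group gT}) : U \subset E ->
  {in N & U, forall (a : {perm gT}) u, a u \in U} -> U <| T.
Proof.
move=> sUE NU; apply/andP; split; first exact: subset_trans sET.
apply/subsetP=> t Tt; rewrite inE; apply/subsetP=> _ /imsetP[u Uu ->].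
by rewrite -conjE ?(subsetP sUE) // NU ?TN.
Qed.

Variable D : {group gT}.
Hypotheses (chD : D \char E) (eD : {in D, forall x, x ^+ p = 1}).
Hypothesis ZD : {in 'Z(E), forall x, x ^+ p = 1 -> x \in D}.
Hypothesis DEZ : {in D & E, forall d e, [~ d, e] \in 'Z(D)}.
Hypothesis faithD : forall a, a \in Aut E -> coprime #[a] p ->
  {in D, forall x, a x = x} -> a = 1.

Let sDE : D \subset E := char_sub chD.
Let sDS : D \subset S := subset_trans sDE sES.
Let pD : p.-group D := pgroupS sDE pE.
Let sXD : X \subset D. Proof. by apply/subsetP=> x /XP[Zx xp]; apply: ZD. Qed.
Let sXZD : X \subset 'Z(D).
Proof.
rewrite subsetI sXD (subset_trans sXZ) // (subset_trans (subsetIr _ _)) //.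
exact: centS.
Qed.
Let ND : {in N & D, forall (a : {perm gT}) x, a x \in D}.
Proof. by move=> a x Na; apply: char_Aut chD; apply: (subsetP sNA). Qed.
Let nsDT : D <| T := NJ sDE ND.
Let nsXT : X <| T := NJ sXE NXX.
Let abX : abelian X := abelianS sXZ (center_abelian E).
Let pX : p.-group X := pgroupS sXE pE.
Let sXS : X \subset S := subset_trans sXE sES.
Let cDX : D \subset 'C(X).
Proof. by rewrite centsC (subset_trans sXZD) ?subsetIr. Qed.

Let fsD := factor_stab_group sNA sDE sXD NXX.
Let nsfsD : fsD <| N. Proof. exact: factor_stab_normal. Qed.
(** An element of order prime to [p] is trivial on [X] and on [D / X], hence on [D], hence
    trivial. *)
Let pfsD : p.-group fsD.
Proof.
apply: pgroup_by_coprime => // a /factor_stabP[Na aX] co.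
have Aa := subsetP sNA _ Na; apply: faithD => // d Dd.
apply: (@aut_coprime_chain _ p E X) => //; first exact: (subsetP sDE).
  by move=> x; apply: NX.
exact: aX.
Qed.

Let conj_fsD t : t \in T -> (conj_aut E t \in fsD) = [forall d in D, [~ d, t] \in X].
Proof.
move=> Tt; apply/idP/forall_inP => [/factor_stabP[_ tX] d Dd | tX].
  by have := tX d Dd; rewrite conjE ?(subsetP sDE) // commgEl.
apply/factor_stabP; split=> [|d Dd]; first exact: TN.
by rewrite conjE ?(subsetP sDE) // -commgEl tX.
Qed.

Let no_fsD : ~ {in D & T, forall d t, [~ d, t] \in X}.
Proof.
move=> DT; apply: (no_pstab nsfsD pfsD) => t Tt.
by rewrite conj_fsD //; apply/forall_inP=> d Dd; apply: DT.
Qed.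

(** An abelian [D] has order at most [p ^ 3], so [D / X] has order at most [p] and [T] acts
    trivially on it, against [no_fsD]. *)
Let nabD : ~~ abelian D.
Proof.
apply/negP=> abD; have leD := sectional_rank_card p_pr rkS sDS abD eD.
apply: no_fsD; apply: pgroup_index_p_comm p_pr pT sXD _ nsXT nsDT _.
  exact: normal_sub.
rewrite -(leq_pmul2l (cardG_gt0 X)) Lagrange // mulnC.
apply: leq_trans leD _; rewrite expnS leq_pmul2l //.
Qed.

(** If ['Z(D)] had order [p ^ 3] or more, rank 3 would put all of [D] into it. *)
Let ZDX : 'Z(D) = X.
Proof.
apply/eqP; rewrite eq_sym eqEcard sXZD /= (leq_trans _ ge_X) // leqNgt.
have sZS := subset_trans (center_sub D) sDS.
have pZ : p.-group 'Z(D) := pgroupS sZS pS.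
apply: contra nabD => /(pgroup_card_ltn p_pr pZ) ge3.
rewrite /abelian; apply: subset_trans (subsetIr D 'C(D)).
apply/subsetP=> d Dd; apply: sectional_rank_adjoin p_pr rkS sZS _ _ _ _ (eD Dd) ge3.
- exact: center_abelian.
- by move=> x Zx; apply: eD; apply: (subsetP (center_sub D)).
- exact: (subsetP sDS).
by apply: subsetP d Dd; rewrite centsC subsetIr.
Qed.

Let oX : #|X| = (p ^ 2)%N.
Proof.
apply/eqP; rewrite eqn_leq ge_X andbT leqNgt.
apply: contra nabD => /(pgroup_card_ltn p_pr pX) ge3.
apply: abelianS abX; apply/subsetP=> d Dd.
apply: sectional_rank_adjoin p_pr rkS sXS abX eX _ _ (eD Dd) ge3.
- exact: (subsetP sDS).
exact: (subsetP cDX).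
Qed.

Let DD d e : d \in D -> e \in E -> [~ d, e] \in X.
Proof. by move=> Dd Ee; rewrite -ZDX DEZ. Qed.

Let D'X : D^`(1) \subset X.
Proof.
rewrite gen_subG; apply/subsetP=> _ /imset2P[x y Dx Dy ->].
by rewrite DD // (subsetP sDE).
Qed.

Let nsXD : X <| D := normalS sXD (normal_sub nsDT) nsXT.

Let nDX : ~~ (D \subset X).
Proof. by apply: contra nabD => sDX; apply: abelianS abX. Qed.

Let Xcent x d : x \in X -> d \in D -> commute x d.
Proof. by move=> Xx Dd; apply: commute_sym; apply: (centP (subsetP cDX _ Dd)). Qed.

(** [X] and [b] generate an elementary abelian group of order at least [p ^ 3], which by rank 3
    contains every element of [D] commuting with [b]. *)
Let cent_small b : b \in D -> b \notin X -> #|'C_D[b]| <= p ^ 3.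
Proof.
move=> Db nXb; pose B := (X <*> <[b]>)%G.
have sBD : B \subset D by rewrite join_subG sXD cycle_subG.
have abB : abelian B.
  by rewrite abelianY abX cycle_abelian cycle_subG; apply: (subsetP cDX).
have eB : {in B, forall x, x ^+ p = 1} by move=> x Bx; rewrite eD ?(subsetP sBD).
have sBS := subset_trans sBD sDS; have pB := pgroupS sBS pS.
have ge3 : p ^ 3 <= #|B|.
  apply: (pgroup_card_ltn p_pr pB); rewrite -oX proper_card //.
  apply/properP; split; first exact: joing_subl.
  by exists b; rewrite // mem_gen // inE cycle_id orbT.
apply: leq_trans (sectional_rank_card p_pr rkS sBS abB eB).
apply: subset_leq_card; apply/subsetP=> c /setIP[Dc /cent1P cbc].
apply: sectional_rank_adjoin p_pr rkS sBS abB eB _ _ (eD Dc) ge3.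
  exact: (subsetP sDS).
rewrite centY inE (subsetP cDX) //=; apply/centP=> y /cycleP[i ->].
exact/commuteX.
Qed.

Let ltD : p ^ 3 < #|D|.
Proof.
rewrite ltnNge; apply/negP=> leD; case/subsetPn: nDX => b Db; case/negP.
have leDX : #|D| <= p * #|X| by rewrite oX -expnS.
rewrite -ZDX; apply/centerP; split=> // c Dc.
have [bX | nbX] := boolP (b \in X); first exact: Xcent.
have [k Xk] := quotient_p_combine p_pr pD nsXD leDX Db nbX Dc.
rewrite -(mulgK (b ^+ k) c); apply: commuteM; last exact/commuteV/commuteX.
exact/commute_sym/Xcent.
Qed.

Let leD : #|D| <= p ^ 5.
Proof.
rewrite -(Lagrange sXD) oX (expnD p 2 3) leq_pmul2l ?expn_gt0 ?p0 //.
by apply: sectional_rank_index p_pr rkS sDS nsXD D'X _ => x /eD->; apply: group1.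
Qed.

(* If |D| = p^5 and Y has order p in X, then D / Y is extraspecial of order
   p^4, but extraspecial groups have order p^(2n+1). *)
Let oD : #|D| = (p ^ 4)%N.
Proof.
apply/eqP; rewrite eqn_leq (pgroup_card_ltn p_pr pD ltD) andbT leqNgt.
apply/negP=> /(pgroup_card_ltn p_pr pD) ge5.
have {ge5} oD5 : #|D| = (p ^ 5)%N by apply/eqP; rewrite eqn_leq leD.
have ntX : X :!=: 1 by rewrite -cardG_gt1 oX -(exp1n 2) ltn_exp2r.
have [z Xz nz] := trivgPn _ ntX.
have oz : #[z] = p.
  apply/prime_nt_dvdP; rewrite ?order_eq1 ?order_dvdn ?eX //.
pose Y := <[z]>%G; have oY : #|Y| = p by [].
have sYX : Y \subset X by rewrite cycle_subG.
have sYD := subset_trans sYX sXD.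
have nYD : D \subset 'N(Y) by apply: cents_norm; rewrite (subset_trans cDX) ?centS.
(* Otherwise commutation with [b] maps [D] into [Y] with kernel ['C_D[b]], and [D] would have order
   at most [p ^ 4]. *)
have noY b : b \in D -> b \notin X -> ~ {in D, forall u, [~ u, b] \in Y}.
  move=> Db nXb bY; have : #|D| <= #|Y : 1| * #|'C_D[b]|.
    apply: (@comm_card_leq _ D Y 1%G 'C_D[b]%G b) => //; first exact: normal1.
      move=> y u Yy Du; apply/set1P/eqP/commgP; apply: Xcent => //.
      exact: (subsetP sYX).
    move=> u Du /set1P cu; apply/setIP; split=> //; apply/cent1P.
    exact/commgP/eqP.
  rewrite indexg1 oY oD5 leqNgt => /negP[].
  apply: leq_ltn_trans (leq_mul (leqnn p) (cent_small Db nXb)) _.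
  by rewrite -expnS ltn_exp2l.
have pDY : p.-group (D / Y) by rewrite quotient_pgroup.
have defZ : 'Z(D / Y) = X / Y.
  apply/eqP; rewrite eqEsubset; apply/andP; split.
    apply/subsetP=> _ /setIP[/morphimP[u Nu Du ->] /centP cu].
    rewrite mem_quotient //; apply: contraT => nXu; case: (noY u Du nXu) => d Dd.
    apply: coset_idr; first by rewrite groupR // (subsetP nYD).
    rewrite morphR ?(subsetP nYD) //; apply/eqP/commgP/commute_sym.
    by apply: cu; apply: mem_quotient.
  by rewrite subsetI quotientS //= quotient_cents // centsC.
have oXY : #|X / Y| = p.
  have := card_quotient (subset_trans sXD nYD); rewrite -divgS // oX oY => ->.
  by rewrite mulKn.
have derY : (D / Y)^`(1) = X / Y.
  have sder : (D / Y)^`(1) \subset X / Y by rewrite -quotient_der // quotientS.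
  apply/eqP; rewrite eqEsubset sder; apply: prime_meetG; first by rewrite oXY.
  rewrite (setIidPr sder) -quotient_der // -subG1 quotient_sub1; last first.
    exact: subset_trans (der_sub 1 D) nYD.
  apply/negP=> sD'Y; case/subsetPn: nDX => b Db nXb; apply: (noY b Db nXb) => u Du.
  by apply: (subsetP sD'Y); apply: mem_commg.
have phiY : 'Phi(D / Y) = X / Y.
  apply/eqP; rewrite eqEsubset; apply/andP; split.
    have nXYD : D / Y \subset 'N(X / Y) by rewrite quotient_norms ?normal_norm.
    apply: Phi_min pDY nXYD _; apply/abelemP=> //; split.
      by apply: sub_der1_abelian; rewrite derY.
    move=> _ /morphimP[v Nv /morphimP[u Nu Du dv] ->].
    by rewrite -morphX // dv -morphX //= (eD Du) !morph1.
  by rewrite -derY (Phi_joing pDY) joing_subl.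
have exY : extraspecial (D / Y) by split; [split|]; rewrite defZ ?oXY.
have [n _ on] := card_extraspecial pDY exY.
have oDY : #|D / Y| = (p ^ 4)%N.
  have := card_quotient nYD; rewrite -divgS // oD5 oY => ->.
  by rewrite expnS mulKn.
have /eqP := on; rewrite oDY eqn_exp2l // => /eqP /(congr1 odd).
by rewrite /= odd_double.
Qed.

Let a0_ex : exists2 a, a \in D & a \notin X. Proof. exact/subsetPn. Qed.
Let a := s2val (sig2W a0_ex).
Let Da : a \in D. Proof. exact: s2valP (sig2W a0_ex). Qed.
Let nXa : a \notin X. Proof. exact: s2valP' (sig2W a0_ex). Qed.

Let Xgen_card u : u \in D -> u \notin X -> p ^ 3 <= #|X <*> <[u]>|.
Proof.
move=> Du nXu; have sBD : X <*> <[u]> \subset D by rewrite join_subG sXD cycle_subG.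
apply: (pgroup_card_ltn p_pr (pgroupS sBD pD)); rewrite -oX proper_card //.
apply/properP; split; first exact: joing_subl.
by exists u; rewrite // mem_gen // inE cycle_id orbT.
Qed.

Let D_gen (K : {group gT}) u v : K \subset D -> X \subset K -> u \in K -> v \in K ->
  u \notin X -> v \notin X <*> <[u]> -> K :=: D.
Proof.
move=> sKD sXK Ku Kv nXu nv; apply/eqP; rewrite eqEcard sKD oD.
apply: (pgroup_card_ltn p_pr (pgroupS sKD pD)).
apply: leq_ltn_trans (Xgen_card (subsetP sKD _ Ku) nXu) (proper_card _).
apply/properP; split; first by rewrite join_subG sXK cycle_subG.
by exists v.
Qed.

Let b_ex u : u \in D -> u \notin X -> exists2 b, b \in D & b \notin X <*> <[u]>.
Proof.
move=> Du nXu; have abB : abelian (X <*> <[u]>).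
  by rewrite abelianY abX cycle_abelian cycle_subG; apply: (subsetP cDX).
by apply/subsetPn; apply: contra nabD => sD; apply: abelianS abB.
Qed.

Let nYD (Y : {set gT}) : Y \subset X -> D \subset 'N(Y).
Proof. by move=> sYX; apply: cents_norm; rewrite (subset_trans cDX) ?centS. Qed.

(** [D] is generated by [a], [b] and the central subgroup [X], so all its commutators are powers of
    [[~ a, b]]. *)
Let oD' : #|D^`(1)| = p.
Proof.
have [b Db nb] := b_ex Da nXa.
pose Y := <[ [~ a, b] ]>%G.
have XYab : [~ a, b] \in X by rewrite DD ?(subsetP sDE).
have sYX : Y \subset X by rewrite cycle_subG.
have kerY u : u \in D -> [~ a, u] \in Y -> [~ b, u] \in Y -> {in D, forall v, [~ v, u] \in Y}.
  move=> Du Yau Ybu v; pose K := commker_group u (nYD sYX).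
  suffices <- : K :=: D by case/commkerP.
  apply: (@D_gen K a b) => //; first exact: commker_sub.
  - apply/subsetP=> x Xx; apply/commkerP; split; first exact: (subsetP sXD).
    by rewrite (eqP (introT commgP (Xcent Xx Du))) group1.
  - exact/commkerP.
  exact/commkerP.
have Yab : [~ a, b] \in Y by apply: cycle_id.
have Yba : [~ b, a] \in Y by rewrite commg_swap_in.
have aa : [~ a, a] \in Y by rewrite (eqP (introT commgP (commute_refl a))) group1.
have bb : [~ b, b] \in Y by rewrite (eqP (introT commgP (commute_refl b))) group1.
have sD'Y : D^`(1) \subset Y.
  rewrite gen_subG; apply/subsetP=> _ /imset2P[x y Dx Dy ->].
  by apply: (kerY) => //; rewrite commg_swap_in; apply: (kerY).
have ntD' : D^`(1) != 1 by apply: contra nabD => /eqP/derG1P.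
have := cardSg sD'Y; have : #|Y| %| p by rewrite -orderE order_dvdn eX.
move=> h1 h2; apply/prime_nt_dvdP => //; last exact: dvdn_trans h2 h1.
by rewrite -trivg_card1.
Qed.

(** Otherwise [D / D2] and [D2 / X] have order at most [p], so [T] acts trivially on both; but the
    automorphisms trivial on these factors form a normal p-subgroup of [N], against [no_pstab]. Thus
    [N] is irreducible on [D / X]. *)
Let irrD (D2 : {group gT}) : X \subset D2 -> D2 \subset D ->
    {in N & D2, forall (c : {perm gT}) u, c u \in D2} -> ~~ (D2 \subset X) -> D \subset D2.
Proof.
move=> sXD2 sD2D ND2 nD2X; apply: contraT => nDD2.
have sD2E := subset_trans sD2D sDE.
have nsD2T := NJ sD2E ND2.
have ltX : X \proper D2 by rewrite properE sXD2.
have ltD2 : D2 \proper D by rewrite properE sD2D.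
have pD2 := pgroupS sD2D pD.
have h1 := proper_pgroup_card p_pr pD ltD2.
have h2 := proper_pgroup_card p_pr pD2 ltX.
have iD : #|D : D2| <= p.
  rewrite -(leq_pmul2l (cardG_gt0 D2)) Lagrange // oD (expnD p 3 1) leq_pmul2r //.
  by rewrite (expnD p 1 2) -oX.
have iX : #|D2 : X| <= p.
  rewrite -(leq_pmul2l (cardG_gt0 X)) Lagrange // -(leq_pmul2l p0).
  by apply: leq_trans h1 _; rewrite oD oX -expnSr -expnS.
pose B1 := factor_stab_group sNA sDE sD2D ND2.
pose B2 := factor_stab_group sNA sD2E sXD2 NXX.
have nsB : (B1 :&: B2)%G <| N.
  apply: normalI; first exact: (factor_stab_normal sNA sDE sD2D ND ND2).
  exact: (factor_stab_normal sNA sD2E sXD2 ND2 NXX).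
have pB : p.-group (B1 :&: B2)%G.
  apply: pgroup_by_coprime => // c /setIP[/factor_stabP[Nc c1] /factor_stabP[_ c2]] co.
  have Ac := subsetP sNA _ Nc; apply: faithD => // d Dd.
  have cX : {in X, forall x, c x = x} by move=> x; apply: NX.
  have c3 : {in D2, forall x, c x = x}.
    move=> x D2x; apply: (aut_coprime_chain p_pr pX Ac co sXE _ cX); last exact: c2.
    exact: (subsetP sD2E).
  apply: (aut_coprime_chain p_pr pD2 Ac co sD2E _ c3); last exact: c1.
  exact: (subsetP sDE).
case: (no_pstab nsB pB) => t Tt; apply/setIP; split; apply/factor_stabP.
  split=> [|d Dd]; first exact: TN.
  rewrite conjE ?(subsetP sDE) // -commgEl.
  exact: pgroup_index_p_comm p_pr pT sD2D (normal_sub nsDT) nsD2T nsDT iD _ _ Dd Tt.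
split=> [|d Dd]; first exact: TN.
rewrite conjE ?(subsetP sD2E) // -commgEl.
exact: pgroup_index_p_comm p_pr pT sXD2 (normal_sub nsD2T) nsXT nsD2T iX _ _ Dd Tt.
Qed.

Let C := 'C_E(D)%G.
Let sCE : C \subset E. Proof. exact: subsetIl. Qed.
Let b := s2val (sig2W (b_ex Da nXa)).
Let Db : b \in D. Proof. exact: s2valP (sig2W (b_ex Da nXa)). Qed.
Let nb : b \notin X <*> <[a]>. Proof. exact: s2valP' (sig2W (b_ex Da nXa)). Qed.

Let XEcent x e : x \in X -> e \in E -> [~ x, e] = 1.
Proof.
move=> Xx Ee; apply/eqP/commgP.
by have /centerP[_ c] := subsetP sXZ x Xx; apply: c.
Qed.

Let nYE (Y : {set gT}) : Y \subset X -> E \subset 'N(Y).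
Proof.
move=> sYX; apply: cents_norm; rewrite centsC (subset_trans sYX) //.
by rewrite (subset_trans sXZ) ?subsetIr.
Qed.

Let gen_comm (Y : {group gT}) e : Y \subset X -> e \in E ->
  [~ a, e] \in Y -> [~ b, e] \in Y -> {in D, forall v, [~ v, e] \in Y}.
Proof.
move=> sYX Ee Yae Ybe v; pose K := commker_group e (nYD sYX).
suffices <- : K :=: D by case/commkerP.
apply: (@D_gen K a b) => //; first exact: commker_sub.
- apply/subsetP=> x Xx; apply/commkerP; split; first exact: (subsetP sXD).
  by rewrite XEcent ?group1.
- exact/commkerP.
exact/commkerP.
Qed.

Let centD e : e \in E -> [~ a, e] = 1 -> [~ b, e] = 1 -> e \in C.
Proof.
move=> Ee ae be; apply/setIP; split=> //; apply/centP=> v Dv.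
have := @gen_comm 1%G e (sub1G X) Ee; rewrite ae be => /(_ (group1 _) (group1 _) v Dv).
by move/set1P/eqP/commgP/commute_sym.
Qed.

Let nD'E := nYE D'X.
Let nsD'X : D^`(1) <| X := normalS D'X sXE (introT andP (conj (subset_trans D'X sXE) nD'E)).

Let EX u : u \in D -> {in E, forall e, [~ e, u] \in X}.
Proof. by move=> Du e Ee; rewrite commg_swap_in DD. Qed.
Let XE (Y : {group gT}) : {in X & E, forall x e, [~ x, e] \in Y}.
Proof. by move=> x e Xx Ee; rewrite XEcent. Qed.
Let Xp (Y : {group gT}) : {in X, forall x, x ^+ p \in Y}.
Proof. by move=> x /eX->. Qed.

(** For [u] in [D], [e -> [~ e, u]] is a homomorphism from [E] to the elementary abelian group [X],
    so it kills E' and, likewise, all p-th powers. *)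
Let E'C : E^`(1) \subset C.
Proof.
apply/subsetP=> e E'e; have Ee := subsetP (der_sub 1 E) _ E'e.
have k u : u \in D -> [~ u, e] = 1.
  move=> Du; have sK := der1_sub_commker (normal1 X) sXE (EX Du) (@XE 1%G).
  have /commkerP[_ /set1P] := subsetP sK _ E'e.
  by move/eqP/commgP => c; apply/eqP/commgP/commute_sym.
by apply: centD => //; apply: k.
Qed.

Let EpC : {in E, forall e, e ^+ p \in C}.
Proof.
move=> e Ee; have Eep := groupX p Ee.
have k u : u \in D -> [~ u, e ^+ p] = 1.
  move=> Du; have := expg_commker (normal1 X) (EX Du) (@XE 1%G) (@Xp 1%G) Ee.
  case/commkerP=> _ /set1P/eqP/commgP c.
  exact/eqP/commgP/commute_sym.
by apply: centD => //; apply: k.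
Qed.

Let nsCE : C <| E := sub_der1_normal E'C sCE.

Let cardDC : #|D * C| = (p ^ 2 * #|C|)%N.
Proof.
have DC : D :&: C = X.
  by rewrite -ZDX setIA (setIidPl sDE).
apply/eqP; rewrite -(eqn_pmul2r (cardG_gt0 X)) -{1}DC -mul_cardG oD oX.
by rewrite mulnAC -expnD.
Qed.

Let sDCE : D * C \subset E. Proof. by rewrite mul_subG. Qed.

Let iEC : #|E| <= p ^ 3 * #|C|.
Proof.
rewrite -(Lagrange (normal_sub nsCE)) mulnC leq_pmul2r //.
exact: sectional_rank_index p_pr rkS sES nsCE E'C EpC.
Qed.

Let D2_set := [set u in D | [forall e in E, [~ u, e] \in D^`(1)]].
Let D2P u : reflect (u \in D /\ {in E, forall e, [~ u, e] \in D^`(1)}) (u \in D2_set).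
Proof. by rewrite inE; apply: (iffP andP) => -[-> /forall_inP]. Qed.
Let D2_group_set : group_set D2_set.
Proof.
apply/group_setP; split=> [|u v /D2P[Du uX] /D2P[Dv vX]].
  by apply/D2P; rewrite group1; split=> // e _; rewrite comm1g group1.
apply/D2P; split=> [|e Ee]; first exact: groupM.
rewrite commMgJ groupM ?vX // memJ_norm ?uX //.
by rewrite (subsetP nD'E) ?(subsetP sDE).
Qed.
Let D2 := Group D2_group_set.

Let nsE1 u : u \in D -> E^`(1) \subset commker E D^`(1) u.
Proof. by move=> Du; exact: der1_sub_commker nsD'X sXE (EX Du) (@XE _). Qed.

(** By irreducibility [D2] is [D] or lies in [X]. In the second case [E1], the centraliser of [D]
    modulo D', has index at most [p] in [E]. For [e] outside [E1], the map [u -> [~ u, e]] from [D]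
    to [X / D'] of order [p] has a kernel of order at least [p ^ 3], larger than [X]; an element of
    it outside [X] would belong to [D2]. *)
Let DED' : {in D & E, forall d e, [~ d, e] \in D^`(1)}.
Proof.
have sD2D : D2 \subset D by apply/subsetP=> u /D2P[].
have sXD2 : X \subset D2.
  apply/subsetP=> x Xx; apply/D2P; split; first exact: (subsetP sXD).
  by move=> e Ee; rewrite XEcent.
have ND2 : {in N & D2, forall (c : {perm gT}) u, c u \in D2}.
  move=> c u Nc /D2P[Du uX]; have Ac := subsetP sNA _ Nc.
  apply/D2P; split; first exact: ND.
  move=> e Ee; have [f Ef ->] := Aut_preimage Ac Ee.
  rewrite -(AutR Ac (subsetP sDE _ Du) Ef).
  exact: (@char_Aut _ E c Ac D^`(1)%G _ (char_trans (der_char 1 D) chD) (uX f Ef)).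
have [sD2X | /(irrD sXD2 sD2D ND2) sDD2] := boolP (D2 \subset X); last first.
  by move=> d e /(subsetP sDD2)/D2P[_]; apply.
pose E1 := (commker_group a nD'E :&: commker_group b nD'E)%G.
have sE1E : E1 \subset E by rewrite subIset ?commker_sub.
have sDCE1 : D * C \subset E1.
  have sCD : forall u, u \in D -> {subset C <= commker E D^`(1) u}.
    move=> u Du c Cc; have [Ec cDc] := setIP Cc; apply/commkerP; split=> //.
    by rewrite (eqP (introT commgP (centP cDc u Du))) group1.
  rewrite mul_subG // subsetI; apply/andP; split; apply/subsetP=> d.
  - by move=> Dd; apply/commkerP; rewrite (subsetP sDE) //; split=> //; apply: mem_commg.
  - by move=> Dd; apply/commkerP; rewrite (subsetP sDE) //; split=> //; apply: mem_commg.
  - exact: sCD.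
  exact: sCD.
have leE1 : #|E| <= p * #|E1|.
  apply: leq_trans iEC _; rewrite expnS -mulnA leq_pmul2l // -cardDC.
  exact: subset_leq_card.
have sE'E1 : E^`(1) \subset E1 by rewrite subsetI !nsE1.
have nsE1E : E1 <| E := sub_der1_normal sE'E1 sE1E.
have full u g : u \in D -> g \in E1 -> [~ u, g] \in D^`(1).
  move=> Du /setIP[/commkerP[Eg ag] /commkerP[_ bg]].
  apply: (gen_comm D'X Eg) => //; by rewrite commg_swap_in.
have [sEE1 | /subsetPn[e Ee nE1e]] := boolP (E \subset E1).
  by move=> d e Dd Ee; apply: full => //; apply: (subsetP sEE1).
pose D3 := commker_group e (subset_trans sDE nD'E).
have : #|D| <= #|X : D^`(1)| * #|D3|.
  apply: (@comm_card_leq _ D X D^`(1)%G D3 e) => //.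
  - by move=> x d Xx Dd; rewrite XEcent // (subsetP sDE).
  - by move=> d Dd; apply: DD.
  by move=> u Du uD; apply/commkerP.
have -> : #|X : D^`(1)| = p by rewrite -divgS // oX oD' expnS expn1 mulnK.
rewrite oD expnS leq_pmul2l // => le3.
have /subsetPn[u /commkerP[Du ue] nXu] : ~~ (D3 \subset X).
  apply: contraL le3 => /subset_leq_card le2; rewrite -ltnNge.
  by apply: leq_ltn_trans le2 _; rewrite oX ltn_exp2l.
case/negP: nXu; apply: (subsetP sD2X); apply/D2P; split=> // f Ef.
have [k E1k] := quotient_p_combine p_pr pE nsE1E leE1 Ee nE1e Ef.
pose Ku := commker_group u nD'E.
have Ke : e \in Ku by apply/commkerP; rewrite commg_swap_in.
have Kf : f * e ^+ k \in Ku.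
  by apply/commkerP; split; [apply: (subsetP sE1E) | rewrite commg_swap_in full].
move: Kf; rewrite groupMr ?groupX // => /commkerP[_].
by rewrite commg_swap_in.
Qed.

(** Commutation with [a] and with [b] maps [E] into D' of order [p], with common kernel [C]. So [C]
    has index at most [p ^ 2] in [E], and [D * C] already accounts for that. *)
Let defE : D * C = E.
Proof.
apply/eqP; rewrite eqEcard sDCE cardDC /=.
have nD'1 : 1%G <| D^`(1) := normal1 _.
have D'E1 : {in D^`(1) & E, forall x e, [~ x, e] \in 1%G}.
  by move=> x e D'x Ee; rewrite XEcent ?group1 // (subsetP D'X).
have ED' u : u \in D -> {in E, forall e, [~ e, u] \in D^`(1)}.
  by move=> Du e Ee; rewrite commg_swap_in DED'.
pose Ka := commker_group a (norms1 E).
have sKaE : Ka \subset E by apply: commker_sub.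
have h1 := commker_card (norms1 E) nD'1 (ED' a Da) D'E1.
have h2 : #|Ka| <= #|D^`(1) : 1| * #|C|.
  apply: (@comm_card_leq _ Ka D^`(1)%G 1%G C b) => //.
  - by move=> x e D'x /(subsetP sKaE); apply: D'E1.
  - by move=> e /(subsetP sKaE); apply: ED'.
  move=> e /commkerP[Ee /set1P ea] /set1P eb; apply: centD => //.
    by apply/eqP/commgP/commute_sym/commgP; rewrite ea.
  by apply/eqP/commgP/commute_sym/commgP; rewrite eb.
apply: leq_trans h1 _; rewrite indexg1 oD' (expnD p 1 1) expn1 -mulnA leq_pmul2l //.
by apply: leq_trans h2 _; rewrite indexg1 oD'.
Qed.

Let sDC : D \subset 'C(C). Proof. by rewrite centsC subsetIr. Qed.
Let defE' : D \* C = E. Proof. by rewrite cprodE ?defE // centsC. Qed.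

Let C_gen : exists c, C :=: X <*> <[c]>.
Proof.
pose K := (X <*> 'Phi(C))%G.
have sXC : X \subset C by rewrite subsetI sXE centsC.
have sKC : K \subset C by rewrite join_subG sXC Phi_sub.
have pC : p.-group C := pgroupS sCE pE.
have sE'K : E^`(1) \subset K.
  have [_ <- _] := cprodP (der_cprod 1 defE'); rewrite mul_subG //.
    exact: subset_trans D'X (joing_subl _ _).
  by rewrite (subset_trans _ (joing_subr _ _)) // (Phi_joing pC) joing_subl.
have nsKE : K <| E.
  rewrite /= normalY //; first by rewrite /normal sXE nYE.
  by rewrite (char_normal_trans (Phi_char C)).
have EpK : {in E, forall e, e ^+ p \in K}.
  move=> e; rewrite -{1}defE => /mulsgP[d c Dd Cc ->].
  rewrite expgMn; last by apply: (centP (subsetP sDC d Dd)).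
  rewrite eD // mul1g mem_gen // inE; apply/orP; right.
  rewrite (Phi_joing pC) mem_gen // inE -[p in _ ^+ p]expn1.
  by rewrite (Mho_p_elt 1 Cc (mem_p_elt pC Cc)) orbT.
have leC : #|C| <= p * #|K|.
  have : #|E| <= p ^ 3 * #|K|.
    rewrite -(Lagrange (normal_sub nsKE)) mulnC leq_pmul2r //.
    exact: sectional_rank_index p_pr rkS sES nsKE sE'K EpK.
  by rewrite -{1}defE cardDC (expnD p 2 1) -mulnA leq_pmul2l ?expn_gt0 ?p0.
have [c Cc defC] : exists2 c, c \in C & C \subset K <*> <[c]>.
  have [sCK | /subsetPn[c Cc nKc]] := boolP (C \subset K).
    by exists 1; rewrite ?group1 // (subset_trans sCK) ?joing_subl.
  exists c => //; have sKc : K <*> <[c]> \subset C by rewrite join_subG sKC cycle_subG.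
  have pKc : K \proper K <*> <[c]>.
    apply/properP; split; first exact: joing_subl.
    by exists c; rewrite // mem_gen // inE cycle_id orbT.
  have h := proper_pgroup_card p_pr (pgroupS sKc pC) pKc.
  have /eqP<- // : K <*> <[c]> == C.
  by rewrite eqEcard sKc; apply: leq_trans leC h.
exists c; have sXcC : X <*> <[c]> \subset C by rewrite join_subG sXC cycle_subG.
have : 'Phi(C) <*> (X <*> <[c]>) = C.
  apply/eqP; rewrite eqEsubset join_subG Phi_sub sXcC /=.
  by rewrite joingA (joingC 'Phi(C)).
by move/Phi_nongen; rewrite genGid.
Qed.

Let abC : abelian C.
Proof.
have [c defC] := C_gen; rewrite defC abelianY abX cycle_abelian cycle_subG.
have sCX : C \subset 'C(X) by rewrite centsC (subset_trans sXZ) // (subset_trans (subsetIr _ _)) ?centS.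
by rewrite (subsetP sCX) // defC mem_gen // inE cycle_id orbT.
Qed.

Let ZE : 'Z(E) = C.
Proof.
apply/eqP; rewrite eqEsubset; apply/andP; split.
  by rewrite subsetI subsetIl (subset_trans (subsetIr _ _)) ?centS.
apply/subsetP=> c Cc; have [Ec cDc] := setIP Cc; apply/setIP; split=> //.
by rewrite -defE centM inE cDc (subsetP abC).
Qed.

Let E'D' : E^`(1) = D^`(1).
Proof.
have [_ <- _] := cprodP (der_cprod 1 defE').
by rewrite (derG1P abC) mulg1.
Qed.

Let oE' : #|E^`(1)| = p. Proof. by rewrite E'D'. Qed.

Let iEZ : #|E : 'Z(E)| = (p ^ 2)%N.
Proof.
rewrite ZE -divgS ?normal_sub //= -{1}defE cardDC mulnK //.
Qed.

Let faithE : {in T, forall t, {in E, forall e, [~ e, t] \in 'Z(E)} -> t \in E}.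
Proof.
move=> t Tt Zt; apply: (pstab_inner nsfsD pfsD Tt).
rewrite conj_fsD //; apply/forall_inP=> d Dd; have Ed := subsetP sDE d Dd.
rewrite -ZDX; have := Zt d Ed; rewrite ZE => /setIP[_ cDc]; apply/setIP; split=> //.
by rewrite commgEl groupM ?groupV // memJ_norm // (subsetP (normal_norm nsDT)).
Qed.

(** All p-th powers of [E] lie in [K = <[c ^+ p]>]. Were one of them a nontrivial element of E',
    then E' would lie in [K] and [E / K] would be elementary abelian; but the strict chain [K <
    <[c]> < C] makes its order at least [p ^ 4]. *)
Let powE : {in E, forall e, e ^+ p \in E^`(1) -> e ^+ p = 1}.
Proof.
move=> e; rewrite -{1}defE => /mulsgP[d u Dd Cu ->].
rewrite expgMn; last by apply: (centP (subsetP sDC d Dd)).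
rewrite eD // mul1g => E'u; apply/eqP; apply: contraT => nu.
have [c defC] := C_gen; have Cc : c \in C by rewrite defC mem_gen // inE cycle_id orbT.
have pC : p.-group C := pgroupS sCE pE.
have ZC x : x \in C -> x \in 'Z(E) by rewrite ZE.
pose K := <[c ^+ p]>%G.
have sKC : K \subset C by rewrite cycle_subG groupX.
have sKE := subset_trans sKC sCE.
have nKE : E \subset 'N(K).
  apply: cents_norm; rewrite centsC (subset_trans sKC) //.
  by rewrite -ZE subsetIr.
have [x Xx [i eu]] : exists2 x, x \in X & exists i, u = x * c ^+ i.
  have cXc : <[c]> \subset 'C(X).
    rewrite cycle_subG; have /setIP[_] := ZC c Cc.
    by apply: subsetP; apply: centS.
  have := Cu; rewrite defC cent_joinEr // => /mulsgP[x y Xx /cycleP[i ->] ->].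
  by exists x => //; exists i.
have Ku : u ^+ p \in K.
  have /centerP[_ cc] := ZC c Cc.
  rewrite eu expgMn; last by apply/commuteX/commute_sym/cc/(subsetP sXE).
  by rewrite eX // mul1g -expgM mulnC expgM mem_cycle.
have nu1 : u ^+ p \notin 1%G by apply: contra nu => /set1P->.
have pE' : p.-group E^`(1) := pgroupS (der_sub 1 E) pE.
have leE' : #|E^`(1)%G| <= p * #|[1 gT]%G| by rewrite /= oE' cards1 muln1.
have sE'K : E^`(1) \subset K.
  apply/subsetP=> z E'z.
  have [k /set1P zk] := quotient_p_combine p_pr pE' (normal1 _) leE' E'u nu1 E'z.
  by rewrite -(groupMr _ (groupX k Ku)) zk group1.
have EpK : {in E, forall f, f ^+ p \in K}.
  move=> f; rewrite -{1}defE => /mulsgP[d' v Dd' Cv ->].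
  rewrite expgMn; last by apply: (centP (subsetP sDC d' Dd')).
  rewrite eD // mul1g; move: Cv; rewrite defC cent_joinEr; last first.
    rewrite cycle_subG; have /setIP[_] := ZC c Cc.
    by apply: subsetP; apply: centS.
  case/mulsgP=> x' y Xx' /cycleP[j ->] ->; have /centerP[_ cc] := ZC c Cc.
  rewrite expgMn; last by apply/commuteX/commute_sym/cc/(subsetP sXE).
  by rewrite eX // mul1g -expgM mulnC expgM mem_cycle.
have nsKE : K <| E by apply/andP.
have := sectional_rank_index p_pr rkS sES nsKE sE'K EpK.
rewrite leqNgt => /negP[]; rewrite -(ltn_pmul2l (cardG_gt0 K)) Lagrange //.
rewrite -{1}defE cardDC.
have ncK : c \notin K.
  apply/negP=> Kc; have /dvdn_leq : #[c] %| #[c ^+ p] by apply: order_dvdG.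
  rewrite order_gt0 => /(_ isT); rewrite leqNgt => /negP[].
  have nc : #[c] != 1%N.
    rewrite order_eq1; apply: contra nu => /eqP c1; have /cycleP[j ->] := Ku.
    by rewrite c1 !expg1n.
  have oc : #[c] = (p ^ logn p #[c])%N by apply: card_pgroup (mem_p_elt pC Cc).
  have pdc : p %| #[c].
    by move: nc; rewrite oc; case: (logn _ _) => [|k _]; rewrite ?expnS ?dvdn_mulr.
  by rewrite (orderXdiv pdc) ltn_Pdiv ?order_gt0.
have p1K : K \proper <[c]>.
  by apply/properP; split; [rewrite cycle_subG mem_cycle | exists c; rewrite ?cycle_id].
have p2K : <[c]> \proper C.
  rewrite properE cycle_subG Cc /=; apply/negP=> sCc.
  have sXC : X \subset C by rewrite subsetI sXE centsC.
  have /cyclicP[y defX] := cyclicS (subset_trans sXC sCc) (cycle_cyclic c).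
  have yp : y ^+ p = 1 by rewrite eX // defX cycle_id.
  have /dvdn_leq : #[y] %| p by rewrite order_dvdn yp.
  by move/(_ p0); rewrite orderE -defX oX leqNgt -{1}(expn1 p) ltn_exp2l.
have pc : p.-group <[c]> by apply: pgroupS (proper_sub p2K) pC.
have h1 := proper_pgroup_card p_pr pc p1K.
have h2 := proper_pgroup_card p_pr pC p2K.
have {h2} h2 := leq_trans (leq_mul (leqnn p) h1) h2.
apply: leq_trans (leq_mul (leqnn (p ^ 2)) h2).
rewrite mulnC !mulnA ltn_pmul2r // -mulnA -[(p * p)%N]/(p ^ 2)%N -expnD ltn_exp2l //.
Qed.

(** * The action of N on the plane D / X *)

Let abDX : abelian (D / X) := sub_der1_abelian D'X.
Let nXD : D \subset 'N(X) := normal_norm nsXD.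

Let cosetXP u v : u \in D -> v \in D -> (coset X u = coset X v) <-> (u^-1 * v \in X).
Proof.
move=> Du Dv; have [Nu Nv] := (subsetP nXD u Du, subsetP nXD v Dv).
split=> [e | Xuv].
  apply: coset_idr; first by rewrite groupM ?groupV.
  by rewrite morphM ?groupV // morphV //= e mulVg.
by rewrite -[v](mulKVg u) morphM ?groupM ?groupV //= (coset_id Xuv) mulg1.
Qed.

Let coset_aut (c : {perm gT}) u v : c \in N -> u \in D -> v \in D ->
  coset X u = coset X v -> coset X (c u) = coset X (c v).
Proof.
move=> Nc Du Dv /(cosetXP Du Dv) Xuv; have Ac := subsetP sNA c Nc.
have [Eu Ev] := (subsetP sDE u Du, subsetP sDE v Dv).
apply/cosetXP; rewrite ?ND // -(AutV Ac) // -(AutM Ac) ?groupV //.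
exact: NXX.
Qed.

Let coset_autM (c : {perm gT}) u v : c \in N -> u \in D -> v \in D ->
  coset X (c (u * v)) = coset X (c u) * coset X (c v).
Proof.
move=> Nc Du Dv; have Ac := subsetP sNA c Nc.
rewrite (AutM Ac) ?(subsetP sDE _ Du) ?(subsetP sDE _ Dv) //.
by rewrite morphM ?(subsetP nXD) ?ND.
Qed.

Let coset_autV (c : {perm gT}) u : c \in N -> u \in D ->
  coset X (c u^-1) = (coset X (c u))^-1.
Proof.
move=> Nc Du; have Ac := subsetP sNA c Nc.
rewrite (AutV Ac) ?(subsetP sDE _ Du) // morphV ?(subsetP nXD) ?ND //.
Qed.

Let coset_autX (c : {perm gT}) u m : c \in N -> u \in D ->
  coset X (c (u ^+ m)) = coset X (c u) ^+ m.
Proof.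
move=> Nc Du; elim: m => [|m IHm].
  by rewrite !expg0 (Aut1E (subsetP sNA c Nc)) coset_id.
by rewrite !expgS coset_autM ?groupX // IHm.
Qed.

(* tau and s below act on D / X as opposite transvections, so tau s tau is a
   quarter turn in SL_2(p) and its square is -1. *)
Let inverter : exists2 c, c \in N & {in D, forall d, coset X (c d) = coset X d^-1}.
Proof.
(* [v1] spans a line of [D / X] fixed by [T]; by irreducibility some [n] in [N] moves this line. *)
have [v1 /upperP[Dv1 _ v1T] nXv1] := upper_nontrivial p_pr pT nsXT nsDT nDX.
pose D1 := (X <*> <[v1]>)%G.
have cXv1 : <[v1]> \subset 'C(X) by rewrite cycle_subG (subsetP cDX).
have sD1D : D1 \subset D by rewrite join_subG sXD cycle_subG.
have sXD1 : X \subset D1 := joing_subl _ _.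
have D1v1 : v1 \in D1 by rewrite mem_gen // inE cycle_id orbT.
have abD1 : abelian D1 by rewrite abelianY abX cycle_abelian.
have D1E u : reflect (exists2 x, x \in X & exists i, u = x * v1 ^+ i) (u \in D1).
  rewrite /= cent_joinEr //; apply: (iffP mulsgP) => [[x _ Xx /cycleP[i ->] ->]|].
    by exists x => //; exists i.
  by case=> x Xx [i ->]; exists x (v1 ^+ i); rewrite ?mem_cycle.
have [n Nn nD1n] : exists2 n, n \in N & n v1 \notin D1.
  apply/exists_inP; apply: contraR nabD => /exists_inPn D1n.
  apply: abelianS abD1; apply: irrD => //.
    move=> c u Nc /D1E[x Xx [i ->]]; have Ac := subsetP sNA c Nc.
    rewrite (AutM Ac) ?groupX ?(subsetP sXE x Xx) ?(subsetP sDE v1 Dv1) //.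
    rewrite (AutX Ac) ?(subsetP sDE v1 Dv1) // groupM ?groupX //.
      by rewrite NX // (subsetP sXD1).
    by have := D1n c Nc; rewrite negbK.
  by apply/subsetPn; exists v1.
have nsD1T : D1 <| T.
  apply/andP; split; first exact: subset_trans sD1D (normal_sub nsDT).
  apply/subsetP=> t Tt; rewrite inE; apply/subsetP=> _ /imsetP[_ /D1E[x Xx [i ->]] ->].
  rewrite conjMg conjXg conjg_mulR (conjg_mulR v1) groupM ?groupX //.
    rewrite groupM ?(subsetP sXD1) //; apply: (subsetP (_ : X \subset X)) => //.
    by rewrite commgEl groupM ?groupV // memJ_norm // (subsetP (normal_norm nsXT)).
  by rewrite groupM // (subsetP sXD1) // v1T.
have iD1 : #|D : D1| <= p.
  rewrite -(leq_pmul2l (cardG_gt0 D1)) Lagrange // oD (expnD p 3 1) leq_pmul2r //.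
  exact: Xgen_card.
have DTD1 := pgroup_index_p_comm p_pr pT sD1D (normal_sub nsDT) nsD1T nsDT iD1.
have [t Tt nEt] := subsetPn nTE.
(* As [t] lies outside [E], it acts nontrivially on [D / X], so its fixed points there are the line
   of [v1]. *)
have DTnX d : d \in D -> [~ d, t] \in X -> d \in D1.
  move=> Dd Xdt; apply: contraR nEt => nD1d; apply: (pstab_inner nsfsD pfsD Tt).
  rewrite conj_fsD //; apply/forall_inP=> u Du.
  pose K := commker_group t nXD.
  suffices eqK : K :=: D by have /commkerP[] : u \in K by rewrite eqK.
  apply: (@D_gen K v1 d) => //; first exact: commker_sub.
  - apply/subsetP=> x Xx; apply/commkerP; split; first exact: (subsetP sXD).
    by rewrite commgEl groupM ?groupV // memJ_norm // (subsetP (normal_norm nsXT)).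
  - by apply/commkerP; rewrite v1T.
  exact/commkerP.
pose v2 := n v1; have Dv2 : v2 \in D by apply: ND.
pose w1 := [~ v2, t]; have D1w1 : w1 \in D1 by apply: DTD1.
have Dw1 := subsetP sD1D w1 D1w1.
have nXw1 : w1 \notin X by apply: contra nD1n => /(DTnX _ Dv2).
have v2t : v2 ^ t = v2 * w1 by rewrite conjg_mulR.
clearbody w1.
have D1X u : u \in D1 -> [~ u, t] \in X.
  move=> D1u; pose K := commker_group t nXD.
  suffices /subsetP/(_ u D1u)/commkerP[] : D1 \subset K by [].
  rewrite join_subG cycle_subG; apply/andP; split; last first.
    by apply/commkerP; rewrite v1T.
  apply/subsetP=> x Xx; apply/commkerP; split; first exact: (subsetP sXD).
  by rewrite commgEl groupM ?groupV // memJ_norm // (subsetP (normal_norm nsXT)).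
have Dv2X m : v2 ^+ m \notin X -> ~~ (p %| m).
  by apply: contra => /dvdnP[r ->]; rewrite mulnC expgM eD // expg1n group1.
pose tau := conj_aut E t; have Ntau : tau \in N by apply: TN.
have tauE d : d \in D -> tau d = d * [~ d, t].
  by move=> Dd; rewrite /tau conjE ?(subsetP sDE) // conjg_mulR.
have tau_w1 : coset X (tau w1) = coset X w1.
  by apply/esym/cosetXP; rewrite ?ND // tauE // mulKg D1X.
have tau_v2 : coset X (tau v2) = coset X (v2 * w1).
  by rewrite tauE // -conjg_mulR v2t.
(* Conjugation by [n] turns [tau] into a transvection fixing [v2]; in the basis [w1], [v2] it adds
   [j] times [v2] to [w1]. *)
pose sigma := tau ^ n; have Nsigma : sigma \in N by rewrite groupJ.
have sigmaE d : d \in D -> sigma (n d) = n d * n [~ d, t].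
  move=> Dd; rewrite permJ tauE // (AutM (subsetP sNA n Nn)) ?(subsetP sDE) //.
  exact/(subsetP sD1D)/DTD1.
have sigma_v2 : coset X (sigma v2) = coset X v2.
  apply/esym/cosetXP; rewrite ?ND // sigmaE // mulKg.
  by rewrite NXX ?v1T.
have [d Ed dw] := Aut_preimage (subsetP sNA n Nn) (subsetP sDE w1 Dw1).
have Dd : d \in D by rewrite -(char_AutE (subsetP sNA n Nn) chD) // -dw.
have /D1E[x Xx [j dj]] : [~ d, t] \in D1 by apply: DTD1.
have sigma_w1 : coset X (sigma w1) = coset X (w1 * v2 ^+ j).
  have Dv2j : v2 ^+ j \in D by rewrite groupX.
  apply/esym/cosetXP; [by rewrite groupM | exact: ND |].
  have An := subsetP sNA n Nn.
  rewrite [in sigma w1]dw sigmaE // dj -dw (AutM An) ?(subsetP sXE x) ?groupX ?(subsetP sDE v1) //.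
  rewrite (AutX An) ?(subsetP sDE v1) // (NX Nn Xx) -/v2.
  have -> : (w1 * v2 ^+ j)^-1 * (w1 * (x * v2 ^+ j)) = x ^ (v2 ^+ j).
    by rewrite conjgE invMg !mulgA mulgKV.
  by rewrite memJ_norm // (subsetP nXD).
have nv2j : v2 ^+ j \notin X.
  apply/negP=> Xv2j; have Av1 := subsetP sDE v1 Dv1; have An := subsetP sNA n Nn.
  have Xv1j : v1 ^+ j \in X.
    have : n^-1 (v2 ^+ j) = v1 ^+ j by rewrite -(AutX An) // permK.
    by move=> <-; apply: NXX; rewrite ?groupV.
  have /D1E[x' Xx' [i di]] : d \in D1 by apply: DTnX => //; rewrite dj groupM.
  have dwi : w1 = x' * v2 ^+ i.
    by rewrite dw di (AutM An) ?groupX ?(subsetP sXE x') // (AutX An) // (NX Nn Xx').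
  have nXi : v2 ^+ i \notin X by apply: contra nXw1 => Xi; rewrite dwi groupM.
  case/negP: nD1n; apply: expg_coprime_mem p_pr _ _ (Dv2X _ nXi).
    by move: D1w1; rewrite dwi groupMl // (subsetP sXD1).
  by rewrite eD.
(* [j] is invertible modulo [p]; [k] satisfies [j * k = -1] modulo [p], so that [sigma ^+ k] sends
   [w1] to [w1 * v2^-1] modulo [X]. *)
have [k Xk] : exists k, v2 * (v2 ^+ j) ^+ k \in X.
  pose B := (X <*> <[v2]>)%G.
  have sBD : B \subset D by rewrite join_subG sXD cycle_subG.
  have abB : abelian B.
    by rewrite abelianY abX cycle_abelian cycle_subG (subsetP cDX).
  have Bv2 : v2 \in B by rewrite mem_gen // inE cycle_id orbT.
  have leB : #|B| <= p * #|X|.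
    rewrite oX -expnS; apply: sectional_rank_card p_pr rkS _ abB _.
      exact: subset_trans sBD sDS.
    by move=> y /(subsetP sBD)/eD.
  have nsXB : X <| B := normalS (joing_subl _ _) sBD nsXD.
  exact: quotient_p_combine p_pr (pgroupS sBD pD) nsXB leB (groupX j Bv2) nv2j Bv2.
pose W := coset X w1; pose V := coset X v2.
have cWV : commute W V by apply: (centsP abDX); rewrite mem_quotient.
have Vj m : coset X (v2 ^+ m) = V ^+ m by rewrite morphX // (subsetP nXD).
have Vk : V * V ^+ (j * k) = 1.
  have := coset_id Xk; rewrite -expgM morphM ?(subsetP nXD) ?groupX //= => <-.
  by rewrite Vj.
pose s := sigma ^+ k; have Ns : s \in N by rewrite groupX.
have s_v2 : coset X (s v2) = V.
  rewrite /s; elim: (k) => [|m IHm]; first by rewrite perm1.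
  by rewrite expgSr permM (coset_aut Nsigma _ Dv2 IHm) // ND ?groupX.
have s_w1 : coset X (s w1) = W * V^-1.
  have -> : V^-1 = V ^+ (j * k) by apply: (mulgI V); rewrite mulgV Vk.
  rewrite /s; elim: (k) => [|m IHm]; first by rewrite muln0 mulg1 perm1.
  have Dm : v2 ^+ (j * m) \in D by rewrite groupX.
  have e : coset X ((sigma ^+ m) w1) = coset X (w1 * v2 ^+ (j * m)).
    by rewrite IHm morphM ?(subsetP nXD) //= Vj.
  rewrite expgSr permM (coset_aut Nsigma _ _ e) ?groupM //; last by rewrite ND ?groupX.
  rewrite coset_autM // coset_autX // sigma_v2 sigma_w1 morphM ?(subsetP nXD) ?groupX //=.
  by rewrite Vj -mulgA -expgD mulnS.
pose w := tau * s * tau; have Nw : w \in N by rewrite !groupM.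
have Dtau u : u \in D -> tau u \in D by apply: ND.
have Dsu u : u \in D -> s u \in D by apply: ND.
have w_w1 : coset X (w w1) = V^-1.
  have e1 : coset X (s (tau w1)) = coset X (w1 * v2^-1).
    rewrite (coset_aut Ns _ Dw1 tau_w1) ?Dtau // s_w1.
    by rewrite morphM ?morphV ?(subsetP nXD) ?groupV.
  rewrite !permM (coset_aut Ntau _ _ e1) ?groupM ?groupV ?Dsu ?Dtau //.
  rewrite coset_autM ?groupV // coset_autV // tau_w1 tau_v2.
  by rewrite morphM ?(subsetP nXD) //= invMg mulKVg.
have w_v2 : coset X (w v2) = W.
  have e1 : coset X (s (tau v2)) = coset X w1.
    rewrite (coset_aut Ns _ _ tau_v2) ?groupM ?Dtau // coset_autM // s_v2 s_w1.
    by rewrite -/W mulgA -cWV mulgK.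
  by rewrite !permM (coset_aut Ntau _ Dw1 e1) ?Dsu ?Dtau.
exists (w * w); first exact: groupM.
have ww_w1 : coset X ((w * w) w1) = W^-1.
  have e1 : coset X (w w1) = coset X v2^-1 by rewrite w_w1 morphV ?(subsetP nXD).
  by rewrite permM (coset_aut Nw _ _ e1) ?groupV ?ND // coset_autV // w_v2.
have ww_v2 : coset X ((w * w) v2) = V^-1.
  by rewrite permM (coset_aut Nw _ Dw1 w_v2) ?ND.
pose K := [set u in D | coset X ((w * w) u) == coset X u^-1].
have Nww : w * w \in N by rewrite groupM.
have gK : group_set K.
  apply/group_setP; split=> [|u v /setIdP[Du /eqP eu] /setIdP[Dv /eqP ev]].
    by rewrite inE group1 invg1 (Aut1E (subsetP sNA _ Nww)) eqxx.
  rewrite inE groupM //= coset_autM // eu ev invMg !morphM ?groupV ?(subsetP nXD) //=.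
  apply/eqP; apply: (centsP abDX); rewrite mem_quotient ?groupV //.
suffices eqK : Group gK :=: D.
  by move=> u Du; have : u \in Group gK; [rewrite eqK | case/setIdP=> _ /eqP].
apply: (@D_gen (Group gK) w1 v2) => //.
- by apply/subsetP=> u /setIdP[].
- apply/subsetP=> u Xu; apply/setIdP; rewrite (subsetP sXD) //.
  by rewrite (NX Nww Xu) !coset_id ?groupV.
- by apply/setIdP; rewrite Dw1 ww_w1 morphV ?(subsetP nXD w1 Dw1).
- by apply/setIdP; rewrite Dv2 ww_v2 morphV ?(subsetP nXD v2 Dv2).
apply: contra nD1n; apply: subsetP; rewrite join_subG sXD1 cycle_subG.
exact: D1w1.
Qed.

(* An element f of N inverting D / X commutes with conjugation by t modulo
   Inn(E); comparing both products at q puts [q, t]^2 in E'. *)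
Let commE : {in E, forall q, q ^+ p = 1 ->
  {in T, forall t, [~ q, t] \in X} -> {in T, forall t, [~ q, t] \in E^`(1)}}.
Proof.
move=> q Eq qp qX t Tt; have [f Nf fD] := inverter.
(* Write [q] as [d * u] with [d] in [D] and [u] in [C], the centre of [E]. The p-th power of [u] is
   trivial too, so [u] lies in [D]. *)
have Dq : q \in D.
  move: qp; move: Eq; rewrite -{1}defE => /mulsgP[d u Dd Cu ->].
  rewrite expgMn; last by apply: (centP (subsetP sDC d Dd)).
  rewrite eD // mul1g => up; rewrite groupM //; apply: ZD => //.
  by rewrite ZE.
pose ct := conj_aut E t; have Nct : ct \in N by apply: TN.
have ctE x : x \in E -> ct x = x ^ t by apply: conjE.
(* Inversion of [D / X] commutes with every automorphism of it, so [psi] is trivial there and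
   belongs to the normal p-subgroup [fsD]; hence it is inner. *)
pose psi := (f * ct)^-1 * (ct * f).
have Npsi : psi \in N by rewrite !(groupM, groupV).
have psiX : psi \in fsD.
  apply/factor_stabP; split=> // d Dd.
  have Nfc : f * ct \in N by rewrite groupM.
  have Ncf : ct * f \in N by rewrite groupM.
  pose e := (f * ct)^-1 d; have De : e \in D by rewrite ND ?groupV.
  have de : (f * ct) e = d by rewrite permKV.
  have -> : psi d = (ct * f) e by exact: permM.
  clearbody e; have Dcf : (ct * f) e \in D by apply: ND.
  apply/(cosetXP Dd Dcf); rewrite -de !permM.
  rewrite (coset_aut Nct _ _ (fD e De)) ?groupV ?ND // fD ?ND //.
  by rewrite (AutV (subsetP sNA ct Nct)) // (subsetP sDE).
have [e Ee ee] := ON nsfsD pfsD psiX.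
set x := [~ q, t]; have Xx : x \in X by apply: qX.
have qt : q ^ t = q * x by rewrite conjg_mulR.
have Ex := subsetP sXE x Xx.
pose x0 := q * f q.
have Xx0 : x0 \in X.
  have Dfq : f q \in D by apply: ND.
  have [+ _] := cosetXP Dfq (groupVr Dq); move/(_ (fD q Dq)).
  by rewrite -groupV invMg !invgK.
have fq : f q = q^-1 * x0 by rewrite mulKg.
clearbody x x0.
have Af := subsetP sNA f Nf.
have lhs : (ct * f) q = q^-1 * x0 * x.
  by rewrite permM ctE // qt (AutM Af) // (NX Nf Xx) fq.
have x0t : x0 ^ t = x0.
  by apply/conjg_fixP/commgP/commute_sym; apply: (centP (subsetP cTX t Tt)).
have xe y : y \in X -> y ^ e = y.
  by move=> Xy; apply/conjg_fixP; rewrite XEcent.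
have rhs : psi ((f * ct) q) = x^-1 * (q^-1) ^ e * x0.
  have Efq : f q \in E by apply: NE.
  have -> : (f * ct) q = (f q) ^ t by rewrite permM ctE.
  rewrite ee; last by rewrite memJ_norm // (subsetP nET).
  have qVt : (q^-1) ^ t = x^-1 * q^-1 by rewrite conjVg qt invMg.
  rewrite fq (conjMg q^-1) qVt x0t (conjMg (x^-1 * q^-1)) (xe x0) //.
  by rewrite (conjMg x^-1) (xe x^-1) ?groupV.
have : (ct * f) q = psi ((f * ct) q) by rewrite -(permM (f * ct) psi) mulKVg.
rewrite lhs rhs => eq1.
have Zx : {in E, forall y, commute x y}.
  by move=> y Ey; have /centerP[_] := subsetP sXZ x Xx; apply.
have Zx0 : {in E, forall y, commute x0 y}.
  by move=> y Ey; have /centerP[_] := subsetP sXZ x0 Xx0; apply.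
have x2 : x * x = [~ q^-1, e].
  have e2 : q^-1 * x = x^-1 * (q^-1) ^ e.
    by apply: (mulIg x0); rewrite -eq1 -!mulgA (Zx0 x Ex).
  rewrite commgEl invgK -[in RHS](mulKVg x ((q^-1) ^ e)) -e2.
  by rewrite mulgA -(Zx q Eq) -mulgA mulKVg.
have Ex2 : x ^+ 2 \in E^`(1) by rewrite expgS expg1 x2 mem_commg ?groupV.
have Exp : x ^+ p \in E^`(1) by rewrite eX.
apply: expg_coprime_mem p_pr Ex2 Exp _.
by rewrite gtnNdvd // ltn_neqAle prime_gt1 // andbT; apply: contraL odd_p => /eqP<-.
Qed.

Lemma core_of_critical : core_pair p T E X.
Proof. by split=> // x Zx xp; apply/XP. Qed.
End CoreStructure.

Lemma core_structure (gT : finGroupType) (p : nat) (S T E : {group gT})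
    (N : {group {perm gT}}) :
    prime p -> odd p -> p.-group S ->
    (forall L : {group gT}, L \subset S -> 'm(L) <= 3) ->
    T \subset S -> E <| T -> 'C_T(E) \subset E -> T \subset 'C('Ohm_1('Z(E))) ->
    p ^ 2 <= #|'Ohm_1('Z(E))| -> ~~ (T \subset E) ->
    N \subset Aut E ->
    {in N & 'Ohm_1('Z(E)), forall (a : {perm gT}) x, a x = x} ->
    {in T, forall t, conj_aut E t \in N} ->
    (forall B : {group {perm gT}}, B <| N -> p.-group B ->
       forall a, a \in B -> exists2 e, e \in E & {in E, forall x, a x = x ^ e}) ->
  core_pair p T E 'Ohm_1('Z(E))%G.
Proof.
move=> p_pr odd_p pS rkS sTS nsET cTE cTX ge_X nTE sNA NX TN ON.
have pE := pgroupS (subset_trans (normal_sub nsET) sTS) pS.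
have [D [chD eD ZD DEZ faithD]] := critical_exponent_p p_pr odd_p pE.
exact: (core_of_critical p_pr odd_p pS rkS sTS nsET cTE cTX ge_X nTE sNA NX TN ON
  chD eD ZD DEZ faithD).
Qed.

(** * Transport along injective morphisms *)

Lemma mem_morphim_injm (aT rT : finGroupType) (M : {group aT})
    (f : {morphism M >-> rT}) (A : {set aT}) x :
  'injm f -> A \subset M -> x \in M -> (f x \in f @* A) = (x \in A).
Proof.
move=> injf sAM Mx; apply/idP/idP => [/morphimP[y My Ay] | Ax]; last exact: mem_morphim.
by move/(injmP injf) => -> //.
Qed.

Lemma core_pair_injm (gT rT : finGroupType) p (M T E X : {group gT})
    (f : {morphism M >-> rT}) :
    'injm f -> T \subset M -> E \subset T -> core_pair p T E X ->
  core_pair p (f @* T) (f @* E) (f @* X).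
Proof.
move=> injf sTM sET [sXZ oX eX maxX iEZ oE' faith commE powE].
have sEM := subset_trans sET sTM.
have sXM := subset_trans sXZ (subset_trans (center_sub E) sEM).
have memE x (A : {set gT}) : A \subset M -> x \in M -> (f x \in f @* A) = (x \in A).
  exact: mem_morphim_injm.
have sZM := subset_trans (center_sub E) sEM.
have sE'M := subset_trans (der_sub 1 E) sEM.
have fX x n : x \in M -> x ^+ n = 1 -> f x ^+ n = 1.
  by move=> Mx xn; rewrite -morphX // xn morph1.
have fX' x n : x \in M -> f x ^+ n = 1 -> x ^+ n = 1.
  move=> Mx; rewrite -morphX // => /eqP; rewrite morph_injm_eq1 ?groupX //.
  by move/eqP.
split; rewrite /= -?(injm_center injf sEM) -?(morphim_der f 1 sEM).
- exact: morphimS.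
- by rewrite card_injm.
- by move=> _ /morphimP[x Mx Xx ->]; apply: fX (eX x Xx).
- move=> _ /morphimP[x Mx Zx ->] /(fX' _ _ Mx) xp.
  by rewrite memE // maxX.
- by rewrite index_injm.
- by rewrite card_injm.
- move=> _ /morphimP[t Mt Tt ->] ft; rewrite memE //; apply: faith => // e Ee.
  have Me := subsetP sEM e Ee.
  by rewrite -memE ?groupR // morphR // ft // mem_morphim.
- move=> _ /morphimP[q Mq Eq ->] /(fX' _ _ Mq) qp qX _ /morphimP[t Mt Tt ->].
  rewrite -morphR // (memE _ _ sE'M (groupR Mq Mt)).
  apply: (commE q Eq qp _ t Tt) => u Tu.
  have Mu := subsetP sTM u Tu.
  by rewrite -memE ?groupR // morphR // qX // mem_morphim.
move=> _ /morphimP[e Me Ee ->]; rewrite -morphX // (memE _ _ sE'M (groupX p Me)) => E'e.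
by rewrite powE // morph1.
Qed.

(** * Invariance of Z_S when C_T(X) is contained in E *)

Section MovedSubgroup.
Variables (gT : finGroupType) (p : nat) (S T E Zs : {group gT}).
Variables (A : {group {perm gT}}) (al : {perm gT}).
Hypotheses (p_pr : prime p) (pS : p.-group S).
Hypothesis rkS : forall L : {group gT}, L \subset S -> 'm(L) <= 3.
Hypotheses (sTS : T \subset S) (nsET : E <| T) (nabE : ~~ abelian E).
Let X : {group gT} := 'Ohm_1('Z(E))%G.
Hypotheses (cTX : 'C_T(X) \subset E) (ge_X : p ^ 2 <= #|X|).
Hypothesis sAA : A \subset Aut E.
Hypothesis TA : {in T, forall t, conj_aut E t \in A}.
Hypothesis OA : forall B : {group {perm gT}}, B <| A -> p.-group B ->
  forall a, a \in B -> exists2 e, e \in E & {in E, forall x, a x = x ^ e}.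
Hypotheses (Aal : al \in Aut T) (al_moves : al @: E != E).
Hypotheses (sZsX : Zs \subset X) (ntZs : Zs :!=: 1).
Hypothesis al_Zs : {in Zs, forall z, al z \in Zs}.

Let sET : E \subset T := normal_sub nsET.
Let nET : T \subset 'N(E) := normal_norm nsET.
Let sES : E \subset S := subset_trans sET sTS.
Let pE : p.-group E := pgroupS sES pS.
Let pT : p.-group T := pgroupS sTS pS.
Let p0 : 0 < p := prime_gt0 p_pr.
Let XP x : reflect (x \in 'Z(E) /\ x ^+ p = 1) (x \in X).
Proof. exact: Ohm1_centerP. Qed.
Let eX : {in X, forall x, x ^+ p = 1}. Proof. by move=> x /XP[]. Qed.
Let sXZ : X \subset 'Z(E). Proof. exact: Ohm_sub. Qed.
Let sXE : X \subset E := subset_trans sXZ (center_sub E).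
Let sXS : X \subset S := subset_trans sXE sES.
Let pX : p.-group X := pgroupS sXE pE.
Let abX : abelian X := abelianS sXZ (center_abelian E).
Let chX : X \char E := char_trans (Ohm_char 1 _) (center_char E).
Let nsXT : X <| T := char_normal_trans chX nsET.
Let sXT := normal_sub nsXT.
Let cEX x e : x \in X -> e \in E -> commute x e.
Proof. by move=> Xx Ee; have /centerP[_] := subsetP sXZ x Xx; apply. Qed.
Let conjE t x : t \in T -> x \in E -> conj_aut E t x = x ^ t.
Proof. by move=> Tt Ex; rewrite norm_conj_autE // (subsetP nET). Qed.

Let cTE : 'C_T(E) \subset E.
Proof. by apply: subset_trans cTX; rewrite setIS // centS. Qed.

Let f := autm Aal.
Let injf : 'injm f := injm_autm Aal.
Let fT : f @* T = T := im_autm Aal.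
Let E2 := (f @* E)%G.
Let X2 := (f @* X)%G.

Let oE2 : #|E2| = #|E|. Proof. exact: card_injm. Qed.
Let oX2 : #|X2| = #|X|. Proof. exact: card_injm. Qed.
Let nsE2T : E2 <| T. Proof. by rewrite -fT morphim_normal. Qed.
Let nsX2T : X2 <| T. Proof. by rewrite -fT morphim_normal. Qed.
Let sX2T := normal_sub nsX2T.
Let sX2S := subset_trans sX2T sTS.
Let cE2X2 : E2 \subset 'C(X2).
Proof.
apply/centsP=> _ /morphimP[e Te Ee ->] _ /morphimP[x Tx Xx ->].
by rewrite /commute -!morphM //; congr (f _); apply/esym/cEX.
Qed.
Let eX2 : {in X2, forall x, x ^+ p = 1}.
Proof. by move=> _ /morphimP[x Tx Xx ->]; rewrite -morphX // eX // morph1. Qed.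

(** If [X2] equalled [X], then [E2] would centralise [X] and so lie in [E], although [al] moves
    [E]. *)
Let nX2X : ~~ (X2 \subset X).
Proof.
apply: contra al_moves => sX2X.
have eqX : X2 :=: X by apply/eqP; rewrite eqEcard sX2X oX2 /=.
have sE2E : E2 \subset E.
  by apply: subset_trans cTX; rewrite subsetI (normal_sub nsE2T) -[gval X]eqX.
have /eqP : E2 :==: E by rewrite eqEcard sE2E oE2 /=.
by move=> eqE; apply/eqP; rewrite -[RHS]eqE /= morphimEsub.
Qed.

Let pstab_inner (B : {group {perm gT}}) t :
  B <| A -> p.-group B -> t \in T -> conj_aut E t \in B -> t \in E.
Proof.
move=> nsB pB Tt Bt; have [e Ee et] := OA nsB pB Bt.
rewrite -(mulgKV e t) groupMr //; apply: (subsetP cTE).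
apply/setIP; split; first by rewrite groupM // groupV (subsetP sET).
apply/centP=> x Ex; apply/commute_sym/commgP/conjg_fixP.
by rewrite conjgM -(conjE Tt Ex) et // -conjgM mulgV conjg1.
Qed.

Let rank3_sub y : p ^ 3 <= #|X| -> y \in X2 -> y \in E -> y \in X.
Proof.
move=> ge3 X2y Ey; apply: sectional_rank_adjoin p_pr rkS sXS abX eX _ _ (eX2 X2y) ge3.
  exact: (subsetP sX2S).
by apply/centP=> x Xx; apply/commute_sym/cEX.
Qed.

Let le_pI : #|X| <= p ^ 2 -> ~~ (X2 \subset E) -> #|E :&: X2| <= p.
Proof.
move=> leX nX2E; have pI : (E :&: X2)%G \proper X2.
  by rewrite properE subsetIr subsetI subxx andbT.
have := proper_pgroup_card p_pr (pgroupS sX2S pS) pI; rewrite oX2 => /leq_trans/(_ leX).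
by rewrite expnS expn1 leq_pmul2l.
Qed.

(** If [X] has order above [p ^ 2], rank 3 suffices. Otherwise [E :&: X2] is a normal subgroup of
    order at most [p] in the p-group [T], hence central. *)
Let sIX : ~~ (X2 \subset E) -> E :&: X2 \subset X.
Proof.
move=> nX2E; apply/subsetP=> y /setIP[Ey X2y].
have [leX | gtX] := leqP #|X| (p ^ 2); last first.
  by apply: rank3_sub => //; apply: pgroup_card_ltn p_pr pX gtX.
apply/XP; split; last exact: eX2.
have nsIT : (E :&: X2)%G <| T by apply: normalI.
have iI : #|(E :&: X2)%G : [1 gT]%G| <= p by rewrite indexg1 le_pI.
have Iy : y \in (E :&: X2)%G by apply/setIP.
apply/centerP; split=> // e Ee; apply/commgP.
have := pgroup_index_p_comm p_pr pT (sub1G _) (normal_sub nsIT) (normal1 T) nsIT iI Iy (subsetP sET e Ee).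
by move/set1P/eqP.
Qed.

Let EX2 e x : e \in E -> x \in X2 -> [~ e, x] \in E :&: X2.
Proof.
move=> Ee X2x; apply/setIP; split.
  by rewrite commgEl groupM ?groupV // memJ_norm // (subsetP nET) // (subsetP sX2T).
rewrite commgEr groupM // memJ_norm ?groupV //.
by rewrite (subsetP (normal_norm nsX2T)) // (subsetP sET).
Qed.

Let AE : {in A & E, forall (a : {perm gT}) x, a x \in E}.
Proof. by move=> a x Aa; apply: Aut_closed; apply: (subsetP sAA). Qed.
Let AX : {in A & X, forall (a : {perm gT}) x, a x \in X}.
Proof. by move=> a x Aa; apply: char_Aut chX; apply: (subsetP sAA). Qed.

Let F := 'Phi(E)%G.
Let sFE : F \subset E := Phi_sub E.
Let chXF : (X :&: F)%G \char E := charI chX (Phi_char E).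
Let AXF : {in A & (X :&: F)%G, forall (a : {perm gT}) x, a x \in (X :&: F)%G}.
Proof. by move=> a x Aa; apply: char_Aut chXF; apply: (subsetP sAA). Qed.
Let sXFX : (X :&: F)%G \subset X := subsetIl _ _.
Let B1 := factor_stab_group sAA (subxx E) sXE AX.
Let B2 := factor_stab_group sAA sXE sXFX AXF.
Let nsB : (B1 :&: B2)%G <| A.
Proof.
apply: normalI; first exact: (factor_stab_normal sAA (subxx E) sXE AE AX).
exact: (factor_stab_normal sAA sXE sXFX AX AXF).
Qed.

(* An automorphism trivial on E / X differs from the identity by a
   homomorphism into X, whose kernel contains the Frattini subgroup. *)
Let fix_Phi a : a \in B1 -> {in F, forall x, a x = x}.
Proof.
case/factor_stabP=> Aa aX; have Ea := subsetP sAA a Aa.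
pose K := [set x in E | a x == x].
have KP x : reflect (x \in E /\ a x = x) (x \in K).
  by rewrite inE; apply: (iffP andP) => -[-> /eqP].
have gK : group_set K.
  apply/group_setP; split=> [|x y /KP[Ex ex] /KP[Ey ey]].
    by apply/KP; rewrite group1 (Aut1E Ea).
  by apply/KP; rewrite groupM // (AutM Ea) // ex ey.
have axE x : x \in E -> exists2 u, u \in X & a x = x * u.
  by move=> Ex; exists (x^-1 * a x); rewrite ?aX // mulKVg.
have comX x u v y : x \in X -> u \in E -> v \in E -> y \in X ->
    [~ u * x, v * y] = [~ u, v].
  move=> Xx Eu Ev Xy; have Ex := subsetP sXE x Xx; have Ey := subsetP sXE y Xy.
  rewrite commMgJ commgMJ (eqP (introT commgP (commute_sym (cEX Xy Eu)))) mul1g.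
  rewrite commgMJ (eqP (introT commgP (cEX Xx Ey))) (eqP (introT commgP (cEX Xx Ev))).
  rewrite conj1g !mulg1 -conjgM; apply/conjg_fixP/commgP.
  apply/commute_sym/cEX; first by rewrite groupM.
  by rewrite groupR.
have sKE : Group gK \subset E by apply/subsetP=> x /KP[].
have sE'K : E^`(1) \subset Group gK.
  rewrite gen_subG; apply/subsetP=> _ /imset2P[u v Eu Ev ->]; apply/KP.
  have [[x Xx ux] [y Xy vy]] := (axE u Eu, axE v Ev).
  by rewrite groupR // (AutR Ea) // ux vy comX.
have EpK : {in E, forall e, e ^+ p \in Group gK}.
  move=> e Ee; have [x Xx ex] := axE e Ee; apply/KP; rewrite groupX //.
  rewrite (AutX Ea) // ex expgMn; last exact/commute_sym/cEX.
  by rewrite (eX Xx) mulg1.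
have nsKE : Group gK <| E := sub_der1_normal sE'K sKE.
move=> x Fx; suffices /KP[] : x \in Group gK by [].
apply: subsetP Fx; apply: (Phi_min pE (normal_norm nsKE)).
apply/abelemP=> //; split; first exact: sub_der1_abelian.
by move=> _ /morphimP[u Nu Eu ->]; rewrite -morphX //; apply: coset_id; apply: EpK.
Qed.

(** Elements of [B1] are trivial on [X :&: F] by [fix_Phi], so one of order prime to [p] in [B2] as
    well is trivial on [X], and then on [E]. *)
Let pB : p.-group (B1 :&: B2)%G.
Proof.
apply: pgroup_by_coprime => // a /setIP[B1a B2a] co.
have [Aa aX] := factor_stabP _ _ _ _ B1a.
have [_ aF] := factor_stabP _ _ _ _ B2a.
have Ea := subsetP sAA a Aa.
have fixXF : {in (X :&: F)%G, forall x, a x = x}.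
  by move=> x /setIP[_ Fx]; apply: fix_Phi.
have fixX : {in X, forall x, a x = x}.
  move=> x Xx; apply: (aut_coprime_chain p_pr (pgroupS sXFX pX) Ea co _ _ fixXF).
  - exact: char_sub chXF.
  - exact: (subsetP sXE).
  exact: aF.
apply: (eq_Aut Ea (group1 _)) => x Ex; rewrite perm1.
by apply: (aut_coprime_chain p_pr pX Ea co sXE Ex fixX); apply: aX.
Qed.

(* Otherwise E / X Phi(E) is cyclic, so E is the product of X and a cyclic
   group and hence abelian. *)
Let iXF : #|X : (X :&: F)%G| <= p.
Proof.
have nsFE : F <| E := Phi_normal E.
have sE'F : E^`(1) \subset F by rewrite /= (Phi_joing pE) joing_subl.
have EpF : {in E, forall e, e ^+ p \in F}.
  move=> e Ee; rewrite /= (Phi_joing pE) mem_gen // inE -[p in _ ^+ p]expn1.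
  by rewrite (Mho_p_elt 1 Ee (mem_p_elt pE Ee)) orbT.
have leE := sectional_rank_index p_pr rkS sES nsFE sE'F EpF.
pose K := (X <*> F)%G.
have sKE : K \subset E by rewrite join_subG sXE.
have ltK : p * #|K| < #|E|.
  rewrite ltnNge; apply: contra nabE => leEK.
  have [c Cc defE] : exists2 c, c \in E & E \subset K <*> <[c]>.
    have [sEK | /subsetPn[c Ec nKc]] := boolP (E \subset K).
      by exists 1; rewrite ?group1 // (subset_trans sEK) ?joing_subl.
    exists c => //; have sKc : K <*> <[c]> \subset E by rewrite join_subG sKE cycle_subG.
    have pKc : K \proper K <*> <[c]>.
      apply/properP; split; first exact: joing_subl.
      by exists c; rewrite // mem_gen // inE cycle_id orbT.
    have h := proper_pgroup_card p_pr (pgroupS sKc pE) pKc.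
    have /eqP<- // : K <*> <[c]> == E.
    by rewrite eqEcard sKc; apply: leq_trans leEK h.
  have sXc : X <*> <[c]> \subset E by rewrite join_subG sXE cycle_subG.
  have : 'Phi(E) <*> (X <*> <[c]>) = E.
    apply/eqP; rewrite eqEsubset join_subG Phi_sub sXc /=.
    by rewrite joingA (joingC 'Phi(E)).
  move/Phi_nongen; rewrite genGid => <-.
  rewrite abelianY abX cycle_abelian cycle_subG /=.
  by apply/centP=> x Xx; apply/commute_sym/cEX.
have pK := pgroupS sKE pE.
have {}ltK : p ^ 2 * #|K| <= #|E|.
  move: ltK; rewrite (card_pgroup pK) -expnS -expnD.
  exact: pgroup_card_ltn p_pr pE.
have leK : p ^ 2 * #|K| <= p ^ 2 * (p * #|F|).
  apply: leq_trans ltK _; rewrite -(Lagrange sFE) mulnA -expnSr.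
  by rewrite [leqLHS]mulnC leq_pmul2r.
rewrite leq_pmul2l ?expn_gt0 ?p0 // in leK.
have oK : (#|K| * #|X :&: F| = #|X| * #|F|)%N.
  by rewrite mul_cardG -norm_joinEl // (subset_trans sXE) ?normal_norm.
rewrite -(leq_pmul2l (cardG_gt0 (X :&: F)%G)) Lagrange //.
rewrite -(leq_pmul2r (cardG_gt0 F)) -oK mulnC -mulnA leq_pmul2l //.
Qed.

(** If [X2] were not in [E], conjugation by its elements would be trivial on [E / X] by [sIX], and
    on [X / (X :&: F)] because that has order at most [p]. So it would lie in a normal p-subgroup
    and be inner, which puts [X2] in [E] after all. *)
Let sX2E : X2 \subset E.
Proof.
apply: contraT => nX2E; case/subsetPn: (nX2E) => x X2x; case/negP.
have Tx := subsetP sX2T x X2x.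
apply: (pstab_inner nsB pB Tx); apply/setIP; split; apply/factor_stabP.
  split=> [|e Ee]; first exact: TA.
  by rewrite conjE // -commgEl (subsetP (sIX nX2E)) // EX2.
split=> [|e Xe]; first exact: TA.
rewrite conjE ?(subsetP sXE) // -commgEl.
have nsXFT : (X :&: F)%G <| T := char_normal_trans chXF nsET.
exact: pgroup_index_p_comm p_pr pT sXFX sXT nsXFT nsXT iXF e x Xe Tx.
Qed.

Let oX : #|X| = (p ^ 2)%N.
Proof.
apply/eqP; rewrite eqn_leq ge_X andbT leqNgt.
apply: contra nX2X => /(pgroup_card_ltn p_pr pX) ge3.
by apply/subsetP=> y X2y; apply: rank3_sub => //; apply: (subsetP sX2E).
Qed.

Let Z1 := (X :&: X2)%G.
Let nsZ1T : Z1 <| T. Proof. exact: normalI. Qed.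

Let sZs : Zs \subset Z1.
Proof.
rewrite subsetI sZsX /=.
have /eqP<- : al @: Zs == Zs.
  rewrite eqEcard card_imset ?leqnn ?andbT; last exact: perm_inj.
  by apply/subsetP=> _ /imsetP[z Zz ->]; apply: al_Zs.
apply/subsetP=> _ /imsetP[z Zz ->].
have Xz := subsetP sZsX z Zz.
by rewrite -(autmE Aal) mem_morphim // (subsetP sXT).
Qed.

Let le_Z1 : #|Z1| <= p.
Proof.
have pZ1 : Z1 \proper X2 by rewrite properE subsetIr /= subsetI subxx andbT.
have := proper_pgroup_card p_pr (pgroupS sX2S pS) pZ1.
by rewrite oX2 oX expnS expn1 leq_pmul2l.
Qed.

Let ge_Zs : p <= #|Zs|.
Proof.
have pZs : 1%G \proper Zs by rewrite proper1G.
have := proper_pgroup_card p_pr (pgroupS sZsX pX) pZs.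
by rewrite cards1 muln1.
Qed.

Let defZ1 : Zs :=: Z1.
Proof. by apply/eqP; rewrite eqEcard sZs (leq_trans le_Z1). Qed.

Let X2Z1 : {in X2 & E, forall b e, [~ b, e] \in Zs}.
Proof.
move=> b e X2b Ee; rewrite defZ1.
have i : #|X2 : Z1| <= p.
  rewrite -(leq_pmul2l (cardG_gt0 Z1)) Lagrange ?subsetIr // oX2 oX.
  by rewrite -defZ1 leq_pmul2r.
apply: (pgroup_index_p_comm p_pr pT (subsetIr _ _) sX2T nsZ1T nsX2T i X2b).
exact: (subsetP sET).
Qed.

(** [Zs] has order [p], so one nontrivial [u] with both [u] and [a u] in [Zs] suffices. By [X2Z1]
    commutators of [b] with [E] are the candidates; the choice depends on whether [b] and [a b]
    commute. *)
Lemma moved_subgroup_invariant : {in A & Zs, forall (a : {perm gT}) z, a z \in Zs}.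
Proof.
have [b X2b nXb] := subsetPn nX2X; have Eb := subsetP sX2E b X2b.
have [e0 Ee0 nb] : exists2 e, e \in E & [~ b, e] != 1.
  apply/exists_inP; apply: contraR nXb => /exists_inPn cb.
  apply/XP; split; last exact: eX2.
  apply/centerP; split=> // e Ee; apply/commgP.
  by have := cb e Ee; rewrite negbK.
move=> a z Aa; have Ea := subsetP sAA a Aa.
suffices [u [Zu nu Zau]] : exists u, [/\ u \in Zs, u != 1 & a u \in Zs].
  have nu1 : u \notin 1%G by apply: contra nu => /set1P->.
  have leZ : #|Zs| <= p * #|[1 gT]%G| by rewrite cards1 muln1 defZ1.
  have pZ : p.-group Zs := pgroupS sZsX pX.
  move=> Zz; have Ez := subsetP (subset_trans sZsX sXE) z Zz.
  have Eu := subsetP (subset_trans sZsX sXE) u Zu.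
  have [k /set1P ek] := quotient_p_combine p_pr pZ (normal1 _) leZ Zu nu1 (groupVr Zz).
  have -> : z = u ^+ k by apply/eqP; rewrite eq_mulVg1 ek.
  by rewrite (AutX Ea) // groupX.
have Ab : a b \in E by apply: AE.
have [/eqP cb | nc] := boolP ([~ b, a b] == 1); last first.
  (* With [b = a c], the automorphism [a] maps [[~ c, b]] to [[~ b, a b]], and both lie in [Zs]. *)
  have [c Ec bc] := Aut_preimage Ea Eb.
  have Zc : [~ c, b] \in Zs by rewrite commg_swap_in X2Z1.
  have ac : a [~ c, b] = [~ b, a b] by rewrite (AutR Ea) // -bc.
  exists [~ c, b]; split=> //; last by rewrite ac X2Z1.
  by apply: contra nc => /eqP c1; rewrite -ac c1 (Aut1E Ea).
pose B := (X <*> <[b]>)%G.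
have cXb : <[b]> \subset 'C(X).
  by rewrite cycle_subG; apply/centP=> x Xx; apply/commute_sym/cEX.
have sBE : B \subset E by rewrite join_subG sXE cycle_subG.
have sBS := subset_trans sBE sES.
have abB : abelian B by rewrite abelianY abX cycle_abelian.
have BP y : reflect (exists2 x, x \in X & exists i, y = x * b ^+ i) (y \in B).
  rewrite /= cent_joinEr //; apply: (iffP mulsgP) => [[x _ Xx /cycleP[i ->] ->]|].
    by exists x => //; exists i.
  by case=> x Xx [i ->]; exists x (b ^+ i); rewrite ?mem_cycle.
have eB : {in B, forall y, y ^+ p = 1}.
  move=> y /BP[x Xx [i ->]]; rewrite expgMn; last first.
    by apply/commuteX/cEX.
  by rewrite (eX Xx) mul1g -expgM mulnC expgM (eX2 X2b) expg1n.
have ge3 : p ^ 3 <= #|B|.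
  apply: pgroup_card_ltn p_pr (pgroupS sBS pS) _; rewrite -oX proper_card //.
  apply/properP; split; first exact: joing_subl.
  by exists b; rewrite // mem_gen // inE cycle_id orbT.
(* [a b] centralises the elementary abelian group [B] of order at least [p ^ 3], so rank 3 puts it
   in [B]. As [X] is central in [E], [a] then maps [[~ b, e0]] to a commutator of a power of [b]
   with an element of [E]. *)
have /BP[x Xx [k abk]] : a b \in B.
  apply: sectional_rank_adjoin p_pr rkS sBS abB eB _ _ _ ge3.
  - exact: (subsetP sES).
  - rewrite centY inE; apply/andP; split.
      by apply/centP=> x Xx; apply/commute_sym/cEX.
    apply/centP=> _ /cycleP[i ->]; apply/commuteX/commute_sym/commgP.
    by rewrite cb.
  by rewrite -(AutX Ea) // (eX2 X2b) (Aut1E Ea).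
exists [~ b, e0]; split=> //; first exact: X2Z1.
have Ae0 : a e0 \in E by apply: AE.
rewrite (AutR Ea) // abk commMgJ (eqP (introT commgP (cEX Xx Ae0))) conj1g mul1g.
by rewrite X2Z1 // groupX.
Qed.
End MovedSubgroup.

(** * Fusion *)

(** A Sylow p-subgroup [R] of [H] is Sylow in [G], because ['N_G(R)] cannot leave [H]. So [B] lies
    in [H] and, being normal, in [H :^ g] for [g] outside [H], which meets [H] in a group of order
    prime to [p]. *)
Lemma strongly_embedded_pcore (gT : finGroupType) (p : nat) (G B : {group gT}) :
    prime p -> strongly_p_embedded_in p G -> B <| G -> p.-group B -> B :=: 1.
Proof.
move=> p_pr [H [/properP[sHG [g Gg nHg]] pH tiH]] nsBG pB.
have noK (K : {group gT}) x : x \in G -> x \notin H -> K \subset H :&: H :^ x ->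
    p %| #|K| -> False.
  move=> Gx nHx sK pK; have /negP[] : ~~ (p %| #|H :&: H :^ x|).
    by apply: tiH; apply/setDP.
  exact: dvdn_trans pK (cardSg sK).
have [R sylR] := Sylow_exists p H; have [sRH pR _] := and3P sylR.
have ntR : R :!=: 1.
  apply: contraTneq pH => R1.
  by rewrite -p'natE // -partn_eq1 ?cardG_gt0 // -(card_Hall sylR) R1 cards1.
have [_ pR' _] := pgroup_pdiv pR ntR.
have sRG := subset_trans sRH sHG.
have sNH : 'N_G(R) \subset H.
  apply/subsetP=> x /setIP[Gx nRx]; apply: contraT => nHx.
  by case: (noK R x Gx nHx) => //; rewrite subsetI sRH -{1}(normP nRx) conjSg.
have sylG : p.-Sylow(G) R.
  by rewrite -Sylow_subnorm; apply: (pHall_subl _ sNH sylR); rewrite subsetI sRG normG.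
have sBH : B \subset H.
  by rewrite (subset_trans (pcore_max pB nsBG)) // (subset_trans (pcore_sub_Hall sylG)).
apply: contraTeq isT => ntB; have [_ pB' _] := pgroup_pdiv pB ntB.
case: (noK B g Gg nHg) => //; rewrite subsetI sBH.
by rewrite -(normP (subsetP (normal_norm nsBG) g Gg)) conjSg.
Qed.

(** * Transvections of X and their conjugates *)

Section Transvections.
Variables (gT : finGroupType) (p : nat) (M X Z D : {group gT}) (t c : {perm gT}).
Hypotheses (p_pr : prime p) (pX : p.-group X) (abX : abelian X).
Hypotheses (sXM : X \subset M) (oX : #|X| = (p ^ 2)%N).
Hypotheses (oZ : #|Z| = p) (oD : #|D| = p) (sZX : Z \subset X) (sDX : D \subset X).
Hypotheses (At : t \in Aut M) (Ac : c \in Aut M).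
Hypothesis cX : {in X, forall x, c x \in X}.
Hypothesis tX : {in X, forall x, x^-1 * t x \in Z}.
Hypothesis tfix : {in X, forall x, (t x == x) = (x \in Z)}.
Hypothesis nDZ : ~~ (D \subset Z).
Hypothesis cZ : ~~ [forall z in Z, c z \in Z].


Let prime_sub (Y K : {group gT}) : #|K| = p -> Y :&: K != 1 -> K \subset Y.
Proof. by move=> oK nYK; apply: prime_meetG; rewrite ?oK // setIC. Qed.

(** An element [y] of [Y] outside [Z] yields [y^-1 * t y], nontrivial in both [Z] and [Y]; so [Y]
    contains [Z]. If [Y] is proper in [X], it has order at most [p] and equals [Z], which [c]
    moves. *)
Lemma transvections_irreducible (Y : {group gT}) :
  Y \char M -> Y \subset X -> Y :=: 1 \/ X \subset Y.
Proof.
move=> chY sYX; have [Y1 | ntY] := eqVneq (Y : {set gT}) 1; [by left | right].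
apply: contraR cZ => nXY; have pY := pgroupS sYX pX.
have leY : #|Y| <= p.
  have := proper_pgroup_card p_pr pX (_ : Y \proper X).
  rewrite properE sYX nXY => /(_ isT); rewrite oX expnS expn1 leq_pmul2l //.
  exact: prime_gt0.
have YZ : Z \subset Y.
  apply: prime_sub => //; have [y Yy ny] := trivgPn _ ntY.
  have Xy := subsetP sYX y Yy.
  have [Zy | nZy] := boolP (y \in Z).
    by apply/trivgPn; exists y; rewrite // inE Yy.
  apply/trivgPn; exists (y^-1 * t y); last by rewrite -eq_mulVg1 eq_sym tfix.
  by rewrite inE tX // groupM ?groupV // (char_Aut At chY).
have eqYZ : Z :=: Y by apply/eqP; rewrite eqEcard YZ oZ.
apply/forall_inP=> z; rewrite eqYZ; apply: (char_Aut Ac chY).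
Qed.

(** [c] takes [Z] to another line of [X], and the powers of [t] permute the lines other than [Z]
    transitively; so some [c * t ^+ k] takes [Z] to [D]. *)
Lemma transvections_center : exists g : {perm gT},
  [/\ g \in Aut M, {in D, forall x, g x = x}, {in X, forall x, x^-1 * g x \in D}
    & exists2 x, x \in X & g x != x].
Proof.
have nsZX : Z <| X by rewrite -sub_abelian_normal.
have leXZ : #|X| <= p * #|Z| by rewrite oX oZ.
have pZ := pgroupS sZX pX; have pD := pgroupS sDX pX.
have le1 (K : {group gT}) : #|K| = p -> #|K| <= p * #|[1 gT]%G|.
  by move=> ->; rewrite cards1 muln1.
have [z0 Zz0 nz0] : exists2 z, z \in Z & c z \notin Z by apply/forall_inPn.
have Xz0 := subsetP sZX z0 Zz0; have Mz0 := subsetP sXM z0 Xz0.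
have [e De nZe] := subsetPn nDZ; have Xe := subsetP sDX e De.
(* [m] is chosen so that [c z1^-1] lies in the coset of [e] modulo [Z]; the power [t ^+ k] found
   below moves it to [e] itself. *)
have [m Zm] := quotient_p_combine p_pr pX nsZX leXZ (cX Xz0) nz0 Xe.
pose z1 := z0 ^+ m; have Zz1 : z1 \in Z by rewrite groupX.
have cz1 : c z1 = (c z0) ^+ m by rewrite (AutX Ac).
pose u := e^-1 * t e; have Zu : u \in Z by apply: tX.
have nu : u \notin 1%G.
  by apply: contra nZe => /set1P u1; rewrite -tfix // eq_sym eq_mulVg1 -/u u1.
have tn n x : x \in X -> (t ^+ n) x = x * (x^-1 * t x) ^+ n.
  move=> Xx; elim: n => [|n IHn]; first by rewrite perm1 mulg1.
  have Zc := tX Xx; have Zcn := groupX n Zc.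
  have XZ y : y \in Z -> y \in M by move=> Zy; rewrite (subsetP sXM) // (subsetP sZX).
  rewrite expgSr permM IHn (AutM At (subsetP sXM x Xx) (XZ _ Zcn)).
  have /eqP-> : t ((x^-1 * t x) ^+ n) == (x^-1 * t x) ^+ n.
    by rewrite tfix // (subsetP sZX).
  by rewrite expgS mulgA mulKVg.
have [k /set1P ek] := quotient_p_combine p_pr pZ (normal1 _) (le1 Z oZ) Zu nu (groupVr Zm).
pose r := c * t ^+ k; have Ar : r \in Aut M by rewrite groupM ?groupX.
have rX : {in X, forall x, r x \in X}.
  move=> x Xx; rewrite permM tn ?cX // groupM ?cX ?groupX //.
  by rewrite (subsetP sZX) ?tX ?cX.
have rz1 : r z1^-1 = e.
  have Mz1 : z1 \in M by rewrite groupX.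
  have Ez : (e * c z1) = u ^+ k.
    by apply/eqP; rewrite eq_mulVg1 cz1 ek.
  have Ecz : c z1^-1 = (u ^+ k)^-1 * e.
    by rewrite (AutV Ac) // -Ez invMg mulgKV.
  have Mu : u \in M by rewrite (subsetP sXM) // (subsetP sZX).
  have tu : t (u ^+ k)^-1 = (u ^+ k)^-1.
    by apply/eqP; rewrite tfix ?groupV ?groupX // (subsetP sZX).
  have tku n : (t ^+ n) (u ^+ k)^-1 = (u ^+ k)^-1.
    by elim: n => [|n IHn]; rewrite ?perm1 // expgSr permM IHn.
  have Mukv : (u ^+ k)^-1 \in M by rewrite groupV groupX.
  rewrite permM Ecz (AutM (groupX k At)) ?(subsetP sXM e) // tku tn // -/u.
  have Xuk : u ^+ k \in X by rewrite groupX // (subsetP sZX).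
  by rewrite (centsP abX e Xe _ Xuk) mulKg.
have ne : e \notin 1%G by apply: contra nZe => /set1P->.
have nz1 : z1^-1 \notin 1%G.
  by apply: contra ne => /set1P z11; rewrite -rz1 z11 (Aut1E Ar) group1.
have cyc (K : {group gT}) a b : #|K| = p -> p.-group K -> a \in K -> a \notin 1%G ->
    b \in K -> exists i, b = a ^+ i.
  move=> oK pK Ka na Kb.
  have [i /set1P ei] := quotient_p_combine p_pr pK (normal1 _) (le1 K oK) Ka na (groupVr Kb).
  by exists i; apply/eqP; rewrite eq_mulVg1 ei.
have imX : r @: X = X.
  apply/eqP; rewrite eqEcard card_imset ?leqnn ?andbT; last exact: perm_inj.
  by apply/subsetP=> _ /imsetP[x Xx ->]; apply: rX.
(* r maps Z onto D, so t ^ r is a transvection with centre D. *)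
exists (t ^ r); split.
- by rewrite groupJ.
- move=> x Dx; have [i ->] := cyc D e x oD pD De ne Dx.
  rewrite (AutX (groupJ At Ar)) ?(subsetP sXM) //; congr (_ ^+ _).
  rewrite -{1}rz1 permJ -[RHS]rz1; congr (r _).
  by apply/eqP; rewrite tfix ?groupV ?groupX.
- move=> x; rewrite -{1}imX => /imsetP[w Xw ->]; rewrite permJ.
  have Mw := subsetP sXM w Xw; have Mtw : t w \in M by apply: Aut_closed.
  rewrite -(AutV Ar) // -(AutM Ar) ?groupV //.
  have [i ->] := cyc Z z1^-1 (w^-1 * t w) oZ pZ (groupVr Zz1) nz1 (tX Xw).
  have Mz1V : z1^-1 \in M by rewrite groupV groupX.
  by rewrite (AutX Ar i Mz1V) rz1; apply: groupX.
exists (r e); first exact: rX.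
by rewrite permJ (inj_eq perm_inj) tfix.
Qed.
End Transvections.

(** * Fusion systems and their automorphism groups *)

Section FusionSystem.
Variables (gT : finGroupType) (S : {group gT}) (F : fsys gT).
Hypothesis fusF : is_fusion_system S F.
Implicit Types P Q : {group gT}.

Lemma fusion_morph (P : {set gT}) f : F P f -> {in P &, {morph f : x y / x * y}}.
Proof. by case: fusF => h _ _ _ _ /h[_ _ []]. Qed.

Lemma fusion_inj (P : {set gT}) f : F P f -> {in P &, injective f}.
Proof. by case: fusF => h _ _ _ _ /h[_ _ []]. Qed.

Lemma fusion_im (P : {set gT}) f : F P f -> f @: P \subset S.
Proof. by case: fusF => h _ _ _ _ /h[_ _ []]. Qed.

Lemma fusion_dom (P : {set gT}) f : F P f -> P \subset S.
Proof. by case: fusF => h _ _ _ _ /h[]. Qed.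

Lemma fusion_eq (P : {set gT}) (f g : {ffun gT -> gT}) :
  F P f -> {in P, f =1 g} -> F P g.
Proof. by case: fusF => _ h _ _ _; apply: h. Qed.

Lemma fusion_conj P s : P \subset S -> s \in S -> F P [ffun x => x ^ s].
Proof. by case: fusF => _ _ h _ _; apply: h; apply: groupP. Qed.

Lemma fusion_comp (P Q : {set gT}) f g : F P f -> F Q g -> f @: P \subset Q ->
  F P [ffun x => g (f x)].
Proof. by case: fusF => _ _ _ h _; apply: h. Qed.

Lemma fusion_inv (P : {set gT}) f : F P f ->
  exists2 g, F (f @: P) g & {in P, cancel f g}.
Proof. by case: fusF => _ _ _ _ h; apply: h. Qed.

Lemma fusion_id P : P \subset S -> F P [ffun x => x].
Proof.
move=> sPS; apply: fusion_eq (fusion_conj sPS (group1 S)) _ => x _.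
by rewrite !ffunE conjg1.
Qed.

Lemma fusion_restrict P (Q : {set gT}) f : P \subset Q -> F Q f -> F P f.
Proof.
move=> sPQ Ff; have sPS := subset_trans sPQ (fusion_dom Ff).
apply: fusion_eq (fusion_comp (fusion_id sPS) Ff _) _ => [|x _]; last by rewrite !ffunE.
by apply/subsetP=> _ /imsetP[x Px ->]; rewrite ffunE (subsetP sPQ).
Qed.

Lemma Fconj_refl P : P \subset S -> Fconj F P P.
Proof.
move=> sPS; exists [ffun x => x]; first exact: fusion_id.
by rewrite (eq_imset _ (ffunE _)) imset_id.
Qed.

Lemma Fconj_trans (P Q R : {set gT}) : Fconj F P Q -> Fconj F Q R -> Fconj F P R.
Proof.
case=> f Ff eQ [g Fg eR]; exists [ffun x => g (f x)].
  by apply: fusion_comp Ff Fg _; rewrite eQ.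
by rewrite (eq_imset _ (ffunE _)) (imset_comp g f) eQ.
Qed.

Lemma fully_normalized_exists P : P \subset S ->
  exists2 f, F P f & fully_normalized S F (f @: P).
Proof.
move=> sPS; pose cj := [pred Q : {set gT} | [exists f, F P f && (f @: P == Q)]].
have cjP (U : {set gT}) : reflect (Fconj F P U) (cj U).
  by apply: (iffP exists_inP) => -[f Ff]; [move/eqP | move=> <-]; exists f.
have cjPP : cj P by apply/cjP/Fconj_refl.
case: (arg_maxnP (fun Q : {set gT} => #|'N_S(Q)|) cjPP) => Q /cjP[f Ff eQ] maxQ.
exists f => // R cQR; rewrite eQ; apply: maxQ; apply/cjP.
by apply: Fconj_trans cQR; exists f.
Qed.

Lemma AutFP P a :
  reflect (a \in Aut P /\ F P [ffun x => a x]) (a \in AutF F P).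
Proof. exact: setIdP. Qed.

Lemma AutF_group_set P : P \subset S -> group_set (AutF F P).
Proof.
move=> sPS; apply/group_setP; split=> [|a b /AutFP[Aa Fa] /AutFP[Ab Fb]].
  apply/AutFP; split; first exact: group1.
  by apply: fusion_eq (fusion_id sPS) _ => x _; rewrite !ffunE perm1.
apply/AutFP; split; first exact: groupM.
apply: fusion_eq (fusion_comp Fa Fb _) _ => [|x _]; last by rewrite !ffunE permM.
by apply/subsetP=> _ /imsetP[x Px ->]; rewrite ffunE; apply: Aut_closed.
Qed.

Lemma conj_aut_AutF P t : P \subset S -> t \in 'N_S(P) -> conj_aut P t \in AutF F P.
Proof.
move=> sPS /setIP[St nPt]; apply/AutFP; split; first exact: Aut_aut.
by apply: fusion_eq (fusion_conj sPS St) _ => x Px; rewrite !ffunE norm_conj_autE.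
Qed.

Lemma InnE P : Inn P = conj_aut P @* P.
Proof.
apply/setP=> a; apply/idP/idP.
  case/setIdP=> Aa /exists_inP[s /setIP[Ps nPs] /forall_inP eas].
  have -> : a = conj_aut P s.
    apply: (eq_Aut Aa); first exact: Aut_aut.
    by move=> x Px; rewrite norm_conj_autE //; apply/eqP/eas.
  by rewrite mem_morphim.
case/morphimP=> s nPs Ps ->; apply/setIdP; split; first exact: Aut_aut.
apply/exists_inP.
exists s; first by rewrite inE Ps.
by apply/forall_inP=> x Px; rewrite norm_conj_autE.
Qed.

(** The image of [B] in Out_F(P) is a normal p-subgroup, hence trivial by
    [strongly_embedded_pcore]. *)
Lemma essential_pcore_inner (p : nat) P (A B : {group {perm gT}}) :
    prime p -> P \subset S -> A :=: AutF F P ->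
    strongly_p_embedded_in p (OutF F P) -> B <| A -> p.-group B ->
  forall a, a \in B -> exists2 e, e \in P & {in P, forall x, a x = x ^ e}.
Proof.
move=> p_pr sPS defA strong nsBA pB a Ba.
pose I := (conj_aut P @* P)%G.
have sIA : I \subset A.
  apply/subsetP=> _ /morphimP[s nPs Ps ->]; rewrite defA conj_aut_AutF //.
  by rewrite inE nPs (subsetP sPS).
have sAA : A \subset Aut P by rewrite defA; apply/subsetP=> c /AutFP[].
have nIA : A \subset 'N(I).
  apply/subsetP=> c Ac; rewrite inE; apply/subsetP=> _ /imsetP[_ /morphimP[s nPs Ps ->] ->].
  have Aut_c := subsetP sAA c Ac; have Pcs : c s \in P by apply: Aut_closed.
  have -> : conj_aut P s ^ c = conj_aut P (c s).
    apply: (@eq_Aut _ P); rewrite ?Aut_aut ?groupJ ?Aut_aut // => x Px.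
    have [y Py ->] := Aut_preimage Aut_c Px.
    by rewrite permJ !norm_conj_autE ?(subsetP (normG P)) ?Aut_closed // (AutJ Aut_c).
  by rewrite mem_morphim // (subsetP (normG P)).
have BI : B / I = 1.
  apply: (@strongly_embedded_pcore _ p (A / I)%G (B / I)%G p_pr).
  - by rewrite /= defA -[conj_aut _ @* _]InnE.
  - exact: quotient_normal.
  exact: quotient_pgroup.
have /subsetP/(_ a Ba)/morphimP[e nPe Pe ->] : B \subset I.
  by rewrite -quotient_sub1 ?BI // (subset_trans (normal_sub nsBA)).
by exists e => // x Px; rewrite norm_conj_autE.
Qed.

Lemma fusion_aut (P : {group gT}) f : F P f -> f @: P \subset P ->
  exists2 k : {perm gT}, k \in Aut P & {in P, k =1 f}.
Proof.
move=> Ff sfP; pose phi := Morphism (fusion_morph Ff).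
have injphi : 'injm phi by apply/injmP; apply: fusion_inj Ff.
have imphi : phi @* P = P.
  apply/eqP; rewrite eqEcard card_injm ?subxx // leqnn andbT morphimEdom.
  exact: sfP.
by exists (aut injphi imphi); [apply: Aut_aut | apply: autE].
Qed.

End FusionSystem.

(** Fully normalised subgroups are fully centralised, so [f] extends to [Nphi]. This contains
    ['C_S(X)]: its elements act trivially on [X], so the identity serves as the matching element. *)
Lemma saturated_extend (gT : finGroupType) (p : nat) (S X : {group gT}) (F : fsys gT) f :
    saturated p S F -> F X f -> fully_normalized S F (f @: X) ->
  exists2 g, F 'C_S(X)%G g & {in X, f =1 g}.
Proof.
case=> fusF [sat2 sat3] Ff fnX; have [g Fg _] := fusion_inv fusF Ff.
have gfX : group_set (f @: X) by case: fusF => h _ _ _ _; case: (h _ _ Fg).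
have [fcX _] := sat2 _ gfX (fusion_im fusF Ff) fnX.
have [h Fh fh] := sat3 _ _ Ff fcX; exists h => //.
apply: (fusion_restrict fusF) Fh; apply/subsetP=> x /setIP[Sx cXx].
have cx y : y \in X -> y ^ x = y.
  by move=> Xy; apply/conjg_fixP/commgP/commute_sym; apply: (centP cXx).
apply/setIdP; split; first by rewrite inE Sx (subsetP (cent_sub X)).
apply/exists_inP; exists 1; first exact: group1.
by apply/forall_inP=> y Xy; rewrite cx // conjg1.
Qed.

(** * Passage to a fully normalised conjugate of X *)

Section CoreFusion.
Variables (gT : finGroupType) (p : nat) (S E X Z : {group gT}) (F : fsys gT).
Variable (a : {perm gT}).
Hypotheses (p_pr : prime p) (odd_p : odd p) (pS : p.-group S).
Hypothesis rkS : forall L : {group gT}, L \subset S -> 'm(L) <= 3.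
Hypotheses (satF : saturated p S F) (sES : E \subset S).
Hypothesis essE : forall P, Fconj F E P ->
  'C_S(P) \subset P /\ #|'N_S(P)| <= #|'N_S(E)|.
Hypothesis coreE : core_pair p 'N_S(E)%G E X.
Hypothesis cNX : 'N_S(E) \subset 'C(X).
Hypotheses (sZX : Z \subset X) (oZ : #|Z| = p) (sZZS : Z \subset 'Z(S)).
Hypothesis maxZ : {in 'Z(S), forall x, x ^+ p = 1 -> x \in Z}.
Hypotheses (Aa : a \in AutF F E) (aZ : ~~ [forall z in Z, a z \in Z]).
Hypothesis nE'Z : ~~ (E^`(1) \subset Z).

Let fusF : is_fusion_system S F := proj1 satF.
Let T := 'N_S(E)%G.
Let M := 'C_S(X)%G.
Let p1 : 1 < p := prime_gt1 p_pr.
Let p0 : 0 < p := prime_gt0 p_pr.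
Let pE : p.-group E := pgroupS sES pS.
Let oX := core_card coreE.
Let eX := core_exp coreE.
Let sXZ := core_sub coreE.
Let maxX := core_max coreE.
Let sXE : X \subset E := subset_trans sXZ (center_sub E).
Let sXS : X \subset S := subset_trans sXE sES.
Let pX : p.-group X := pgroupS sXE pE.
Let abX : abelian X := abelianS sXZ (center_abelian E).
Let sET : E \subset T. Proof. by rewrite subsetI sES normG. Qed.
Let sTM : T \subset M. Proof. by rewrite subsetI subsetIl. Qed.
Let sEM : E \subset M := subset_trans sET sTM.
Let sMS : M \subset S := subsetIl _ _.
Let sXM : X \subset M := subset_trans sXE sEM.
Let cMX : M \subset 'C(X) := subsetIr _ _.
Let AaE : a \in Aut E. Proof. by case/AutFP: Aa. Qed.

Let sXZM : X \subset 'Z(M). Proof. by rewrite subsetI sXM centsC. Qed.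

Let Z_in_X x : x \in 'Z(M) -> x ^+ p = 1 -> x \in X.
Proof.
case/centerP=> Mx cMx xp; apply: maxX => //.
have [cSE _] := essE (Fconj_refl fusF sES).
have cEx : x \in 'C(E) by apply/centP=> y Ey; apply/cMx/(subsetP sEM).
apply/setIP; split=> //; apply: (subsetP cSE); apply/setIP; split=> //.
exact: (subsetP sMS).
Qed.

Let nsZS : Z <| S.
Proof.
by rewrite /normal (subset_trans sZX sXS) cents_norm // centsC (subset_trans sZZS) ?subsetIr.
Qed.

(** [X] is too large to be central in [S], so [M] is proper and ['N_S(M)] is larger than [M]. It
    normalises [X], the set of elements of order dividing [p] in ['Z(M)]. *)
Let g_ex : exists2 g, g \in 'N_S(X) & g \notin 'C(X).
Proof.
have nSM : ~~ (S \subset M).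
  apply/negP=> sSM; have : #|X| <= #|Z|.
    apply: subset_leq_card; apply/subsetP=> x Xx; apply: maxZ; last exact: eX.
    apply/setIP; split; first exact: (subsetP sXS).
    by apply: (subsetP (_ : X \subset 'C(S))) => //; rewrite centsC (subset_trans sSM).
  by rewrite oX oZ leqNgt -{1}(expn1 p) ltn_exp2l.
have : M \proper 'N_S(M).
  by apply: nilpotent_proper_norm (pgroup_nil pS) _; rewrite properE sMS.
case/properP=> _ [g /setIP[Sg nMg] nMg']; exists g; last first.
  by apply: contra nMg' => cXg; rewrite inE Sg.
rewrite inE Sg /= inE; apply/subsetP=> _ /imsetP[x Xx ->].
apply: Z_in_X; last by rewrite -conjXg eX // conj1g.
by rewrite memJ_norm ?(subsetP sXZM) // (subsetP (char_norms (center_char M))).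
Qed.

Lemma core_fusion_contradiction : False.
Proof.
(* The extension [f] embeds [M] in the centraliser [M'] of [X'], perhaps properly; so the later
   argument runs in [M'], and the normaliser of [E'] has to be computed anew there. *)
have [f0 Ff0 fnX] := fully_normalized_exists fusF sXS.
have [f Ff ff0] := saturated_extend satF Ff0 fnX.
have eqfX : f @: X = f0 @: X by apply/esym/eq_in_imset.
rewrite -eqfX in fnX.
pose phi := Morphism (fusion_morph fusF Ff).
have injphi : 'injm phi by apply/injmP; apply: (fusion_inj fusF Ff).
have phiE (Q : {set gT}) : Q \subset M -> phi @* Q = f @: Q by move=> s; rewrite morphimEsub.
pose X' := (phi @* X)%G; pose E' := (phi @* E)%G; pose T' := (phi @* T)%G.
pose M' := 'C_S(X')%G.
have FXf : F X f := fusion_restrict fusF sXM Ff.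
have FEf : F E f := fusion_restrict fusF sEM Ff.
have abX' : abelian X' by rewrite morphim_abelian.
have phiM : phi @* M \subset M'.
  rewrite subsetI /= {1}morphimEdom (fusion_im fusF Ff) /=.
  by rewrite morphim_cents.
have sE'M' : E' \subset M' by apply: subset_trans phiM; apply: morphimS.
have sX'M' : X' \subset M' by apply: subset_trans phiM; apply: morphimS.
have sX'Z : X' \subset 'Z(M') by rewrite subsetI sX'M' centsC subsetIr.
have sM'S : M' \subset S by apply: subsetIl.
have cE : Fconj F E E' by exists f => //; rewrite /= phiE.
have [cSE' leN] := essE cE.
(* Equality follows by order, since the normaliser of [E] in [S] is largest among those of its
   conjugates. *)
have NT : 'N_M'(E') = T'.
  apply/esym/eqP; rewrite eqEcard; apply/andP; split.
    rewrite subsetI (subset_trans (morphimS phi sTM)) //=.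
    by apply: morphim_norms; apply: subsetIr.
  rewrite card_injm //; apply: leq_trans leN; apply: subset_leq_card.
  by apply: setSI.
have core' : core_pair p 'N_M'(E')%G E' X'.
  have -> : 'N_M'(E')%G = T' by apply: group_inj.
  exact: core_pair_injm injphi sTM sET coreE.
have [fi Ffi fiK] := fusion_inv fusF FXf.
have fiX y : y \in f @: X -> fi y \in X by case/imsetP=> x Xx ->; rewrite fiK.
have X'E : X' :=: f @: X by rewrite /= phiE.
(* Transported by [f], an automorphism of [X] in F becomes one of the fully normalised [X'], so it
   extends to [M']; the extension preserves [M'] because it preserves [X']. *)
have lift (k : {ffun gT -> gT}) : F X k -> k @: X \subset X ->
    exists2 c : {perm gT}, c \in Aut M' & {in X, forall x, c (f x) = f (k x)}.
  move=> Fk kX.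
  have Fkf : F (f @: X) [ffun y => k (fi y)].
    by apply: (fusion_comp fusF) Ffi Fk _; apply/subsetP=> _ /imsetP[y fXy ->]; apply: fiX.
  have kfX : [ffun y => k (fi y)] @: (f @: X) \subset X.
    apply/subsetP=> _ /imsetP[y fXy ->]; rewrite ffunE (subsetP kX) //.
    by apply: imset_f; apply: fiX.
  have Fh := fusion_comp fusF Fkf FXf kfX; set h := finfun _ in Fh.
  have hE x : x \in X -> h (f x) = f (k x).
    by move=> Xx; rewrite !ffunE fiK.
  have hX' : h @: X' = X'.
    have ch : #|h @: X'| = #|X'|.
      by apply: card_in_imset; rewrite X'E; apply: (fusion_inj fusF Fh).
    apply/eqP; rewrite eqEcard ch leqnn andbT.
    rewrite {1}X'E; apply/subsetP=> _ /imsetP[_ /imsetP[x Xx ->] ->].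
    by rewrite hE // X'E imset_f // (subsetP kX) // imset_f.
  rewrite -X'E in Fh; have fnh : fully_normalized S F (h @: X') by rewrite hX' X'E.
  have [hh Fhh hhE] := saturated_extend satF Fh fnh.
  have sub : hh @: M' \subset M'.
    apply/subsetP=> _ /imsetP[m Mm ->]; apply/setIP; split.
      by apply: (subsetP (fusion_im fusF Fhh)); apply: imset_f.
    apply/centP=> y; rewrite -{1}hX' => /imsetP[x X'x ->]; rewrite hhE //.
    have Mx := subsetP sX'M' x X'x; have [_ cXm] := setIP Mm.
    by rewrite /commute -!(fusion_morph fusF Fhh) // (centP cXm x X'x).
  have [c Ac cE'] := fusion_aut fusF Fhh sub; exists c => // x Xx.
  have X'fx : f x \in X' by rewrite X'E imset_f.
  by rewrite cE' ?(subsetP sX'M') // -hhE // hE.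
have [g Ng nCg] := g_ex; have [Sg nXg] := setIP Ng.
have Xg x : x \in X -> x ^ g \in X by move=> Xx; rewrite memJ_norm.
(* Conjugation by [g] lifts to [t], which will be a transvection of [X'] with centre the image of
   [Z]; [a] lifts to [c], which moves that centre. *)
have [t At tE] : exists2 c : {perm gT}, c \in Aut M' & {in X, forall x, c (f x) = f (x ^ g)}.
  have [||c Ac ce] := lift [ffun x => x ^ g].
  - exact: (fusion_conj fusF).
  - by apply/subsetP=> _ /imsetP[x Xx ->]; rewrite ffunE Xg.
  by exists c => // x Xx; rewrite ce // ffunE.
have aX x : x \in X -> a x \in X.
  move=> Xx; apply: maxX.
    by rewrite (char_Aut AaE (center_char E)) // (subsetP sXZ).
  by rewrite -(AutX AaE) ?(subsetP sXE) // eX // (Aut1E AaE).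
have [c Ac cEx] : exists2 c : {perm gT}, c \in Aut M' & {in X, forall x, c (f x) = f (a x)}.
  have [||c Ac ce] := lift [ffun x => a x].
  - have /AutFP[_ FEa] := Aa; exact: (fusion_restrict fusF sXE FEa).
  - by apply/subsetP=> _ /imsetP[x Xx ->]; rewrite ffunE aX.
  by exists c => // x Xx; rewrite ce // ffunE.
have sE'X : E^`(1) \subset X := core_der_sub p_pr pE coreE.
have sZM := subset_trans sZX sXM; have sE'M := subset_trans sE'X sXM.
have memf x (Q : {set gT}) : Q \subset M -> x \in X -> (f x \in phi @* Q) = (x \in Q).
  by move=> sQM Xx; rewrite -(@mem_morphim_injm _ _ M phi) // (subsetP sXM).
have X'P y : y \in X' -> exists2 x, x \in X & y = f x.
  by rewrite X'E => /imsetP.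
have fM x y : x \in X -> y \in X -> f (x * y) = f x * f y.
  by apply: (fusion_morph fusF FXf).
have fV x : x \in X -> f x^-1 = (f x)^-1.
  move=> Xx; apply: (mulgI (f x)); rewrite -fM ?groupV // !mulgV.
  exact: (morph1 phi).
have iXZ : #|X : Z| <= p by rewrite -divgS // oX oZ expnS expn1 mulnK.
have nsXN : X <| 'N_S(X) by rewrite normalSG.
have pN : p.-group 'N_S(X) := pgroupS (subsetIl _ _) pS.
have nsZN : Z <| 'N_S(X).
  by apply: normalS nsZS; rewrite ?subsetIl // (subset_trans sZX) ?normal_sub.
have gZ x : x \in X -> x^-1 * x ^ g \in Z.
  move=> Xx; rewrite -commgEl.
  exact: pgroup_index_p_comm p_pr pN sZX (normal_sub nsXN) nsZN nsXN iXZ x g Xx Ng.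
have Zfix z : z \in Z -> z ^ g = z.
  move=> Zz; apply/conjg_fixP/commgP.
  by have /centerP[_] := subsetP sZZS z Zz; apply.
have fixZ x : x \in X -> (x ^ g == x) = (x \in Z).
  move=> Xx; apply/idP/idP => [/eqP xg | /Zfix-> //].
  apply: contraR nCg => nZx; apply/centP=> y Xy.
  have nsZX : Z <| X by rewrite -sub_abelian_normal.
  have leXZ : #|X| <= p * #|Z| by rewrite oX oZ.
  have [k Zk] := quotient_p_combine p_pr pX nsZX leXZ Xx nZx Xy.
  apply/commute_sym/commgP/conjg_fixP; apply: (mulIg (x ^+ k)).
  by rewrite -{1}xg -conjXg -conjMg Zfix.
pose D' := (E' ^`(1))%G.
have D'E : D' :=: phi @* E^`(1) by rewrite /= morphim_der.
pose Z' := (phi @* Z)%G.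
have pX' : p.-group X' by rewrite morphim_pgroup.
have oX' : #|X'| = (p ^ 2)%N by rewrite card_injm.
have oZ' : #|Z'| = p by rewrite card_injm.
have oD' : #|D'| = p := core_der core'.
have sZX' : Z' \subset X' by apply: morphimS.
have sDX' : D' \subset X' by rewrite D'E; apply: morphimS.
have tX : {in X', forall x, x^-1 * t x \in Z'}.
  move=> _ /X'P[x Xx ->]; rewrite tE // -fV // -fM ?groupV ?Xg // memf //.
    exact: gZ.
  by rewrite groupM ?groupV ?Xg.
have tfix : {in X', forall x, (t x == x) = (x \in Z')}.
  move=> _ /X'P[x Xx ->]; rewrite tE // memf // -fixZ //.
  by rewrite (inj_in_eq (fusion_inj fusF FXf)) ?Xg.
have cX : {in X', forall x, c x \in X'}.
  by move=> _ /X'P[x Xx ->]; rewrite cEx // X'E imset_f ?aX.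
have nDZ' : ~~ (D' \subset Z') by rewrite D'E injmSK.
have cZ : ~~ [forall z in Z', c z \in Z'].
  have /forall_inPn[z Zz naz] := aZ; apply/forall_inPn; exists (f z).
    by rewrite memf // (subsetP sZX).
  have Xz := subsetP sZX z Zz.
  by rewrite cEx // memf // aX.
have [r [Ar rD rX rn]] := transvections_center p_pr pX' abX' sX'M' oX' oZ' oD' sZX' sDX'
  At Ac cX tX tfix nDZ' cZ.
have irr := transvections_irreducible p_pr pX' oX' oZ' At Ac tX tfix cZ.
have cME' : 'C_M'(E') \subset E'.
  apply: subset_trans cSE'; exact: setSI.
have rkM' (L : {group gT}) : L \subset M' -> 'm(L) <= 3.
  by move=> sLM; apply: rkS; apply: subset_trans sM'S.
exact: (core_contradiction p_pr odd_p (pgroupS sM'S pS) rkM' sE'M' sX'Z cME' core' irr Ar rD rX rn).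
Qed.
End CoreFusion.

(** * The two cases for the centraliser of X in T *)

Theorem theorem5p6 (gT : finGroupType) (p : nat) (S E : {group gT}) (F : fsys gT) :
  prime p -> odd p -> p.-group S ->
  sectional_rank S 3 ->
  saturated p S F ->
  F_essential p S F E ->
  ~ F_characteristic S F E ->
  'Ohm_1('Z(S)) \proper Z_E F S E ->
  abelian E.
Proof.
move=> p_pr odd_p pS [rkS _] satF [_ sES essE strongE] nchE ltZ.
have [fusF _] := satF; apply: contraT => nabE.
pose X := 'Ohm_1('Z(E))%G; pose Zs := 'Ohm_1('Z(S))%G.
have pE := pgroupS sES pS.
have [cSE _] := essE _ (Fconj_refl fusF sES).
pose A := Group (AutF_group_set fusF sES).
have sAA : A \subset Aut E by apply/subsetP=> a /AutFP[].
have chX : X \char E := char_trans (Ohm_char 1 _) (center_char E).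
have sXZ : X \subset 'Z(E) := Ohm_sub 1 _.
have sXE : X \subset E := subset_trans sXZ (center_sub E).
have XP x := @Ohm1_centerP _ p E x p_pr pE.
have ZP x := @Ohm1_centerP _ p S x p_pr pS.
have sZsX : Zs \subset X.
  apply/subsetP=> z /ZP[/centerP[Sz cSz] zp]; apply/XP; split=> //.
  have cEz : {in E, forall y, commute z y} by move=> y Ey; apply/cSz/(subsetP sES).
  apply/centerP; split=> //; apply: (subsetP cSE); rewrite inE Sz.
  by apply/centP=> y Ey; apply: cEz.
have pX : p.-group X := pgroupS sXE pE.
have pZs := pgroupS sZsX pX.
have ntZs : Zs :!=: 1.
  rewrite /= Ohm1_eq1 center_nil_eq1 ?(pgroup_nil pS) //.
  by apply: contra nabE => /eqP S1; apply: (abelianS sES); rewrite S1 abelian1.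
have ZE_sub (K : {group gT}) : {in A & Zs, forall (a : {perm gT}) z, a z \in K} ->
    Z_E F S E \subset K.
  move=> AK; rewrite gen_subG; apply/bigcupsP=> a Aa.
  by apply/subsetP=> _ /imsetP[z Zz ->]; apply: AK.
have AX : {in A & Zs, forall (a : {perm gT}) z, a z \in X}.
  by move=> a z Aa /(subsetP sZsX); apply: char_Aut chX; apply: (subsetP sAA).
have ninv : ~ {in A & Zs, forall (a : {perm gT}) z, a z \in Zs}.
  by move=> /ZE_sub; have /andP[_ /negP] := ltZ.
have ltZX : Zs \proper X := proper_sub_trans ltZ (ZE_sub X AX).
have geZs : p <= #|Zs|.
  have pZs1 : 1%G \proper Zs by rewrite proper1G.
  by have := proper_pgroup_card p_pr pZs pZs1; rewrite cards1 muln1.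
have leX : p * #|Zs| <= #|X| := proper_pgroup_card p_pr pX ltZX.
have geX : p ^ 2 <= #|X| by apply: leq_trans leX; rewrite leq_pmul2l ?prime_gt0.
have inner := essential_pcore_inner fusF p_pr sES (erefl _ : A :=: AutF F E) strongE.
pose T := 'N_S(E)%G; have sTS : T \subset S := subsetIl _ _.
have nsET : E <| T by rewrite normalSG.
have sET := normal_sub nsET.
have TA : {in T, forall t, conj_aut E t \in A}.
  by move=> t Tt; apply: (conj_aut_AutF fusF).
have Zs_cent z s : z \in Zs -> s \in S -> z ^ s = z.
  by case/ZP=> /centerP[_ cz] _ Ss; apply/conjg_fixP/commgP/cz.
have [al [Aal al_moves al_Zs]] : exists al : {perm gT},
    [/\ al \in Aut T, al @: E != E & {in Zs, forall z, al z \in Zs}].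
  have [sSN | nSN] := boolP (S \subset T).
    have eqT : T :=: S by apply/eqP; rewrite eqEsubset sTS.
    have /exists_inP[a /AutFP[Aa _] na] : [exists a in AutF F S, a @: E != E].
      apply: contraT => /exists_inPn ex; case: nchE => a Aa.
      by apply/eqP; have := ex a Aa; rewrite negbK.
    exists a; rewrite eqT; split=> // z Zz.
    exact: (char_Aut Aa (char_trans (Ohm_char 1 _) (center_char S))).
  have : T \proper 'N_S(T).
    by apply: nilpotent_proper_norm (pgroup_nil pS) _; rewrite properE sTS.
  case/properP=> _ [g /setIP[Sg nTg] nTg']; exists (conj_aut T g).
  split=> [||z Zz]; first exact: Aut_aut.
    apply: contra nTg' => /eqP eqE; rewrite inE Sg inE; apply/subsetP=> _ /imsetP[x Ex ->].
    by rewrite -eqE -(norm_conj_autE nTg) ?(subsetP sET) // imset_f.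
  by rewrite norm_conj_autE ?Zs_cent // (subsetP sET) // (subsetP sXE) // (subsetP sZsX).
have [cTX | ncTX] := boolP ('C_T(X) \subset E).
  case: ninv.
  exact: (moved_subgroup_invariant p_pr pS rkS sTS nsET nabE cTX geX sAA TA inner Aal al_moves sZsX ntZs al_Zs).
pose T0 := 'C_T(X)%G.
have cEX : E \subset 'C(X) by rewrite centsC (subset_trans sXZ) ?subsetIr.
have sET0 : E \subset T0 by rewrite subsetI sET.
have sT0T : T0 \subset T := subsetIl _ _.
pose N := ('C_A(X | 'P))%G.
have NP a : reflect (a \in A /\ {in X, forall x, a x = x}) (a \in N).
  apply: (iffP setIP) => [[Aa /astabP aX] | [Aa aX]]; split=> //.
  by apply/astabP.
have nsNA : N <| A.
  apply/andP; split; first exact: subsetIl.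
  apply/subsetP=> c Ac; rewrite inE; apply/subsetP=> _ /imsetP[a /NP[Aa aX] ->].
  apply/NP; split=> [|x Xx]; first by rewrite groupJ.
  have AcE := subsetP sAA c Ac.
  have [y Ey dx] := Aut_preimage AcE (subsetP sXE x Xx).
  have Xy : y \in X by rewrite -(char_AutE AcE chX) // -dx.
  by rewrite dx permJ aX.
have core : core_pair p T0 E X.
  apply: (@core_structure _ p S T0 E N) => //.
  - exact: subset_trans sT0T sTS.
  - exact: normalS sET0 sT0T nsET.
  - by apply: subset_trans cSE; rewrite setSI // (subset_trans sT0T).
  - exact: subsetIr.
  - exact: subset_trans (normal_sub nsNA) sAA.
  - by move=> a x /NP[_]; apply.
  - move=> t /setIP[Tt cXt]; apply/NP; split=> [|x Xx]; first exact: TA.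
    rewrite norm_conj_autE ?(subsetP sXE) //; last by case/setIP: Tt.
    by apply/conjg_fixP/commgP/commute_sym; apply: (centP cXt).
  (* [B] is normal only in [N], so [inner] is applied to ['O_p(N)], which contains [B] and is normal
     in [A]. *)
  move=> B nsBN pB a Ba; apply: (inner 'O_p(N)%G).
  - exact: char_normal_trans (pcore_char p N) nsNA.
  - exact: pcore_pgroup.
  exact: (subsetP (pcore_max pB nsBN)).
have oX := core_card core; have oE' := core_der core.
have oZs : #|Zs| = p.
  apply/eqP; rewrite eqn_leq geZs andbT -(leq_pmul2l (prime_gt0 p_pr)).
  by apply: leq_trans leX _; rewrite oX.
have sE'X : E^`(1) \subset X := core_der_sub p_pr pE core.
(* Were E' inside [Zs], they would coincide by order, and [Zs] would be characteristic in [E]. *)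
have nE'Zs : ~~ (E^`(1) \subset Zs).
  apply/negP=> sE'Zs; case: ninv => a z Aa.
  have <- : E^`(1) = Zs by apply/eqP; rewrite eqEcard sE'Zs oE' oZs leqnn.
  exact: (@char_Aut _ E a (subsetP sAA a Aa) E^`(1)%G z (der_char 1 E)).
have cTX : T \subset 'C(X).
  apply/subsetP=> t Tt; apply/centP=> x Xx.
  have [e E'e nZe] := subsetPn nE'Zs.
  have nsE'T : E^`(1)%G <| T := char_normal_trans (der_char 1 E) nsET.
  have i1 : #|E^`(1)%G : [1 gT]%G| <= p by rewrite indexg1 oE'.
  (* E' has order [p] and is normal in the p-group [T], hence central in it. *)
  have et : e ^ t = e.
    apply/conjg_fixP; have := pgroup_index_p_comm p_pr (pgroupS sTS pS) (sub1G _)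
      (normal_sub nsE'T) (normal1 T) nsE'T i1 E'e Tt.
    by move/set1P=> ->.
  have abX : abelian X := abelianS sXZ (center_abelian E).
  have nsZX : Zs <| X by rewrite -sub_abelian_normal.
  have leXZ : #|X| <= p * #|Zs| by rewrite oX oZs.
  have [k Zk] := quotient_p_combine p_pr pX nsZX leXZ (subsetP sE'X e E'e) nZe Xx.
  apply/commute_sym/commgP/conjg_fixP; apply: (mulIg (e ^+ k)).
  by rewrite -{1}et -conjXg -conjMg Zs_cent // (subsetP sTS).
have eqT : T0 = T by apply: group_inj; apply/setIidPl.
rewrite eqT in core.
have [a Aa aZ] : exists2 a : {perm gT}, a \in A & ~~ [forall z in Zs, a z \in Zs].
  apply/exists_inP; apply: contraT => /exists_inPn all; case: ninv => a z Aa Zz.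
  by have := all a Aa; rewrite negbK => /forall_inP; apply.
have sZsZS : Zs \subset 'Z(S) := Ohm_sub 1 _.
have maxZ : {in 'Z(S), forall x, x ^+ p = 1 -> x \in Zs}.
  by move=> x Zx xp; apply/ZP.
case: (core_fusion_contradiction p_pr odd_p pS rkS satF sES essE core cTX sZsX oZs sZsZS maxZ Aa aZ nE'Zs).
Qed.
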